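(* Let $D$ be a bounded domain in $\mathbb{C}$ with real analytic boundary and fix $w\in D$. Suppose that $p$ is a smooth scalar function defined in a neighborhood of $D$ with corresponding multiplication operator $P$, $P\phi=p\phi$. Let $g_w=g(\cdot,w)$ be the Green function of the Laplacian on $D$, and let $T$ be the operator of integration against $g$, i.e. $T\phi(z)=\int_D \phi(\xi)g(z,\xi)\,dA(\xi)$. The Green function $g^*$ of the Schrödinger operator $\Delta-\epsilon p$ on $D$, with $g^*_w=g^*(\cdot,w)$, satisfies $$g^*_w-g_w=\epsilon\,TPg_w+o(\epsilon)$$ as $\epsilon\to 0$, where the convergence of $o(\epsilon)$ is uniform in $z$ for each fixed $w$. Furthermore, a full series expansion is given by $$g^*_w=\sum_{n=0}^\infty \epsilon^n (TP)^n g_w.$$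
   Context: Here $dA$ is area measure on $\mathbb{C}$ and $\Delta$ is the Laplacian. The Green function $g:D\times D\to[-\infty,\infty)$ of $D$ is the function such that for each $w\in D$: $g(\cdot,w)$ is harmonic on $D\setminus\{w\}$ and bounded outside every neighborhood of $w$; $g(w,w)=-\infty$ and $g(z,w)=\frac{1}{2\pi}\log|z-w|+O(1)$ as $z\to w$; and $g(z,w)\to 0$ as $z\to\zeta$ for every $\zeta\in\partial D$ (every boundary point qualifies because the boundary is real analytic). Equivalently, $g_w=g(\cdot,w)$ solves $\Delta g_w=\delta_w$ in $D$ with $g_w=0$ on $\partial D$, where $\delta_w$ is the Dirac delta at $w$. For a differential operator $L$, the Green function $g^*$ of $L$ on $D$ is defined analogously: $g^*_w=g^*(\cdot,w)$ solves $Lg^*_w=\delta_w$ in $D$ with $g^*_w=0$ on $\partial D$. Here $L=\Delta-\epsilon p$, so that $\Delta g^*_w-\epsilon p\,g^*_w=\delta_w$ in $D$, and $g^*$ depends on $\epsilon$. $(TP)^n$ is the $n$-fold iterate of the composition $TP$ (first multiply by $p$, then apply $T$), with $(TP)^0$ the identity. *)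

(* Defs.v *)
From HB Require Import structures.
From mathcomp Require Import all_boot all_order all_algebra.
From mathcomp Require Import all_classical all_reals all_analysis.

Set Implicit Arguments.
Unset Strict Implicit.
Unset Printing Implicit Defensive.

Import Order.TTheory GRing.Theory Num.Theory.
Import numFieldNormedType.Exports.

Local Open Scope classical_set_scope.
Local Open Scope ring_scope.

(* The complex plane is R * R, the point (x, y) standing for x + i y. *)

Section Plane.
Context {R : realType}.
Implicit Types (D U : set (R * R)) (f rho : R * R -> R) (z w : R * R).

(* The library norm on R * R is the max norm, so the modulus is needed. *)
Definition cmod z : R := Num.sqrt (z.1 ^+ 2 + z.2 ^+ 2).

Definition area :
    {measure set (measurableTypeR R * measurableTypeR R) -> \bar R} :=
  (lebesgue_measure \x lebesgue_measure)%E.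

Definition dx f z : R := 'D_((1, 0) : R * R) f z.
Definition dy f z : R := 'D_((0, 1) : R * R) f z.

Definition laplacian f z : R := dx (dx f) z + dy (dy f) z.

Fixpoint Ck (k : nat) U f : Prop :=
  {in U, continuous f} /\
  if k is k'.+1 then
    [/\ forall z, U z -> derivable f z ((1, 0) : R * R)
                      /\ derivable f z ((0, 1) : R * R),
        Ck k' U (dx f) & Ck k' U (dy f)]
  else True.

Definition smooth U f : Prop := forall k, Ck k U f.

Definition harmonic U f : Prop :=
  Ck 2 U f /\ forall z, U z -> laplacian f z = 0.

(* The k-th term of the series is the homogeneous part of degree k of the
   Taylor expansion. *)
Definition real_analytic_at f z : Prop :=
  exists (a : nat -> nat -> R) (r : R),
  [/\ 0 < r,
      cvgn (series (fun k => \sum_(i < k.+1) `|a i (k - i)%N| * r ^+ k)) &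
      forall x : R * R, `|x.1 - z.1| < r -> `|x.2 - z.2| < r ->
        series (fun k => \sum_(i < k.+1) a i (k - i)%N *
                  (x.1 - z.1) ^+ i * (x.2 - z.2) ^+ (k - i)) @ \oo --> f x].

Definition boundary D : set (R * R) := closure D `\` D°.

Definition real_analytic_boundary D : Prop :=
  forall zeta, boundary D zeta -> exists rho,
  [/\ real_analytic_at rho zeta,
      ~ (dx rho zeta = 0 /\ dy rho zeta = 0) &
      \forall z \near zeta, D z <-> rho z < 0].

Definition bounded_domain D : Prop :=
  [/\ D !=set0, open D, connected D & bounded_set D].

Definition vanishes_on_boundary D (u : R * R -> \bar R) : Prop :=
  forall zeta, boundary D zeta -> u @ within D (nbhs zeta) --> 0%E.

(* Values outside D * D are irrelevant. *)
Definition green_function D (g : R * R -> R * R -> \bar R) : Prop :=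
  forall w, D w ->
  let u := fun z => g z w in
  [/\ u w = -oo%E,
      (forall z, D z -> z <> w -> u z \is a fin_num) /\
        harmonic (D `\ w) (fine \o u),
      (forall V, nbhs w V -> [bounded fine (u z) | z in D `\` V]),
      bounded_near (fun z => fine (u z) - (2 * pi)^-1 * ln (cmod (z - w)))
        w^' &
      vanishes_on_boundary D u].

Definition test_function D (phi : R * R -> R) : Prop :=
  smooth setT phi /\
  exists K : set (R * R),
    [/\ compact K, K `<=` D & forall z, ~ K z -> phi z = 0].

Definition schrodinger (q f : R * R -> R) z : R := laplacian f z - q z * f z.

(* L u = delta_w in the sense of distributions on D, for L = Laplacian - q;
   this L is its own transpose, hence acts as L on the test function. *)
Definition fundamental_solution D (q : R * R -> R) w (u : R * R -> \bar R) :=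
  (forall K : set (R * R), compact K -> K `<=` D -> area.-integrable K u) /\
  forall phi, test_function D phi ->
    (\int[area]_(z in D) (u z * (schrodinger q phi z)%:E) = (phi w)%:E)%E.

(* A distributional solution is only determined almost everywhere; continuity
   off the pole and the value -oo at the pole select the pointwise
   representative. *)
Definition schrodinger_green_function D (q : R * R -> R)
    (G : R * R -> R * R -> \bar R) : Prop :=
  forall w, D w ->
  let u := fun z => G z w in
  [/\ u w = -oo%E,
      (forall z, D z -> z <> w -> u z \is a fin_num) /\
        {in D `\ w, continuous (fine \o u)},
      fundamental_solution D q w u &
      vanishes_on_boundary D u].

(* The operators act on extended-real functions, because g(., w) is -oo at w. *)
Definition mult_op (p : R * R -> R) (phi : R * R -> \bar R) z : \bar R :=
  ((p z)%:E * phi z)%E.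

Definition green_op D (g : R * R -> R * R -> \bar R) (phi : R * R -> \bar R)
    z : \bar R :=
  (\int[area]_(xi in D) (phi xi * g z xi))%E.

End Plane.

(* Main.v *)
Require Import Defs.
From HB Require Import structures.
From mathcomp Require Import all_boot all_order all_algebra.
From mathcomp Require Import all_classical all_reals all_analysis.
From mathcomp Require Import measurable_realfun.
From mathcomp Require Import ring lra.
Import Order.TTheory GRing.Theory Num.Theory.
Import numFieldNormedType.Exports.
Local Open Scope classical_set_scope.
Local Open Scope ring_scope.

(** The perturbed Green function U, with pole w, satisfies the integral
    equation U(z) = G_w(z) + eps T(p U)(z) for z <> w, where G_w is the Green
    function of the Laplacian and T is integration against G_z (lemma
    [integral_equation]). Once this is known, the expansion is a Neumann
    series. The remainders r_n = U - sum_(k < n) eps^k (TP)^k G_w satisfy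
    r_(n+1) = eps T(p r_n) ([remainder_rec]), and
    theta = |eps| sup |p| sup_z (integral of a majorant of |G_z|) is small with
    eps. As |G_z| and G_z^2 have a majorant whose integral does not exceed a
    constant independent of z, r_1 is at most 4 theta ([remainder1_bound]) and
    every further step gains a factor theta ([remainder_bound]). The bound on
    r_2 is the first assertion, the decay of r_n the second. At the pole itself
    both sides are -oo.

    The solution is given in the sense of distributions, and the natural test
    function G_z is neither smooth at z nor compactly supported. The idea is to
    test with F(G_z), where F vanishes near 0 and is constant near -oo. As G_z is
    harmonic off z, the Laplacian of F(G_z) is F''(G_z) |grad G_z|^2, which is
    carried by two bands, one near the boundary and one near the pole. The
    divergence theorem shows that the weight of a band has a total mass that
    depends neither on its width nor on its position ([flux_hat]), so such a
    weight computes averages ([window]). When the bands move to the boundary,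
    where U tends to 0, and to the pole, where U is continuous, the weak equation
    becomes the integral equation up to the factor given by the total mass
    ([representation]). The total mass is 1 for (2 pi)^-1 log |z - a|, by a
    Gaussian integral ([flux_Lam]), hence also for G_a by comparison
    ([flux_gam]). The same averages, taken with respect to the logarithm, give
    the strict negativity of G_a ([gam_lt0]), and [representation] applied to a
    Green function gives the symmetry G_a(b) = G_b(a) ([gam_sym]). As F is only
    of class C^2, the weak equation is first extended from smooth to C^2 test
    functions by mollification ([fundamental_C2]).

    The remaining estimates follow from the comparison
    (2 pi)^-1 log |z - a| - C <= G_a(z) <= 0, with C independent of a, which is
    the maximum principle ([gam_lower]). It bounds |G_a| and G_a^2 by a
    multiple of 1 + |z - a|^(-1/2) ([gam_kB]). Boundedness of r_1, without which
    the contraction argument cannot start, is obtained by inserting the integral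
    equation into itself once and exchanging the integrals ([apriori_bound]).
    The iterates of T are measurable because truncating G_z from below yields
    integrals that are continuous in z ([green_operator_measurable]). *)

(** * Directional derivatives in the plane *)

Section Calculus.
Set Implicit Arguments.
Unset Strict Implicit.
Context {R : realType}.
Implicit Types (U E K : set (R * R)) (f g v : R * R -> R) (z e : R * R).

Definition ex : R * R := (1, 0).
Definition ey : R * R := (0, 1).

(** Only derivatives along fixed directions occur, so each statement below is
    proved once for an arbitrary direction [e] and used for [ex] and [ey]. *)
Definition dd e f : R * R -> R := fun z => 'D_e f z.
Definition diffb e f z : Prop := derivable f z e.
Definition isd e f z (d : R) : Prop := is_derive z e f d.

Lemma isdP e f z d : isd e f z d <-> diffb e f z /\ dd e f z = d.
Proof. by split=> [[]|[a b]]; [|apply: DeriveDef]. Qed.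

Lemma isd_dd e f z : diffb e f z -> isd e f z (dd e f z).
Proof. by move=> h; apply/isdP. Qed.

(** Restricting to the line through z in direction e gives access to the chain
    rule in one real variable. *)
Lemma isd_slice f z e df :
  isd e f z df <-> is_derive (0 : R) 1 (fun h => f (h *: e + z)) df.
Proof.
have E : 'D_e f z = 'D_1 (fun h : R => f (h *: e + z)) 0.
  rewrite /derive; set g1 := fun h => h^-1 *: _; set g2 := fun h => h^-1 *: _.
  suff -> : g1 = g2 by [].
  by apply/funext => h; rewrite /g1 /g2 /= addr0 scale0r add0r [_%:A]mulr1.
split=> -[d1 d2]; apply: DeriveDef.
- exact: (iffLR (derivable1P _ _ _) d1).
- by rewrite -E.
- exact: (iffRL (derivable1P _ _ _) d1).
- by rewrite E.
Qed.

Lemma isd_comp (F : R -> R) f z e dF df :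
  is_derive (f z) 1 F dF -> isd e f z df -> isd e (F \o f) z (dF * df).
Proof.
move=> dF1 /isd_slice df1; apply/isd_slice.
have h0 : f (0 *: e + z) = f z by rewrite scale0r add0r.
have [D1 D2] := df1; have [D3 D4] := dF1.
have D3' : derivable F (f (0 *: e + z)) 1 by rewrite h0.
apply: DeriveDef.
- have /derivable1_diffP d1 := D1; have /derivable1_diffP d3 := D3'.
  by apply/derivable1_diffP; exact: (differentiable_comp d1 d3).
- have := @derive1_comp _ (fun h : R => f (h *: e + z)) F 0 D1 D3'.
  by rewrite !derive1E h0 D2 D4 => <-.
Qed.

Lemma isdM e f g z df dg : isd e f z df -> isd e g z dg ->
  isd e (fun y => f y * g y) z (df * g z + f z * dg).
Proof.
move=> a b; apply: (is_derive_eq (is_deriveM a b)).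
by rewrite /GRing.scale /=; ring.
Qed.

Lemma isdD e f g z df dg : isd e f z df -> isd e g z dg ->
  isd e (fun y => f y + g y) z (df + dg).
Proof. by move=> a b; exact: is_deriveD. Qed.

Lemma isdB e f g z df dg : isd e f z df -> isd e g z dg ->
  isd e (fun y => f y - g y) z (df - dg).
Proof. by move=> a b; exact: is_deriveB. Qed.

Lemma isd_cst e (c : R) z : isd e (fun=> c) z 0.
Proof. exact: is_derive_cst. Qed.

Lemma is_derive_shift (c x : R) : is_derive x 1 (fun s : R => s - c) 1.
Proof.
by apply: is_derive_eq (is_deriveB (is_derive_id x 1) (is_derive_cst c x 1)) _;
  rewrite subr0.
Qed.

Lemma isd_near e f g z d : (\forall y \near z, f y = g y) ->
  isd e f z d -> isd e g z d.
Proof. exact: near_eq_is_derive. Qed.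

Lemma dd_near e f g z : (\forall y \near z, f y = g y) ->
  \forall y \near z, dd e f y = dd e g y.
Proof.
by move=> /near_join; apply: filterS => y fg; exact: near_eq_derive.
Qed.

Lemma continuous_near f g z : (\forall y \near z, f y = g y) ->
  {for z, continuous f} -> {for z, continuous g}.
Proof.
move=> fg cf; have e : g z = f z by rewrite (nbhs_singleton fg).
rewrite /prop_for /continuous_at e.
by apply: cvg_trans cf; apply: near_eq_cvg; apply: filterS fg => y /esym.
Qed.

Lemma dxE f : dx f = dd ex f. Proof. by []. Qed.
Lemma dyE f : dy f = dd ey f. Proof. by []. Qed.

Lemma laplacianE f z : laplacian f z = dd ex (dd ex f) z + dd ey (dd ey f) z.
Proof. by rewrite /laplacian !dxE !dyE. Qed.

(** The Laplacian involves pure second derivatives only, hence this notion of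
    class C^2 along one direction, without mixed derivatives. *)
Definition C2dir e U f := forall z, U z ->
  [/\ diffb e f z, diffb e (dd e f) z,
      {for z, continuous (dd e f)} & {for z, continuous (dd e (dd e f))}].

Definition C2 U f :=
  [/\ forall z, U z -> {for z, continuous f}, C2dir ex U f & C2dir ey U f].

Lemma Ck2_C2 U f : Ck 2 U f -> C2 U f.
Proof.
move=> H.
have [cf [d [cx [dxx [cxx _] _]] [cy [dyy _ [cyy _]]]]] :
  {in U, continuous f} /\ [/\ forall z, U z -> diffb ex f z /\ diffb ey f z,
    {in U, continuous (dd ex f)} /\
    [/\ forall z, U z -> diffb ex (dd ex f) z /\ diffb ey (dd ex f) z,
       {in U, continuous (dd ex (dd ex f))} /\ True &
       {in U, continuous (dd ey (dd ex f))} /\ True] &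
    {in U, continuous (dd ey f)} /\
    [/\ forall z, U z -> diffb ex (dd ey f) z /\ diffb ey (dd ey f) z,
       {in U, continuous (dd ex (dd ey f))} /\ True &
       {in U, continuous (dd ey (dd ey f))} /\ True]] := H.
split.
- by move=> z Uz; apply: cf; rewrite inE.
- move=> z Uz; split.
  + exact: (proj1 (d z Uz)).
  + exact: (proj1 (dxx z Uz)).
  + by apply: cx; rewrite inE.
  + by apply: cxx; rewrite inE.
- move=> z Uz; split.
  + exact: (proj2 (d z Uz)).
  + exact: (proj2 (dyy z Uz)).
  + by apply: cy; rewrite inE.
  + by apply: cyy; rewrite inE.
Qed.

Lemma C2dir_near e U f : (forall z, U z -> exists g V,
    [/\ V z, C2dir e V g & \forall y \near z, g y = f y]) -> C2dir e U f.
Proof.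
move=> H z Uz; have [g [V [Vz Cg gf]]] := H z Uz.
have [d1 d2 c1 c2] := Cg z Vz.
have g1 := dd_near e gf.
have g2 := dd_near e g1.
split.
- by have /isdP[] := isd_near gf (isd_dd d1).
- by have /isdP[] := isd_near g1 (isd_dd d2).
- exact: continuous_near g1 c1.
- exact: continuous_near g2 c2.
Qed.

Lemma dd_cst e (c : R) : dd e (fun=> c) = (fun=> 0).
Proof. by apply/funext => z; have /isdP[] := isd_cst e c z. Qed.

Lemma C2dir_cst e U (c : R) : C2dir e U (fun=> c).
Proof.
move=> z Uz; rewrite !dd_cst.
by split; [exact: derivable_cst|exact: derivable_cst|exact: cst_continuous..].
Qed.

Lemma continuous_comp_pt (F : R -> R) f z : {for z, continuous f} ->
  {for f z, continuous F} -> {for z, continuous (F \o f)}.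
Proof. by move=> cf cF; exact: continuous_comp. Qed.

Lemma is_derive_continuous (F F' : R -> R) :
  (forall t : R, is_derive t 1 F (F' t)) -> continuous F.
Proof.
move=> dF t; apply: differentiable_continuous; apply/derivable1_diffP.
by have [] := dF t.
Qed.

(** The second derivative of F(v) is F''(v) (d v)^2 + F'(v) d^2 v. When v is
    harmonic, the last terms cancel in the sum over both directions; the whole
    proof relies on this cancellation. *)
Lemma C2dir_comp e U v (F F' F'' : R -> R) : open U ->
  (forall z, U z -> {for z, continuous v}) ->
  C2dir e U v -> (forall t : R, is_derive t 1 F (F' t)) ->
  (forall t : R, is_derive t 1 F' (F'' t)) -> continuous F'' ->
  [/\ C2dir e U (F \o v),
      forall z, U z -> dd e (F \o v) z = F' (v z) * dd e v z &
      forall z, U z -> dd e (dd e (F \o v)) z =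
        F'' (v z) * dd e v z ^+ 2 + F' (v z) * dd e (dd e v) z].
Proof.
move=> oU cv Cv dF dF' cF''.
have cF' := is_derive_continuous dF'.
have D1 z : U z -> isd e (F \o v) z (F' (v z) * dd e v z).
  move=> Uz; apply: isd_comp => //.
  by apply: isd_dd; have [] := Cv z Uz.
have N1 z : U z -> \forall y \near z,
    (F' \o v) y * dd e v y = dd e (F \o v) y.
  move=> Uz; near=> y; have Uy : U y by near: y; exact: open_nbhs_nbhs.
  by have /isdP[_ ->] := D1 y Uy.
have D2 z : U z -> isd e (fun y => (F' \o v) y * dd e v y) z
    (F'' (v z) * dd e v z ^+ 2 + F' (v z) * dd e (dd e v) z).
  move=> Uz; have [d1 d2 _ _] := Cv z Uz.
  have a : isd e (F' \o v) z (F'' (v z) * dd e v z).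
    by apply: isd_comp => //; exact: isd_dd.
  have -> : F'' (v z) * dd e v z ^+ 2 + F' (v z) * dd e (dd e v) z =
     F'' (v z) * dd e v z * dd e v z + (F' \o v) z * dd e (dd e v) z.
    by rewrite /=; ring.
  exact: (isdM a (isd_dd d2)).
have D3 z : U z -> isd e (dd e (F \o v)) z
    (F'' (v z) * dd e v z ^+ 2 + F' (v z) * dd e (dd e v) z).
  by move=> Uz; apply: isd_near (N1 z Uz) (D2 z Uz).
have N2 z : U z -> \forall y \near z,
    (F'' \o v) y * (dd e v y * dd e v y) + (F' \o v) y * dd e (dd e v) y =
    dd e (dd e (F \o v)) y.
  move=> Uz; near=> y; have Uy : U y by near: y; exact: open_nbhs_nbhs.
  by have /isdP[_ ->] := D3 y Uy; rewrite expr2.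
split; last 2 first.
- by move=> z Uz; have /isdP[_ ->] := D1 z Uz.
- by move=> z Uz; have /isdP[_ ->] := D3 z Uz.
move=> z Uz; have [d1 d2 c1 c2] := Cv z Uz; have cvz := cv z Uz.
split.
- by have /isdP[] := D1 z Uz.
- by have /isdP[] := D3 z Uz.
- apply: (continuous_near (N1 z Uz)); apply: cvgM => //.
  by apply: continuous_comp_pt => //; exact: cF'.
- apply: (continuous_near (N2 z Uz)); apply: cvgD; apply: cvgM => //.
  + by apply: continuous_comp_pt => //; exact: cF''.
  + by apply: cvgM.
  + by apply: continuous_comp_pt => //; exact: cF'.
Unshelve. all: by end_near. Qed.

End Calculus.

(** * Measurability and compact supports in the plane *)

Section PlaneMeasure.
Set Implicit Arguments.
Unset Strict Implicit.
Context {R : realType}.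
Implicit Types (U E K : set (R * R)) (f g v : R * R -> R) (z e : R * R).
Local Notation P2 := (measurableTypeR R * measurableTypeR R)%type.

(** An open set is the union of the rectangles with rational corners that it
    contains. *)
Lemma open_measurable_plane (A : set P2) : open (A : set (R * R)) -> measurable A.
Proof.
move=> oA.
pose rect (q : (rat * rat) * (rat * rat)) : set P2 :=
  (`]ratr q.1.1, ratr q.1.2[%classic : set (measurableTypeR R))
  `*` (`]ratr q.2.1, ratr q.2.2[%classic : set (measurableTypeR R)).
pose F q := if `[< rect q `<=` A >] then rect q else set0.
have -> : A = \bigcup_q F q.
  apply/seteqP; split => [z Az|z [q _]]; last first.
    by rewrite /F; case: asboolP => // sub; exact: sub.
  have /nbhs_ballP[e /= e0 zA] : nbhs (z : R * R) A.
    exact: open_nbhs_nbhs.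
  have H (x : R) : exists a b : rat, [/\ x - e < ratr a, ratr a < x, x < ratr b
      & ratr b < x + e].
    have [|a] := @rat_in_itvoo _ (x - e) x; first by lra.
    rewrite in_itv => /andP[a1 a2].
    have [|b] := @rat_in_itvoo _ x (x + e); first by lra.
    by rewrite in_itv => /andP[b1 b2]; exists a, b.
  have [a [b [a1 a2 b1 b2]]] := H z.1.
  have [c [d [c1 c2 d1 d2]]] := H z.2.
  exists ((a, b), (c, d)) => //; rewrite /F; case: asboolP => [_|].
    by split => /=; rewrite in_itv /= ?a2 ?b1 ?c2 ?d1.
  case=> y [/=]; rewrite !in_itv /= => /andP[y1 y2] /andP[y3 y4].
  by apply: zA; split; rewrite /ball /= ltr_norml; apply/andP; split; lra.
apply: countable_bigcupT_measurable; first exact: countableP.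
move=> q; rewrite /F; case: asboolP => _; last exact: measurable0.
by apply: measurableX; exact: measurable_itv.
Qed.

Lemma closed_measurable_plane (A : set P2) : closed (A : set (R * R)) -> measurable A.
Proof.
move=> cA; rewrite -(setCK A); apply: measurableC; apply: open_measurable_plane.
exact: closed_openC.
Qed.

Lemma compact_measurable_plane (A : set P2) : compact (A : set (R * R)) -> measurable A.
Proof.
move=> cA; apply: closed_measurable_plane; exact: compact_closed.
Qed.

Lemma continuous_measurable_plane U (f : R * R -> R) : open U ->
  (forall z, U z -> {for z, continuous f}) ->
  measurable_fun (U : set P2) f.
Proof.
move=> oU cf; apply: (measurability _ (measurable_realfun.RGenOpens.measurableE R)) => //.
move=> _ [_ [a [b ->]] <-].
apply: open_measurable_plane.
rewrite openE => z [Uz /= fz].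
apply: filterI; first exact: open_nbhs_nbhs.
by apply: (cf z Uz); apply: open_nbhs_nbhs; split => //; exact: itv_open.
Qed.


Lemma isd_ex f (x y d : R) :
  isd ex f (x, y) d <-> is_derive x 1 (fun t : R => f (t, y)) d.
Proof.
have E : (fun h : R => h^-1 *: (f (h *: ex + (x, y)) - f (x, y))) =
         (fun h : R => h^-1 *: (f (h *: (1 : R) + x, y) - f (x, y))).
  apply/funext => h; congr (_ *: (f _ - _)).
  have -> : h *: ex + (x, y) = (h *: (1 : R) + x, h *: (0 : R) + y) by [].
  by rewrite scaler0 add0r.
split=> -[d1 d2]; apply: DeriveDef.
- by move: d1; rewrite /derivable E.
- by rewrite -d2 /derive E.
- by move: d1; rewrite /derivable -E.
- by rewrite -d2 /derive -E.
Qed.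

Lemma isd_ey f (x y d : R) :
  isd ey f (x, y) d <-> is_derive y 1 (fun t : R => f (x, t)) d.
Proof.
have E : (fun h : R => h^-1 *: (f (h *: ey + (x, y)) - f (x, y))) =
         (fun h : R => h^-1 *: (f (x, h *: (1 : R) + y) - f (x, y))).
  apply/funext => h; congr (_ *: (f _ - _)).
  have -> : h *: ey + (x, y) = (h *: (0 : R) + x, h *: (1 : R) + y) by [].
  by rewrite scaler0 add0r.
split=> -[d1 d2]; apply: DeriveDef.
- by move: d1; rewrite /derivable E.
- by rewrite -d2 /derive E.
- by move: d1; rewrite /derivable -E.
- by rewrite -d2 /derive -E.
Qed.

Definition box (B : R) : set P2 :=
  (`[- B, B]%classic : set (measurableTypeR R))
  `*` (`[- B, B]%classic : set (measurableTypeR R)).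

Lemma measurable_box B : measurable (box B).
Proof. by apply: measurableX; exact: measurable_itv. Qed.

Lemma area_box B : (area (box B) < +oo)%E.
Proof.
pose I : set R := `[- B, B]%classic.
have -> : area (box B) = (lebesgue_measure I * lebesgue_measure I)%E.
  by apply: product_measure1E; exact: measurable_itv.
rewrite /I lebesgue_measure_itv; case: ifP => _; last by rewrite mule0 ltry.
by rewrite -EFinB -EFinM ltry.
Qed.

Lemma bounded_box U : bounded_set U -> exists2 B, 0 < B & U `<=` box B.
Proof.
move=> [M [_ bM]]; exists (`|M| + 1); first by rewrite ltr_wpDl.
move=> z Uz; have /bM/(_ z Uz) : M < `|M| + 1.
  by rewrite (le_lt_trans (ler_norm M)) // ltrDl.
rewrite /= prod_normE /= ge_max => /andP[h1 h2].
by split; rewrite /= in_itv /= -ler_norml.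
Qed.

Lemma compact_box K : compact K -> exists2 B, 0 < B & K `<=` box B.
Proof. by move=> /compact_bounded/bounded_box. Qed.

Lemma box_compact B : compact (box B : set (R * R)).
Proof. by apply: compact_setX; exact: segment_compact. Qed.

Lemma continuous_compact_bounded (T : topologicalType) (K : set T) (f : T -> R) :
  compact K -> (forall x : T, K x -> {for x, continuous f}) ->
  exists2 M, 0 < M & forall x : T, K x -> `|f x| <= M.
Proof.
move=> cK cf.
have /compact_bounded[M [_ bM]] : compact (f @` K).
  by apply: continuous_compact cK; apply: continuous_in_subspaceT => z /set_mem; exact: cf.
exists (`|M| + 1); first by rewrite ltr_wpDl.
move=> z Kz; apply: (bM (`|M| + 1)); last by exists z.
by rewrite (le_lt_trans (ler_norm M)) // ltrDl.
Qed.

Definition vanish_off K f := forall z, ~ K z -> f z = 0.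

Definition Cc f := continuous f /\ exists2 K, compact K & vanish_off K f.

Lemma Cc_bounded f : Cc f -> exists2 M, 0 < M & forall z, `|f z| <= M.
Proof.
move=> [cf [K cK Kf]].
have [M M0 bM] := continuous_compact_bounded cK (fun z _ => cf z).
exists M => // z; case: (pselect (K z)) => Kz; first exact: bM.
by rewrite Kf // normr0 ltW.
Qed.

Lemma integrable_bounded_box (B : R) f : measurable_fun [set: P2] f ->
  (exists M, forall z, `|f z| <= M) -> (vanish_off (box B) f) ->
  area.-integrable setT (EFin \o f).
Proof.
move=> mf [M fM] fB.
have -> : EFin \o f = (EFin \o f) \_ (box B).
  apply/funext => z; rewrite patchE; case: ifPn => //.
  by rewrite notin_setE => /fB /= ->.
apply/(integrable_mkcond _ (measurable_box B)).
apply: measurable_bounded_integrable.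
- exact: measurable_box.
- exact: area_box.
- exact: measurable_funS mf.
- by exists M; split; [exact: num_real|move=> x Mx z _ /=; apply: le_trans (fM z) (ltW Mx)].
Qed.

Lemma continuous_measurableT f : continuous f -> measurable_fun [set: P2] f.
Proof.
move=> cf; apply: (@continuous_measurable_plane setT); first exact: openT.
by move=> z _; exact: cf.
Qed.

Lemma Cc_integrable f : Cc f -> area.-integrable setT (EFin \o f).
Proof.
move=> Cf; have [M _ fM] := Cc_bounded Cf; have [cf [K cK Kf]] := Cf.
have [B _ KB] := compact_box cK.
apply: (@integrable_bounded_box B).
- exact: continuous_measurableT.
- by exists M.
- by move=> z nz; apply: Kf => /KB.
Qed.

End PlaneMeasure.

(** * Green's second identity for compactly supported functions *)

Section IntegrationByParts.
Set Implicit Arguments.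
Unset Strict Implicit.
Context {R : realType}.
Implicit Types (U E K : set (R * R)) (f g v phi : R * R -> R) (z e : R * R).
Local Notation P2 := (measurableTypeR R * measurableTypeR R)%type.
Local Notation mu := (@lebesgue_measure R).

Definition intp f : R := (\int[area]_z f z)%R.

Lemma intp_Fubini f : area.-integrable setT (EFin \o f) ->
  (\int[mu]_x \int[mu]_y (f (x, y))%:E = \int[area]_z (f z)%:E)%E /\
  (\int[mu]_y \int[mu]_x (f (x, y))%:E = \int[area]_z (f z)%:E)%E.
Proof.
move=> fi; split.
- exact: (integral12_prod_meas1 fi).
- exact: (integral21_prod_meas1 fi).
Qed.

Lemma near_vanish K f z : compact K -> vanish_off K f -> ~ K z ->
  \forall y \near z, cst 0 y = f y.
Proof.
move=> cK fK nKz.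
have oK : open (~` K) by apply: closed_openC; apply: compact_closed.
have : \forall y \near z, (~` K) y by exact: open_nbhs_nbhs.
by apply: filterS => y /fK ->.
Qed.

Lemma vanish_dd K e f : compact K -> vanish_off K f -> vanish_off K (dd e f).
Proof.
move=> cK fK z nKz.
have /(dd_near e) H := near_vanish cK fK nKz.
by rewrite -(nbhs_singleton H) dd_cst.
Qed.

Lemma int_1d (h h' : R -> R) (B : R) : 0 < B ->
  (forall x : R, is_derive x 1 h (h' x)) -> continuous h' ->
  (forall x, B < `|x| -> h x = 0) ->
  (\int[mu]_x (h' x)%:E = 0)%E.
Proof.
move=> B0 dh ch' hB.
have h'0 x : B < `|x| -> h' x = 0.
  move=> Bx; have [_ <-] := dh x.
  have nx : \forall y \near x, cst 0 y = h y.
    have : \forall y \near x, B < `|y|.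
      have nc : {for x, continuous (fun y : R => `|y|)} by exact: norm_continuous.
      exact: (cvgr_gt _ nc _ Bx).
    by apply: filterS => y /hB ->.
  by have [_ ->] := near_eq_is_derive nx (is_derive_cst (0 : R) x 1).
have -> : (fun x => (h' x)%:E) = ((EFin \o h') \_ `[- (B + 1), B + 1]).
  apply/funext => x; rewrite patchE; case: ifPn => //.
  rewrite notin_setE /= in_itv /= -ler_norml => /negP; rewrite -ltNge => Bx.
  by rewrite h'0 // (lt_trans _ Bx) // ltrDl.
rewrite -integral_mkcond /= (@continuous_FTC2 _ h' h).
- by rewrite !hB ?sube0 // ?normrN gtr0_norm; lra.
- lra.
- by apply: continuous_subspaceT => x; exact: ch'.
- have ch := is_derive_continuous dh.
  split.
  + by move=> x _; have [] := dh x.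
  + by apply: cvg_at_right_filter; exact: ch.
  + by apply: cvg_at_left_filter; exact: ch.
- by move=> x _; rewrite derive1E; have [_ ->] := dh x.
Qed.

Lemma continuous_hline (y : R) : continuous (fun t : R => (t, y)).
Proof.
move=> x.
exact: (@cvg_pair _ _ _ (nbhs x) (nbhs x) (nbhs y) _ _ _ id (cst y)
  cvg_id (cvg_cst y)).
Qed.

Lemma continuous_vline (x : R) : continuous (fun t : R => (x, t)).
Proof.
move=> y.
exact: (@cvg_pair _ _ _ (nbhs y) (nbhs x) (nbhs y) _ _ _ (cst x) id
  (cvg_cst x) cvg_id).
Qed.

(** By Fubini this is the fundamental theorem of calculus on each horizontal
    line. *)
Lemma int_dd_ex K f : compact K -> vanish_off K f ->
  (forall z, diffb ex f z) -> continuous (dd ex f) -> intp (dd ex f) = 0.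
Proof.
move=> cK fK df cf'.
have C : Cc (dd ex f).
  by split => //; exists K => //; exact: vanish_dd.
have [B B0 KB] := compact_box cK.
have [_ E] := intp_Fubini (Cc_integrable C).
rewrite /intp /Rintegral -E integral0_eq // => y _.
apply: (@int_1d (fun x => f (x, y)) _ B) => //.
- by move=> x; exact: (iffLR (isd_ex f x y _) (isd_dd (df (x, y)))).
- move=> x; apply: (@continuous_comp _ _ _ (fun t : R => (t, y)) (dd ex f)).
    exact: continuous_hline.
  exact: cf'.
- move=> x Bx; apply: fK => /KB [/=].
  by rewrite in_itv /= -ler_norml leNgt Bx.
Qed.

Lemma int_dd_ey K f : compact K -> vanish_off K f ->
  (forall z, diffb ey f z) -> continuous (dd ey f) -> intp (dd ey f) = 0.
Proof.
move=> cK fK df cf'.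
have C : Cc (dd ey f).
  by split => //; exists K => //; exact: vanish_dd.
have [B B0 KB] := compact_box cK.
have [E _] := intp_Fubini (Cc_integrable C).
rewrite /intp /Rintegral -E integral0_eq // => x _.
apply: (@int_1d (fun y => f (x, y)) _ B) => //.
- by move=> y; exact: (iffLR (isd_ey f x y _) (isd_dd (df (x, y)))).
- move=> y; apply: (@continuous_comp _ _ _ (fun t : R => (x, t)) (dd ey f)).
    exact: continuous_vline.
  exact: cf'.
- move=> y By; apply: fK => /KB [/= _].
  by rewrite in_itv /= -ler_norml leNgt By.
Qed.

Lemma intpD f g : Cc f -> Cc g -> intp (fun z => f z + g z) = intp f + intp g.
Proof. by move=> Cf Cg; apply: RintegralD => //; exact: Cc_integrable. Qed.

Lemma intpB f g : Cc f -> Cc g -> intp (fun z => f z - g z) = intp f - intp g.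
Proof. by move=> Cf Cg; apply: RintegralB => //; exact: Cc_integrable. Qed.

Lemma intpZ (c : R) f : Cc f -> intp (fun z => c * f z) = c * intp f.
Proof. by move=> Cf; apply: RintegralZl => //; exact: Cc_integrable. Qed.

Lemma vanish_laplacian K phi : compact K -> vanish_off K phi ->
  vanish_off K (laplacian phi).
Proof.
move=> cK fK z nK; rewrite laplacianE.
rewrite (vanish_dd _ cK (vanish_dd ex cK fK) nK).
by rewrite (vanish_dd _ cK (vanish_dd ey cK fK) nK) addr0.
Qed.

Lemma laplacian_cont phi : C2 setT phi -> continuous (laplacian phi).
Proof.
move=> [_ Cx Cy] z.
have -> : laplacian phi = (fun z => dd ex (dd ex phi) z + dd ey (dd ey phi) z).
  by apply/funext => y; rewrite laplacianE.
have [_ _ _ cx] := Cx z I; have [_ _ _ cy] := Cy z I.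
exact: (cvgD cx cy).
Qed.

Lemma laplacian_Cc K phi : compact K -> vanish_off K phi -> C2 setT phi ->
  Cc (laplacian phi).
Proof.
move=> cK fK C2p; split; first exact: laplacian_cont.
by exists K => //; exact: vanish_laplacian.
Qed.

(** The product vanishes near every point outside E, whatever g is there. *)
Lemma continuous_mul_vanish K E f g : compact K -> open E -> K `<=` E ->
  vanish_off K f -> continuous f -> (forall z, E z -> {for z, continuous g}) ->
  continuous (fun z => f z * g z).
Proof.
move=> cK oE KE fK cf cg z; case: (pselect (E z)) => Ez.
  by apply: cvgM; [exact: cf|exact: cg].
have nKz : ~ K z by move/KE.
apply: (@continuous_near _ (cst 0)); last exact: cst_continuous.
by apply: filterS (near_vanish cK fK nKz) => y <-; rewrite mul0r.
Qed.

(** f d^2 g - (d^2 f) g is the derivative of f (d g) - (d f) g, which extends by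
    zero outside E. Taking the vanishing of integrals of derivatives as a
    hypothesis lets both directions share the proof. *)
Lemma green_dir (e : R * R) K E f g :
  (forall h, vanish_off K h -> (forall z, diffb e h z) ->
     continuous (dd e h) -> intp (dd e h) = 0) ->
  compact K -> open E -> K `<=` E -> vanish_off K f ->
  continuous f -> C2dir e setT f ->
  (forall z, E z -> {for z, continuous g}) -> C2dir e E g ->
  [/\ Cc (fun z => f z * dd e (dd e g) z),
      Cc (fun z => dd e (dd e f) z * g z) &
      intp (fun z => f z * dd e (dd e g) z) =
      intp (fun z => dd e (dd e f) z * g z)].
Proof.
move=> I0 cK oE KE fK cf Cf cg Cg.
have f1K := vanish_dd e cK fK; have f2K := vanish_dd e cK f1K.
have c1 : continuous (dd e f) by move=> z; have [] := Cf z I.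
have c2 : continuous (dd e (dd e f)) by move=> z; have [] := Cf z I.
have A1 : Cc (fun z => f z * dd e (dd e g) z).
  split.
    by apply: (continuous_mul_vanish cK oE) => // z Ez; have [] := Cg z Ez.
  by exists K => // z nK; rewrite fK // mul0r.
have A2 : Cc (fun z => dd e (dd e f) z * g z).
  split; first by apply: (continuous_mul_vanish cK oE).
  by exists K => // z nK; rewrite f2K // mul0r.
split => //; apply/eqP; rewrite -subr_eq0 -intpB //; apply/eqP.
pose h z := f z * dd e g z - dd e f z * g z.
have hK : vanish_off K h by move=> z nK; rewrite /h fK // f1K // !mul0r subr0.
have dh z : isd e h z (f z * dd e (dd e g) z - dd e (dd e f) z * g z).
  case: (pselect (E z)) => Ez; last first.
    have nK : ~ K z by move/KE.
    rewrite fK // f2K // !mul0r subr0.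
    apply: (@isd_near _ _ (cst 0)); last exact: isd_cst.
    exact: near_vanish hK nK.
  have [d1 d2 _ _] := Cf z I; have [d3 d4 _ _] := Cg z Ez.
  have H := isdB (isdM (isd_dd d1) (isd_dd d4)) (isdM (isd_dd d2) (isd_dd d3)).
  have alg (p q r s t u : R) : p * q + r * s - (t * u + p * q) = r * s - t * u.
    by ring.
  by rewrite alg in H.
have E1 : dd e h = (fun z => f z * dd e (dd e g) z - dd e (dd e f) z * g z).
  by apply/funext => z; have /isdP[] := dh z.
rewrite -E1; apply: (I0 h hK) => [z|]; first by have /isdP[] := dh z.
rewrite E1 => z.
exact: cvgB (A1.1 z) (A2.1 z).
Qed.

Theorem green K E f g : compact K -> open E -> K `<=` E -> vanish_off K f ->
  C2 setT f -> C2 E g ->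
  intp (fun z => f z * laplacian g z) = intp (fun z => laplacian f z * g z).
Proof.
move=> cK oE KE fK [cf0 fx fy] [cg gx gy].
have cf : continuous f by move=> z; exact: cf0.
have [X1 X2 X3] := green_dir (fun h => @int_dd_ex K h cK) cK oE KE fK cf fx cg gx.
have [Y1 Y2 Y3] := green_dir (fun h => @int_dd_ey K h cK) cK oE KE fK cf fy cg gy.
have E1 : (fun z => f z * laplacian g z) =
    (fun z => f z * dd ex (dd ex g) z + f z * dd ey (dd ey g) z).
  by apply/funext => z; rewrite (laplacianE g z) mulrDr.
have E2 : (fun z => laplacian f z * g z) =
    (fun z => dd ex (dd ex f) z * g z + dd ey (dd ey f) z * g z).
  by apply/funext => z; rewrite (laplacianE f z) mulrDl.
have E3 := etrans (congr1 intp E1) (intpD X1 Y1).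
have E4 := etrans (congr1 intp E2) (intpD X2 Y2).
exact: (etrans E3 (etrans (congr2 +%R X3 Y3) (esym E4))).
Qed.

End IntegrationByParts.

(** * Smooth functions with a flat zero *)

Section Bump.
Set Implicit Arguments.
Unset Strict Implicit.
Context {R : realType}.
Implicit Types (P Q : {poly R}) (x r : R).

(** A family closed under differentiation whose members all vanish to infinite
    order at 0. *)
Definition fl P x : R := if 0 < x then P.[x^-1] * expR (- x^-1) else 0.

Lemma expR_ge_pow (k : nat) (y : R) : 0 < y ->
  (y / k.+1%:R) ^+ k.+1 <= expR y.
Proof.
move=> y0.
have -> : expR y = expR (y / k.+1%:R) ^+ k.+1.
  by rewrite -expRM_natl -mulr_natr mulrC divfK // pnatr_eq0.
apply: lerXn2r; rewrite ?nnegrE ?expR_ge0 //.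
  by rewrite divr_ge0 // ltW.
by apply: le_trans (expR_ge1Dx _); rewrite lerDr.
Qed.

Lemma horner_bound P (y : R) : 1 <= y ->
  `|P.[y]| <= (\sum_(i < size P) `|P`_i|) * y ^+ size P.
Proof.
move=> y1; rewrite horner_coef (le_trans (ler_norm_sum _ _ _)) // mulr_suml.
apply: ler_sum => i _; rewrite normrM ler_wpM2l // normrX.
rewrite ger0_norm; last by lra.
by apply: ler_weXn2l => //; exact: ltnW.
Qed.

(** The exponential beats every power of 1 / h, and one spare power remains. *)
Lemma fl_bound P : exists2 C, 0 <= C & forall h, `|h| <= 1 -> `|fl P h| <= C * `|h|.
Proof.
set S := \sum_(i < size P) `|P`_i|.
have S0 : 0 <= S by exact: sumr_ge0.
set n := size P.
exists (S * n.+1%:R ^+ n.+1) => [|h h1].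
  by apply: mulr_ge0 => //; apply: exprn_ge0.
rewrite /fl; case: ifPn => [h0|_]; last by rewrite normr0 !mulr_ge0 // exprn_ge0.
rewrite (gtr0_norm h0) in h1 *.
set y := h^-1; have y0 : 0 < y by rewrite invr_gt0.
have y1 : 1 <= y by rewrite invf_ge1.
rewrite normrM (ger0_norm (expR_ge0 _)).
have H := expR_ge_pow n y0.
have E : expR (- y) <= n.+1%:R ^+ n.+1 * y ^- n.+1.
  rewrite expRN -[leRHS]invrK lef_pV2 ?posrE ?expR_gt0 //; last first.
    by rewrite invr_gt0 mulr_gt0 ?invr_gt0 ?exprn_gt0.
  by rewrite invfM invrK mulrC -expr_div_n.
apply: le_trans (_ : (S * y ^+ n) * (n.+1%:R ^+ n.+1 * y ^- n.+1) <= _).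
  by apply: ler_pM => //; exact: horner_bound.
rewrite le_eqVlt; apply/orP; left; apply/eqP.
have -> : h = y^-1 by rewrite invrK.
rewrite [y ^+ n.+1]exprSr; move: (n.+1%:R ^+ n.+1) (y ^+ n) (exprn_gt0 n y0) => c u u0.
by field; rewrite !gt_eqF.
Qed.

Lemma fl0 P x : x <= 0 -> fl P x = 0.
Proof. by rewrite /fl ltNge => ->. Qed.

Definition fl_der P : {poly R} := 'X^2 * (P - P^`()).

(** At 0 the difference quotient is again a member of the family, for the
    polynomial 'X * P, and [fl_bound] shows that it tends to 0. *)
Lemma fl_derive P x : is_derive x 1 (fl P) (fl (fl_der P) x).
Proof.
have [x0|x0|->] := ltgtP x 0.
- rewrite fl0 ?ltW //.
  have nx : \forall y \near x, cst 0 y = fl P y.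
    near=> y; rewrite fl0 //; apply: ltW; near: y.
    exact: lt_nbhsl.
  exact: near_eq_is_derive nx (is_derive_cst (0 : R) x 1).
- have nx : \forall y \near x, P.[y^-1] * expR (- y^-1) = fl P y.
    near=> y; rewrite /fl ifT //; near: y.
    exact: lt_nbhsr.
  apply: (near_eq_is_derive nx).
  have xn0 : x != 0 by rewrite gt_eqF.
  have dV : is_derive x 1 (fun y : R => y^-1) (- x ^- 2).
    have := @is_deriveV _ id x 1 1 xn0 (is_derive_id x 1).
    by rewrite [_ *: 1]mulr1.
  have dE : is_derive x 1 (fun y : R => expR (- y^-1)) (x ^- 2 * expR (- x^-1)).
    have dN : is_derive x 1 (fun y : R => - y^-1) (x ^- 2).
      by apply: is_derive_eq (is_deriveN dV) _; rewrite opprK.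
    have := @is_derive1_comp _ expR (fun y : R => - y^-1) x _ _ (is_derive_expR _) dN.
    by move/is_derive_eq; apply; rewrite mulrC.
  have dP : is_derive x 1 (fun y : R => P.[y^-1]) (- x ^- 2 * P^`().[x^-1]).
    have := @is_derive1_comp _ (horner P) (fun y : R => y^-1) x _ _ (is_derive_poly _ _) dV.
    by move/is_derive_eq; apply; rewrite mulrC.
  apply: (is_derive_eq (is_deriveM dP dE)).
  rewrite /fl x0 /fl_der !hornerE /GRing.scale /=.
  by field.
- rewrite [fl (fl_der P) 0]fl0 //.
  have [C C0 bC] := fl_bound ('X * P).
  have L : h^-1 *: (fl P (h *: 1 + 0) - fl P 0) @[h --> (0 : R)^'] --> (0 : R).
    apply/cvgrPdist_le => e e0; near=> h.
    rewrite sub0r normrN [fl P 0]fl0 // subr0 addr0 [_%:A]mulr1.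
    have -> : h^-1 *: fl P h = fl ('X * P) h.
      rewrite /fl /GRing.scale /=; case: ifPn => h0; last by rewrite mulr0.
      by rewrite hornerM hornerX mulrA.
    have h1 : `|h| <= 1 by near: h; apply: dnbhs0_le.
    apply: le_trans (bC h h1) _.
    have : `|h| <= e / (C + 1).
      by near: h; apply: dnbhs0_le; rewrite divr_gt0 // ltr_wpDl.
    rewrite ler_pdivlMr; last by rewrite ltr_wpDl.
    apply: le_trans; rewrite mulrC ler_wpM2l //; lra.
  apply: DeriveDef; first by apply/cvg_ex; exists 0.
  exact: cvg_lim L.
Unshelve. all: by end_near. Qed.

Lemma fl_gt0 x : 0 < x -> 0 < fl 1 x.
Proof. by move=> x0; rewrite /fl x0 hornerC mul1r expR_gt0. Qed.

Lemma fl_ge0 x : 0 <= fl 1 x.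
Proof. by rewrite /fl; case: ifP => // _; rewrite hornerC mul1r expR_ge0. Qed.

End Bump.

(** * Smoothing by product kernels *)

Section Mollifier.
Set Implicit Arguments.
Unset Strict Implicit.
Context {R : realType}.
Local Notation P2 := (measurableTypeR R * measurableTypeR R)%type.

Implicit Types (f g : R * R -> R).

(** A class of functions supported between 0 and r that contains the derivatives
    of its members, so that smoothness follows by induction on the order. *)
Inductive molf (r : R) : (R -> R) -> Prop :=
| molf_fl (c : R) (P Q : {poly R}) :
    molf r (fun x => c * (fl P x * fl Q (r - x)))
| molf_add a b : molf r a -> molf r b -> molf r (fun x => a x + b x).

Lemma is_derive_reflect (a a' : R -> R) (c s : R) :
  (forall x : R, is_derive x 1 a (a' x)) ->
  is_derive s 1 (fun s => a (c - s)) (-1 * a' (c - s)).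
Proof.
move=> da.
have dB : is_derive s 1 (fun s : R => c - s) (-1).
  by apply: is_derive_eq (is_deriveB (is_derive_cst c s 1) (is_derive_id s 1)) _;
    rewrite sub0r.
have d1 := @is_derive1_comp _ a (fun s : R => c - s) s _ _ (da (c - s)) dB.
by apply: is_derive_eq d1 _; rewrite mulrC.
Qed.

Lemma molfZ r (c : R) a : molf r a -> molf r (fun x => c * a x).
Proof.
elim=> [d P Q|a1 a2 _ h1 _ h2].
  by under eq_fun do rewrite mulrA; exact: molf_fl.
by under eq_fun do rewrite mulrDr; exact: molf_add.
Qed.

Lemma molf_derive r a : molf r a ->
  exists2 a', molf r a' & forall x : R, is_derive x 1 a (a' x).
Proof.
elim=> [c P Q|a1 a2 _ [b1 m1 d1] _ [b2 m2 d2]]; last first.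
  exists (fun x => b1 x + b2 x) => [|x]; first exact: molf_add.
  exact: is_deriveD.
exists (fun x => c * (fl (fl_der P) x * fl Q (r - x)) +
                 (- c) * (fl P x * fl (fl_der Q) (r - x))) => [|x].
  by apply: molf_add; exact: molf_fl.
have d2 := is_derive_reflect r x (fl_derive Q).
apply: is_derive_eq (is_deriveZ c (is_deriveM (fl_derive P x) d2)) _.
by rewrite /GRing.scale /=; ring.
Qed.

Lemma molf_cont r a : molf r a -> continuous a.
Proof. by move=> /molf_derive[a' _]; exact: is_derive_continuous. Qed.

Lemma molf_supp r a : molf r a -> forall x, ~ (0 <= x <= r) -> a x = 0.
Proof.
elim=> [c P Q x h|a1 a2 _ h1 _ h2 x h]; last by rewrite h1 // h2 // addr0.
have [x0|x0] := lerP x 0; first by rewrite fl0 // mul0r mulr0.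
rewrite [fl Q _]fl0 ?mulr0 //; rewrite leNgt; apply/negP => rx; apply: h.
by apply/andP; split; lra.
Qed.

Lemma molf_bounded r a : molf r a -> exists2 M, 0 <= M & forall x, `|a x| <= M.
Proof.
move=> ma; have ca := molf_cont ma.
have [M M0 bM] := continuous_compact_bounded (@segment_compact R 0 r) (fun x _ => ca x).
exists M => [|x]; first exact: ltW.
case: (pselect (0 <= x <= r)) => xr; last by rewrite (molf_supp ma) // normr0 ltW.
by apply: bM; rewrite /= in_itv.
Qed.

Lemma molf_lipschitz r a : molf r a ->
  exists2 L, 0 <= L & forall x y, `|a x - a y| <= L * `|x - y|.
Proof.
move=> ma; have [a' ma' da] := molf_derive ma.
have [L L0 bL] := molf_bounded ma'; exists L => //.
have ca := molf_cont ma.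
suff H x y : x <= y -> `|a x - a y| <= L * `|x - y|.
  move=> x y; have [/H //|/ltW yx] := leP x y.
  by rewrite (distrC (a x)) (distrC x); exact: H.
rewrite le_eqVlt => /orP[/eqP ->|xy]; first by rewrite !subrr normr0 mulr0.
have [c _ E] := @MVT _ a a' x y xy (fun x _ => da x)
   (continuous_subspaceT (fun x => ca x)).
by rewrite distrC E normrM (distrC y x) ler_wpM2r.
Qed.

Definition tens (a b : R -> R) (z : R * R) : R * R -> R :=
  fun t => a (t.1 - z.1) * b (t.2 - z.2).

(** A correlation with a product kernel: the two partial derivatives act on the
    two factors separately. *)
Definition smear (phi : R * R -> R) (a b : R -> R) : R * R -> R :=
  fun z => intp (fun t => phi t * tens a b z t).

Lemma continuous_fst_sub (c : R) : continuous (fun t : R * R => t.1 - c).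
Proof. by move=> t; apply: cvgB; [exact: cvg_fst|exact: cvg_cst]. Qed.

Lemma continuous_snd_sub (c : R) : continuous (fun t : R * R => t.2 - c).
Proof. by move=> t; apply: cvgB; [exact: cvg_snd|exact: cvg_cst]. Qed.

Lemma continuous_tens a b z : continuous a -> continuous b ->
  continuous (tens a b z).
Proof.
move=> ca cb t; apply: cvgM.
- apply: (@continuous_comp _ _ _ (fun t : R * R => t.1 - z.1) a); last exact: ca.
  exact: continuous_fst_sub.
- apply: (@continuous_comp _ _ _ (fun t : R * R => t.2 - z.2) b); last exact: cb.
  exact: continuous_snd_sub.
Qed.

Lemma CcM f g : Cc f -> continuous g -> Cc (fun z : R * R => f z * g z).
Proof.
move=> [cf [K cK fK]] cg; split; last first.
  by exists K => // z nK; rewrite fK // mul0r.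
by move=> z; apply: cvgM; [exact: cf|exact: cg].
Qed.

Lemma Cc_norm f : Cc f -> Cc (fun z : R * R => `|f z|).
Proof.
move=> [cf [K cK fK]]; split; last first.
  by exists K => // z nK; rewrite fK // normr0.
by move=> z; apply: cvg_norm; exact: cf.
Qed.

Lemma ler_intp f g : Cc f -> Cc g -> (forall z, f z <= g z) -> intp f <= intp g.
Proof. by move=> Cf Cg fg; apply: le_Rintegral => //; exact: Cc_integrable. Qed.

Lemma intp_norm f : Cc f -> `|intp f| <= intp (fun z => `|f z|).
Proof. by move=> Cf; apply: le_normr_Rintegral => //; exact: Cc_integrable. Qed.

Lemma Cc_cstM (c : R) f : Cc f -> Cc (fun z : R * R => c * f z).
Proof.
move=> Cf; under eq_fun do rewrite mulrC.
by apply: CcM => //; exact: cst_continuous.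
Qed.

Variables (phi : R * R -> R).
Hypothesis Cphi : Cc phi.

Lemma Cc_smear a b z : continuous a -> continuous b ->
  Cc (fun t => phi t * tens a b z t).
Proof. by move=> ca cb; apply: CcM => //; exact: continuous_tens. Qed.

(** The kernel is Lipschitz in z, uniformly in the variable of integration. *)
Lemma smear_continuous r a b : molf r a -> molf r b -> continuous (smear phi a b).
Proof.
move=> ma mb z; have ca := molf_cont ma; have cb := molf_cont mb.
have [La La0 lipa] := molf_lipschitz ma; have [Lb Lb0 lipb] := molf_lipschitz mb.
have [Ma Ma0 bda] := molf_bounded ma; have [Mb Mb0 bdb] := molf_bounded mb.
pose I := intp (fun t => `|phi t|).
have I0 : 0 <= I by apply: Rintegral_ge0 => t _.
pose C := (La * Mb + Ma * Lb) * I.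
have C0 : 0 <= C by rewrite mulr_ge0 // addr_ge0 // mulr_ge0.
have H y : `|smear phi a b z - smear phi a b y| <= C * `|z - y|.
  rewrite /smear -intpB; [|exact: Cc_smear..].
  apply: le_trans (intp_norm _) _.
    have -> : (fun t => phi t * tens a b z t - phi t * tens a b y t) =
              (fun t => phi t * (tens a b z t - tens a b y t)).
      by apply/funext => t; rewrite mulrBr.
    apply: CcM => // t.
    by apply: cvgB; exact: continuous_tens.
  apply: le_trans (_ : intp (fun t => ((La * Mb + Ma * Lb) * `|z - y|) * `|phi t|) <= _).
    apply: ler_intp.
    - have -> : (fun t => `|phi t * tens a b z t - phi t * tens a b y t|) =
              (fun t => `|phi t * (tens a b z t - tens a b y t)|).
        by apply/funext => t; rewrite mulrBr.
      apply: Cc_norm; apply: CcM => // t.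
      by apply: cvgB; exact: continuous_tens.
    - by apply: Cc_cstM; exact: Cc_norm.
    - move=> t; rewrite -mulrBr normrM mulrC ler_wpM2r //.
      have h1 : `|z.1 - y.1| <= `|z - y| by rewrite prod_normE /= le_max lexx.
      have h2 : `|z.2 - y.2| <= `|z - y| by rewrite prod_normE /= le_max lexx orbT.
      have -> : tens a b z t - tens a b y t =
         (a (t.1 - z.1) - a (t.1 - y.1)) * b (t.2 - z.2) +
         a (t.1 - y.1) * (b (t.2 - z.2) - b (t.2 - y.2)).
        by rewrite /tens; ring.
      apply: le_trans (ler_normD _ _) _; rewrite !normrM mulrDl.
      apply: lerD.
      + rewrite mulrAC; apply: ler_pM => //.
        apply: le_trans (lipa _ _) _; rewrite ler_wpM2l //.
        by rewrite (_ : t.1 - z.1 - (t.1 - y.1) = - (z.1 - y.1)) ?normrN //; ring.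
      + rewrite -mulrA; apply: ler_pM => //.
        apply: le_trans (lipb _ _) _; rewrite ler_wpM2l //.
        by rewrite (_ : t.2 - z.2 - (t.2 - y.2) = - (z.2 - y.2)) ?normrN //; ring.
  rewrite intpZ; last exact: Cc_norm.
  by rewrite -/I /C mulrAC.
apply/cvgrPdist_le => e e0; near=> y.
apply: le_trans (H y) _.
have : `|z - y| <= e / (C + 1).
  near: y; apply: (@cvgr_dist_le _ _ _ (nbhs z) _ id z); first exact: cvg_id.
  by rewrite divr_gt0 // ltr_wpDl.
rewrite ler_pdivlMr; last by rewrite ltr_wpDl.
apply: le_trans; rewrite mulrC ler_wpM2l //; lra.
Unshelve. all: by end_near. Qed.

(** Differentiation under the integral sign along a curve of kernels; a bound on
    the derivative of the kernel times |phi| is the integrable majorant. *)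
Lemma smear_derive (T T' : R -> R * R -> R) (C x : R) :
  (forall s, continuous (T s)) -> 0 <= C -> (forall s t, `|T' s t| <= C) ->
  (forall (s : R) t, is_derive s 1 (T ^~ t) (T' s t)) ->
  is_derive x 1 (fun s => intp (fun t => phi t * T s t))
    (intp (fun t => phi t * T' x t)).
Proof.
move=> cT C0 bT' dT.
pose f (s : R) (t : R * R) : R := phi t * T s t.
have df (s : R) (t : R * R) : is_derive s 1 (f ^~ t) (phi t * T' s t).
  exact: (is_deriveZ (phi t) (dT s t)).
have pE s t : partial1of2 f s t = phi t * T' s t.
  by rewrite partial1of2E; have [_ ->] := df s t.
have int_f s : `]x - 1, x + 1[%classic s -> area.-integrable setT (EFin \o f s).
  by move=> _; apply: Cc_integrable; exact: (CcM Cphi (cT s)).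
have Ix : `]x - 1, x + 1[%classic x by rewrite /= in_itv /=; apply/andP; split; lra.
pose G (t : R * R) : R := C * `|phi t|.
have G0 t : 0 <= G t by rewrite mulr_ge0.
have iG : area.-integrable setT (EFin \o G).
  by apply: Cc_integrable; apply: Cc_cstM; exact: Cc_norm.
have Gub s t : `]x - 1, x + 1[%classic s -> setT t -> `|partial1of2 f s t| <= G t.
  by move=> _ _; rewrite pE normrM mulrC /G ler_wpM2r.
have d1 s t : `]x - 1, x + 1[%classic s -> setT t -> derivable (f ^~ t) s 1.
  by move=> _ _; have [] := df s t.
apply: DeriveDef.
  exact: (derivable_under_integral measurableT Ix int_f d1 G0 iG Gub).
rewrite -derive1E.
have := differentiation_under_integral measurableT Ix int_f d1 G0 iG Gub.
rewrite /intp => ->.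
by apply: eq_Rintegral => t _; rewrite pE.
Qed.

Lemma smear_isd_ex r a b a' z : molf r a -> molf r a' -> molf r b ->
  (forall x : R, is_derive x 1 a (a' x)) ->
  isd ex (smear phi a b) z (smear phi (fun x => (-1) * a' x) b z).
Proof.
move=> ma ma' mb da; have ca := molf_cont ma; have cb := molf_cont mb.
have [Mb Mb0 bdb] := molf_bounded mb; have [Ma Ma0 bda] := molf_bounded ma'.
case: z => x y; apply/isd_ex.
apply: (@smear_derive (fun s t => tens a b (s, y) t)
  (fun s t => tens (fun x => (-1) * a' x) b (s, y) t) (Ma * Mb)).
- by move=> s; exact: continuous_tens.
- by rewrite mulr_ge0.
- move=> s t; rewrite normrM; apply: ler_pM => //.
  by rewrite normrM normrN1 mul1r.
move=> s t; have d := is_deriveZ (b (t.2 - y)) (is_derive_reflect t.1 s da).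
have -> : (fun s => tens a b (s, y) t) = (b (t.2 - y) \*: (fun s => a (t.1 - s)) : R -> R).
  by apply/funext => s'; rewrite /tens /= mulrC.
by apply: is_derive_eq d _; rewrite /tens /GRing.scale /= [RHS]mulrC.
Qed.

Lemma smear_isd_ey r a b b' z : molf r a -> molf r b' -> molf r b ->
  (forall x : R, is_derive x 1 b (b' x)) ->
  isd ey (smear phi a b) z (smear phi a (fun x => (-1) * b' x) z).
Proof.
move=> ma mb' mb db; have ca := molf_cont ma; have cb := molf_cont mb.
have [Mb Mb0 bdb] := molf_bounded mb'; have [Ma Ma0 bda] := molf_bounded ma.
case: z => y x; apply/isd_ey.
apply: (@smear_derive (fun s t => tens a b (y, s) t)
  (fun s t => tens a (fun x => (-1) * b' x) (y, s) t) (Ma * Mb)).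
- by move=> s; exact: continuous_tens.
- by rewrite mulr_ge0.
- move=> s t; rewrite normrM; apply: ler_pM => //.
  by rewrite normrM normrN1 mul1r.
move=> s t; exact: (is_deriveZ (a (t.1 - y)) (is_derive_reflect t.2 s db)).
Qed.

Lemma smear_smooth r a b : molf r a -> molf r b -> smooth setT (smear phi a b).
Proof.
move=> + + k; elim: k a b => [|k IH] a b ma mb /=.
  by split => // z _; exact: (smear_continuous ma mb).
have [a' ma' da] := molf_derive ma; have [b' mb' db] := molf_derive mb.
have dx1 z := smear_isd_ex z ma ma' mb da.
have dy1 z := smear_isd_ey z ma mb' mb db.
split; first by move=> z _; exact: (smear_continuous ma mb).
split.
- by move=> z _; split; [have /isdP[] := dx1 z|have /isdP[] := dy1 z].
- have -> : dx (smear phi a b) = smear phi (fun x => (-1) * a' x) b.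
    by rewrite dxE; apply/funext => z; have /isdP[] := dx1 z.
  by apply: IH => //; exact: molfZ.
- have -> : dy (smear phi a b) = smear phi a (fun x => (-1) * b' x).
    by rewrite dyE; apply/funext => z; have /isdP[] := dy1 z.
  by apply: IH => //; exact: molfZ.
Qed.

End Mollifier.

(** * Approximation of C^2 functions by test functions *)

Section Approximation.
Set Implicit Arguments.
Unset Strict Implicit.
Context {R : realType}.
Implicit Types (f g phi : R * R -> R) (K D : set (R * R)).
Local Notation P2 := (measurableTypeR R * measurableTypeR R)%type.
Local Notation mu := (@lebesgue_measure R).

Lemma ball_area (z : R * R) (e : R) : 0 < e ->
  exists2 A : set P2, measurable A /\ (0 < area A < +oo)%E &
    (A : set (R * R)) `<=` ball z e.
Proof.
move=> e0.
pose I (c : R) : set R := `]c - e, c + e[%classic.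
have mI (c : R) : mu (I c) = (e + e)%:E.
  rewrite /I lebesgue_measure_itv /= lte_fin ifT; last by lra.
  by rewrite -EFinB; congr EFin; ring.
exists ((I z.1 : set (measurableTypeR R)) `*` (I z.2 : set (measurableTypeR R))).
  split; first by apply: measurableX; exact: measurable_itv.
  have -> : area ((I z.1 : set (measurableTypeR R)) `*`
     (I z.2 : set (measurableTypeR R))) = (mu (I z.1) * mu (I z.2))%E.
    by apply: product_measure1E; exact: measurable_itv.
  by rewrite !mI -EFinM ltry lte_fin mulr_gt0 ?addr_gt0.
move=> y [/=]; rewrite /I /= !in_itv /= => /andP[h1 h2] /andP[h3 h4].
by split; rewrite /ball /= ltr_norml; apply/andP; split; lra.
Qed.

Lemma intp_gt0 f z : area.-integrable setT (EFin \o f) -> (forall y, 0 <= f y) ->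
  {for z, continuous f} -> 0 < f z -> 0 < intp f.
Proof.
move=> fi f0 cf fz.
have : \forall y \near z, f z / 2 < f y.
  by apply: (cvgr_gt _ cf); lra.
move=> /nbhs_ballP[e /= e0 He].
have [A [mA /andP[A0 Aoo]] Ae] := ball_area z e0.
have mf := measurable_int _ fi.
have H : ((f z / 2)%:E * area A <= \int[area]_y (f y)%:E)%E.
  apply: (@le_trans _ _ (\int[area]_(y in A) (f y)%:E)%E).
    rewrite -integral_cst //; apply: ge0_le_integral => //.
    - by move=> y _; rewrite lee_fin; lra.
    - exact: measurable_funS mf.
    - by move=> y Ay; rewrite lee_fin ltW //; exact: (He y (Ae y Ay)).
  by apply: ge0_subset_integral => //; move=> y _; rewrite lee_fin.
have fin : (\int[area]_y (f y)%:E)%E \is a fin_num by exact: integrable_fin_num.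
rewrite /intp /Rintegral -lte_fin fineK //; apply: lt_le_trans H.
by rewrite mule_gt0 // lte_fin; lra.
Qed.

Lemma intp_eq0 f z : area.-integrable setT (EFin \o f) -> (forall y, 0 <= f y) ->
  intp f = 0 -> {for z, continuous f} -> f z = 0.
Proof.
move=> fi f0 I0 cf; apply/eqP; rewrite eq_le f0 andbT leNgt; apply/negP => fz.
by have := intp_gt0 fi f0 cf fz; rewrite I0 ltxx.
Qed.

Definition rho (r : R) : R -> R := fun x => 1 * (fl 1 x * fl 1 (r - x)).

Lemma molf_rho r : molf r (rho r).
Proof. exact: molf_fl. Qed.

Lemma rho_ge0 r x : 0 <= rho r x.
Proof. by rewrite /rho mul1r mulr_ge0 // fl_ge0. Qed.

Lemma rho_gt0 r : 0 < r -> 0 < rho r (r / 2).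
Proof. by move=> r0; rewrite /rho mul1r mulr_gt0 // fl_gt0; lra. Qed.

Lemma Cc_tens r a b (z : R * R) : molf r a -> molf r b -> Cc (tens a b z).
Proof.
move=> ma mb; split.
  by apply: continuous_tens; [exact: molf_cont ma|exact: molf_cont mb].
pose B := `|z.1| + `|z.2| + `|r|.
exists (box B : set (R * R)); first exact: box_compact.
move=> t nB; rewrite /tens.
case: (pselect (0 <= t.1 - z.1 <= r)) => h1; last by rewrite (molf_supp ma) // mul0r.
case: (pselect (0 <= t.2 - z.2 <= r)) => h2; last by rewrite (molf_supp mb) // mulr0.
exfalso; apply: nB; move: h1 h2 => /andP[h1 h2] /andP[h3 h4].
have := ler_norm z.1; have := ler_norm (- z.1); have := ler_norm z.2.
have := ler_norm (- z.2); have := ler_norm r; rewrite !normrN => *.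
have := normr_ge0 z.1; have := normr_ge0 z.2; have := normr_ge0 r => *.
by rewrite /box /B; split; rewrite /= in_itv /=; apply/andP; split; lra.
Qed.

Lemma tens_far r a b (z t : R * R) : molf r a -> molf r b ->
  r < `|z - t| -> tens a b z t = 0.
Proof.
move=> ma mb tz; rewrite /tens.
case: (pselect (0 <= t.1 - z.1 <= r)) => h1; last by rewrite (molf_supp ma h1) mul0r.
case: (pselect (0 <= t.2 - z.2 <= r)) => h2; last by rewrite (molf_supp mb h2) mulr0.
exfalso; move: tz; rewrite ltNge => /negP; apply; rewrite distrC prod_normE /= ge_max.
move/andP: h1 => [h1 h1']; move/andP: h2 => [h2 h2'].
by rewrite !ger0_norm // h1' h2'.
Qed.

Lemma integral_shift (h : R -> R) (c : R) : continuous h -> (forall x, 0 <= h x) ->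
  (\int[mu]_x (h (x - c))%:E = \int[mu]_x (h x)%:E)%E.
Proof.
move=> ch h0.
pose F (x : R) := x - c.
have dF (x : R) : is_derive x 1 F 1 := is_derive_shift c x.
have F1 : F^`()%classic = cst 1.
  by apply/funext => x; rewrite derive1E; have [_ ->] := dF x.
rewrite (@increasing_ge0_integration_by_substitutionT _ F h) //.
- by apply: eq_integral => x _; rewrite F1 /= mulr1.
- by move=> x y xy; rewrite /F ltrD2r.
- by rewrite F1; exact: cst_continuous.
- by rewrite F1; exact: is_cvg_cst.
- by rewrite F1; exact: is_cvg_cst.
- apply/cvgrNyPle => M; near=> x; rewrite /F lerBlDr; near: x.
  by apply: nbhs_ninfty_le; exact: num_real.
- apply/cvgryPge => M; near=> x; rewrite /F lerBrDr; near: x.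
  by apply: nbhs_pinfty_ge; exact: num_real.
Unshelve. all: by end_near. Qed.

Lemma intp_tens_shift r (z : R * R) :
  intp (tens (rho r) (rho r) z) = intp (tens (rho r) (rho r) 0).
Proof.
have mr := molf_rho r; have cr := molf_cont mr.
have E y : (\int[area]_t (tens (rho r) (rho r) y t)%:E =
    (\int[mu]_x (rho r x)%:E) * (\int[mu]_x (rho r x)%:E))%E.
  have [<- _] := intp_Fubini (Cc_integrable (Cc_tens y mr mr)).
  have cs (c : R) : continuous (fun x => rho r (x - c)).
    move=> x; apply: (@continuous_comp _ _ _ (fun x : R => x - c) (rho r)); last exact: cr.
    by apply: cvgB; [exact: cvg_id|exact: cvg_cst].
  have mrho (c : R) : measurable_fun setT (fun x : R => (rho r (x - c))%:E).
    by apply/measurable_EFinP; exact: continuous_measurable_fun.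
  have rho0 (c x : R) : (0 <= (rho r (x - c))%:E)%E by rewrite lee_fin rho_ge0.
  set M := (\int[mu]_x (rho r x)%:E)%E.
  have M0 : (0 <= M)%E by apply: integral_ge0 => x _; rewrite lee_fin rho_ge0.
  have inner (x : R) : (\int[mu]_t (tens (rho r) (rho r) y (x, t))%:E =
      (rho r (x - y.1))%:E * M)%E.
    rewrite /M -(integral_shift y.2 cr (rho_ge0 r)).
    have := @ge0_integralZl _ _ _ mu setT measurableT _
      (mrho y.2) (rho r (x - y.1))%:E (fun t _ => rho0 y.2 t) (rho0 y.1 x).
    by move=> <-; apply: eq_integral => t _; rewrite -EFinM.
  transitivity (\int[mu]_x ((rho r (x - y.1))%:E * M))%E.
    by apply: eq_integral => x _; exact: inner.
  have := @ge0_integralZr _ _ _ mu setT measurableT _ (mrho y.1) M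
      (fun t _ => rho0 y.1 t) M0.
  by move=> ->; rewrite {2}/M (integral_shift y.1 cr (rho_ge0 r)).
by rewrite /intp /Rintegral !E.
Qed.

Definition mass (r : R) := intp (tens (rho r) (rho r) 0).

Lemma mass_gt0 r : 0 < r -> 0 < mass r.
Proof.
move=> r0; have mr := molf_rho r.
apply: (@intp_gt0 _ (r / 2, r / 2)).
- exact: Cc_integrable (Cc_tens _ mr mr).
- by move=> y; rewrite mulr_ge0 // rho_ge0.
- by case: (Cc_tens 0 mr mr) => c _; exact: c.
- by rewrite /tens /= !subr0 mulr_gt0 // rho_gt0.
Qed.

(** Compactness of a box slightly larger than the support; when z is outside it,
    both values are 0. *)
Lemma Cc_unif f (eta : R) : Cc f -> 0 < eta ->
  exists2 r0, 0 < r0 & forall z t, `|z - t| <= r0 -> `|f z - f t| <= eta.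
Proof.
move=> Cf e0; have [cf [K cK fK]] := Cf.
have [B B0 KB] := compact_box cK.
have : compact (box (B + 1) : set (R * R)) by exact: box_compact.
move/compact_near_coveringP/near_covering_withinP.
move/(_ R (0 : R)^'+ (fun r z => forall t, `|z - t| <= r -> `|f z - f t| <= eta)).
case.
  move=> z _.
  have : \forall y \near z, `|f z - f y| <= eta / 2.
    by apply: (cvgr_dist_le _ _ (cf z)); lra.
  move=> /nbhs_ballP[e /= e0' He].
  exists (ball z (e / 2), [set r | r < e / 2]).
    split; first by apply: nbhsx_ballx; lra.
    by apply: nbhs_right_lt; lra.
  move=> [y r] [/= zy re] By t yt.
  have h1 : `|f z - f y| <= eta / 2.
    by apply: He; apply: le_ball zy; lra.
  have h2 : `|f z - f t| <= eta / 2.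
    apply: He; rewrite -ball_normE /=.
    rewrite -ball_normE /= in zy.
    have -> : z - t = (z - y) + (y - t) by rewrite addrA subrK.
    by rewrite (le_lt_trans (ler_normD _ _)) //; lra.
  have -> : f y - f t = (f z - f t) - (f z - f y) by ring.
  by rewrite (le_trans (ler_normB _ _)) //; lra.
move=> e /= e1 He.
exists (Num.min (e / 2) 1); first by rewrite lt_min ltr01 divr_gt0.
move=> z t; rewrite le_min => /andP[zt1 zt2].
case: (pselect ((box (B + 1) : set (R * R)) z)) => Bz.
  apply: (He (e / 2) _ _ z Bz t zt1); last by rewrite /=; lra.
  by rewrite /ball /= sub0r normrN gtr0_norm; lra.
have out (y : R * R) : ~ box B y -> f y = 0 by move=> nB; apply: fK => /KB.
have nBt : ~ (box B : set (R * R)) t.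
  move=> [/=]; rewrite !in_itv /= -!ler_norml => t1 t2; apply: Bz.
  rewrite prod_normE /= ge_max in zt2; move/andP: zt2 => [z1 z2].
  have a1 := ler_normD (z.1 - t.1) t.1; have a2 := ler_normD (z.2 - t.2) t.2.
  rewrite !subrK in a1 a2.
  by split; rewrite /= in_itv /= -ler_norml; lra.
rewrite (out t) // (out z) ?subrr ?normr0 ?ltW //.
move=> [/=]; rewrite !in_itv /= -!ler_norml => z1 z2; apply: Bz.
by split; rewrite /= in_itv /= -ler_norml; lra.
Qed.

(** Divided by its mass, the kernel takes an average of phi over a square of
    side r. *)
Lemma smear_approx phi (eta : R) : Cc phi -> 0 < eta ->
  exists2 r0, 0 < r0 & forall r, 0 < r -> r <= r0 -> forall z,
    `|smear phi (fun x => (mass r)^-1 * rho r x) (rho r) z - phi z| <= eta.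
Proof.
move=> Cphi e0; have [r0 r00 H] := Cc_unif Cphi e0; exists r0 => // r rp rr0 z.
have m0 := mass_gt0 rp; have mr := molf_rho r; have cr := molf_cont mr.
have CT := Cc_tens z mr mr.
have -> : smear phi (fun x => (mass r)^-1 * rho r x) (rho r) z =
    (mass r)^-1 * intp (fun t => phi t * tens (rho r) (rho r) z t).
  rewrite -intpZ; last by exact: Cc_smear.
  by congr intp; apply/funext => t; rewrite /tens; ring.
have -> : phi z = (mass r)^-1 * intp (fun t => phi z * tens (rho r) (rho r) z t).
  by rewrite intpZ // intp_tens_shift -/(mass r) mulrCA mulVf ?mulr1 // gt_eqF.
rewrite -mulrBr normrM gtr0_norm ?invr_gt0 // mulrC ler_pdivrMr //.
rewrite -intpB; [|exact: Cc_smear|exact: Cc_cstM].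
have E : (fun t => phi t * tens (rho r) (rho r) z t - phi z * tens (rho r) (rho r) z t)
   = (fun t => tens (rho r) (rho r) z t * (phi t - phi z)).
  by apply/funext => t; ring.
have cphi : continuous phi by case: Cphi.
have C1 : Cc (fun t => tens (rho r) (rho r) z t * (phi t - phi z)).
  by apply: CcM => // t; apply: cvgB; [exact: cphi|exact: cvg_cst].
rewrite E (le_trans (intp_norm C1)) // /mass -(intp_tens_shift r z) -intpZ //.
apply: ler_intp; [exact: Cc_norm|exact: Cc_cstM|].
move=> t; rewrite normrM ger0_norm; last by rewrite mulr_ge0 // rho_ge0.
have T0 : 0 <= tens (rho r) (rho r) z t by rewrite mulr_ge0 // rho_ge0.
case: (pselect (`|t - z| <= r)) => tz.
  by rewrite mulrC ler_wpM2r // H // (le_trans tz).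
rewrite (tens_far (z:=z) mr mr) ?mul0r ?mulr0 // distrC ltNge.
exact/negP.
Qed.

Lemma isd_tens_ex a b a' z t : (forall x : R, is_derive x 1 a (a' x)) ->
  isd ex (tens a b z) t (tens a' b z t).
Proof.
move=> da; case: t => x y; apply/isd_ex.
have d1 := @is_derive1_comp _ a (fun s : R => s - z.1) x _ _ (da (x - z.1))
  (is_derive_shift z.1 x).
have d2 := is_deriveZ (b (y - z.2)) d1.
have -> : (fun s => tens a b z (s, y)) =
    ((b (y - z.2)) \*: (a \o (fun s : R => s - z.1)) : R -> R).
  by apply/funext => s; rewrite /tens /= /GRing.scale /= mulrC.
by apply: is_derive_eq d2 _; rewrite /tens /GRing.scale /=; ring.
Qed.

Lemma isd_tens_ey a b b' z t : (forall x : R, is_derive x 1 b (b' x)) ->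
  isd ey (tens a b z) t (tens a b' z t).
Proof.
move=> db; case: t => x y; apply/isd_ey.
have d1 := @is_derive1_comp _ b (fun s : R => s - z.2) y _ _ (db (y - z.2))
  (is_derive_shift z.2 y).
have d2 := is_deriveZ (a (x - z.1)) d1.
have -> : (fun s => tens a b z (x, s)) =
    ((a (x - z.1)) \*: (b \o (fun s : R => s - z.2)) : R -> R).
  by apply/funext => s; rewrite /tens /= /GRing.scale /=.
by apply: is_derive_eq d2 _; rewrite /tens /GRing.scale /=; ring.
Qed.

Lemma dd_eq (e : R * R) f g : (forall z, isd e f z (g z)) -> dd e f = g.
Proof. by move=> H; apply/funext => z; have /isdP[] := H z. Qed.

(** The derivatives of the smeared function fall on the kernel, and Green's
    identity moves them to [phi]. *)
Lemma laplacian_smear phi K r a b : compact K -> vanish_off K phi -> C2 setT phi ->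
  molf r a -> molf r b ->
  laplacian (smear phi a b) = smear (laplacian phi) a b.
Proof.
move=> cK fK C2p ma mb.
have cphi : continuous phi by case: C2p => c _ _ z; exact: c.
have Cphi : Cc phi by split => //; exists K.
have [a' ma' da] := molf_derive ma; have [b' mb' db] := molf_derive mb.
have [a'' ma'' da'] := molf_derive ma'; have [b'' mb'' db'] := molf_derive mb'.
have N (c c' : R -> R) : (forall x : R, is_derive x 1 c (c' x)) ->
    forall x : R, is_derive x 1 (fun x => (-1) * c x) ((-1) * c' x).
  by move=> H x; have := is_deriveZ (-1) (H x).
apply/funext => z; rewrite laplacianE.
rewrite (dd_eq (fun z => smear_isd_ex Cphi z ma ma' mb da)).
rewrite (dd_eq (fun z => smear_isd_ex Cphi z (molfZ _ ma') (molfZ _ ma'') mb (N _ _ da'))).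
rewrite (dd_eq (fun z => smear_isd_ey Cphi z ma mb' mb db)).
rewrite (dd_eq (fun z => smear_isd_ey Cphi z ma (molfZ _ mb'') (molfZ _ mb') (N _ _ db'))).
have ca := molf_cont ma; have cb := molf_cont mb.
have ca' := molf_cont ma'; have cb' := molf_cont mb'.
have ca'' := molf_cont ma''; have cb'' := molf_cont mb''.
have T1 : dd ex (tens a b z) = tens a' b z by apply: dd_eq => t; exact: isd_tens_ex.
have T2 : dd ex (tens a' b z) = tens a'' b z by apply: dd_eq => t; exact: isd_tens_ex.
have T3 : dd ey (tens a b z) = tens a b' z by apply: dd_eq => t; exact: isd_tens_ey.
have T4 : dd ey (tens a b' z) = tens a b'' z by apply: dd_eq => t; exact: isd_tens_ey.
have CT : C2 setT (tens a b z).
  split.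
  - by move=> t _; exact: continuous_tens.
  - move=> t _; split.
    + by have /isdP[] := isd_tens_ex b z t da.
    + by rewrite T1; have /isdP[] := isd_tens_ex b z t da'.
    + by rewrite T1; exact: continuous_tens.
    + by rewrite T1 T2; exact: continuous_tens.
  - move=> t _; split.
    + by have /isdP[] := isd_tens_ey a z t db.
    + by rewrite T3; have /isdP[] := isd_tens_ey a z t db'.
    + by rewrite T3; exact: continuous_tens.
    + by rewrite T3 T4; exact: continuous_tens.
have G := green cK (@openT _) (fun _ _ => I) fK C2p CT.
have mA := molfZ (-1) (molfZ (-1) ma''); have mB := molfZ (-1) (molfZ (-1) mb'').
rewrite {3}/smear -G.
rewrite -(intpD (Cc_smear Cphi z (molf_cont mA) cb) (Cc_smear Cphi z ca (molf_cont mB))).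
congr intp; apply/funext => t.
by rewrite laplacianE T1 T2 T3 T4 /tens; ring.
Qed.

Definition fatten K (r : R) : set (R * R) :=
  [set z | exists2 t, K t & `|z - t| <= r].

Lemma fatten_compact K r : compact K -> compact (fatten K r).
Proof.
move=> cK.
have -> : fatten K r =
    (fun y : (R * R) * (R * R) => y.1 + y.2) @` (K `*` (box r : set (R * R))).
  apply/seteqP; split => [z [t Kt zt]|_ [[t s] [/= Kt [/= s1 s2]] <-]].
    exists (t, z - t); last by rewrite /= addrC subrK.
    split => //; move: zt; rewrite prod_normE /= ge_max => /andP[h1 h2].
    by split; rewrite /= in_itv /= -ler_norml.
  exists t => //; rewrite addrC addKr prod_normE /= ge_max.
  by rewrite !in_itv /= -!ler_norml in s1 s2; rewrite s1 s2.
apply: continuous_compact; last by apply: compact_setX => //; exact: box_compact.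
by apply: continuous_subspaceT => y; apply: cvgD; [exact: cvg_fst|exact: cvg_snd].
Qed.

Lemma fatten_sub K D : compact K -> open D -> K `<=` D ->
  exists2 r, 0 < r & fatten K r `<=` D.
Proof.
move=> cK oD KD.
have : \forall r \near (0 : R)^'+, K `<=` [set z | forall t, `|t - z| <= r -> D t].
  move/compact_near_coveringP: cK => /(_ R (0 : R)^'+
    (fun r z => forall t, `|t - z| <= r -> D t)); apply.
  move=> z Kz; have /nbhs_ballP[e /= e0 He] : nbhs z D.
    by apply: open_nbhs_nbhs; split => //; exact: KD.
  exists (ball z (e / 2), [set r | r < e / 2]).
    split; first by apply: nbhsx_ballx; lra.
    by apply: nbhs_right_lt; lra.
  move=> [y r] [/= zy re] t ty; apply: He; rewrite -ball_normE /=.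
  rewrite -ball_normE /= in zy.
  have -> : z - t = (z - y) + - (t - y) by rewrite opprB addrA subrK.
  by rewrite (le_lt_trans (ler_normD _ _)) // normrN; lra.
move=> [e /= e0 He].
exists (e / 2); first by lra.
move=> z [t Kt zt]; apply: (He (e / 2) _ _ t Kt z zt); last by rewrite /=; lra.
by rewrite /ball /= sub0r normrN gtr0_norm; lra.
Qed.

(** A single compact set K' carries all the approximations, so that a weak
    equation for a locally integrable function passes to the limit. *)
Lemma mollify phi K D : C2 setT phi -> compact K -> open D -> K `<=` D ->
  vanish_off K phi ->
  exists K', [/\ compact K', K' `<=` D, K `<=` K' &
    forall eta, 0 < eta -> exists psi, [/\ smooth setT psi, vanish_off K' psi,
      forall z, `|psi z - phi z| <= eta &
      forall z, `|laplacian psi z - laplacian phi z| <= eta]].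
Proof.
move=> C2p cK oD KD fK.
have [r1 r10 fD] := fatten_sub cK oD KD.
exists (fatten K r1); split => //; first exact: fatten_compact.
  by move=> z Kz; exists z => //; rewrite subrr normr0 ltW.
move=> eta eta0.
have cphi : continuous phi by case: C2p => c _ _ z; exact: c.
have Cphi : Cc phi by split => //; exists K.
have Clap := laplacian_Cc cK fK C2p.
have [ra ra0 Ha] := smear_approx Cphi eta0.
have [rb rb0 Hb] := smear_approx Clap eta0.
pose r := Num.min r1 (Num.min ra rb).
have r0 : 0 < r by rewrite !lt_min r10 ra0 rb0.
have [rr1 rra rrb] : [/\ r <= r1, r <= ra & r <= rb].
  by rewrite !ge_min !lexx !orbT.
have mr := molf_rho r; have mr' := molfZ (mass r)^-1 mr.
exists (smear phi (fun x => (mass r)^-1 * rho r x) (rho r)); split.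
- exact: (smear_smooth Cphi mr' mr).
- move=> z nz; rewrite /smear.
  have -> : (fun t => phi t * tens (fun x => (mass r)^-1 * rho r x) (rho r) z t) =
      (fun=> 0).
    apply/funext => t; case: (pselect (K t)) => Kt; last by rewrite fK // mul0r.
    rewrite (tens_far mr' mr) ?mulr0 // (le_lt_trans rr1) // ltNge; apply/negP => zt.
    by apply: nz; exists t.
  by rewrite /intp Rintegral_cst // mul0r.
- exact: Ha.
- by rewrite (laplacian_smear cK fK C2p mr' mr); exact: Hb.
Qed.

End Approximation.

(** * The weak equation tested against C^2 functions *)

Section WeakFormulation.
Set Implicit Arguments.
Unset Strict Implicit.
Context {R : realType}.
Implicit Types (phi : R * R -> R) (K D : set (R * R)).
Local Notation P2 := (measurableTypeR R * measurableTypeR R)%type.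

(** An integrable function is finite almost everywhere, so it may be replaced by
    its finite part. *)
Lemma integral_fine (K : set P2) (u : R * R -> \bar R) (f : R * R -> R) : measurable K ->
  area.-integrable K u -> measurable_fun K f ->
  (exists M, forall z, K z -> `|f z| <= M) ->
  area.-integrable K (EFin \o (fun z => fine (u z) * f z)) /\
  (\int[area]_(z in K) (u z * (f z)%:E) = \int[area]_(z in K) (fine (u z) * f z)%:E)%E.
Proof.
move=> mK iu mf [M fM].
have mu := measurable_int _ iu.
have mU : measurable_fun K (fine \o u) by exact: measurableT_comp.
have bf : [bounded f z | z in K].
  by exists M; split; [exact: num_real|move=> x Mx z Kz /=; exact: le_trans (fM z Kz) (ltW Mx)].
have iuf : area.-integrable K (fun z => u z * (f z)%:E)%E.
  exact: integrableMl.
have E : ae_eq area K (fun z => u z * (f z)%:E)%E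
    (EFin \o (fun z => fine (u z) * f z)).
  have := integrable_ae mK iu; apply: filterS => z H Kz.
  by rewrite /= EFinM fineK //; exact: H.
have mUf : measurable_fun K (EFin \o (fun z => fine (u z) * f z)).
  by apply/measurable_EFinP; exact: measurable_funM.
split; last by apply: ae_eq_integral => //; exact: measurable_int iuf.
apply: (le_integrable mK mUf _ iuf) => z _.
rewrite abseM /= normrM EFinM lee_wpmul2r ?lee_fin //.
by case: (u z) => [x| |] //=; rewrite leey.
Qed.

Lemma schrodinger_bounded K D q phi : compact K -> K `<=` D -> open D ->
  (forall z, D z -> {for z, continuous q}) -> C2 setT phi ->
  measurable_fun (K : set P2) (schrodinger q phi) /\
  exists M, forall z, K z -> `|schrodinger q phi z| <= M.
Proof.
move=> cK KD oD cq [cp Cx Cy].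
have cs z : D z -> {for z, continuous (schrodinger q phi)}.
  move=> Dz; have [_ _ _ cx] := Cx z I; have [_ _ _ cy] := Cy z I.
  have -> : schrodinger q phi =
     (fun z => dd ex (dd ex phi) z + dd ey (dd ey phi) z - q z * phi z).
    by apply/funext => y; rewrite /schrodinger laplacianE.
  exact: (cvgB (cvgD cx cy) (cvgM (cq z Dz) (cp z I))).
have mK := compact_measurable_plane cK.
split.
  apply: (@measurable_funS _ _ _ _ D) => //; first exact: open_measurable_plane.
  exact: continuous_measurable_plane.
have [M _ bM] := continuous_compact_bounded cK (fun z Kz => cs z (KD z Kz)).
by exists M.
Qed.

(** The truncated potentials that serve as test functions below are not smooth.
    Uniform approximation of phi and of its Laplacian extends the weak equation
    to them. *)
Lemma fundamental_C2 D q w (u : R * R -> \bar R) K phi : open D ->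
  (forall z, D z -> {for z, continuous q}) ->
  fundamental_solution D q w u ->
  C2 setT phi -> compact K -> K `<=` D -> vanish_off K phi ->
  (\int[area]_(z in D) (u z * (schrodinger q phi z)%:E) = (phi w)%:E)%E.
Proof.
move=> oD cq [iu Hu] C2p cK KD fK.
have [K' [cK' K'D KK' H]] := mollify C2p cK oD KD fK.
have iuK' : area.-integrable K' u by exact: iu.
have mK' := compact_measurable_plane cK'.
have mD := open_measurable_plane oD.
have fK' : vanish_off K' phi by move=> z nz; apply: fK => /KK'.
have red psi : C2 setT psi -> vanish_off K' psi ->
   area.-integrable K' (EFin \o (fun z => fine (u z) * schrodinger q psi z)) /\
   (\int[area]_(z in D) (u z * (schrodinger q psi z)%:E) =
    \int[area]_(z in K') (fine (u z) * schrodinger q psi z)%:E)%E.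
  move=> C2psi psiK'.
  have [ms bs] := schrodinger_bounded cK' K'D oD cq C2psi.
  have [i1 <-] := integral_fine mK' iuK' ms bs; split => //.
  rewrite [LHS]integral_mkcond [RHS]integral_mkcond.
  apply: eq_integral => z _; rewrite !patchE.
  have [/set_mem Kz|nK] := boolP (z \in K').
    by rewrite ifT //; apply/mem_set/K'D.
  case: ifP => // _; rewrite notin_setE in nK; rewrite /schrodinger.
  by rewrite (vanish_laplacian cK' psiK' nK) psiK' // mulr0 subr0 mule0.
have [i1 ->] := red phi C2p fK'.
have fin1 := integrable_fin_num mK' i1.
rewrite -(fineK fin1); congr EFin.
have iU : area.-integrable K' (EFin \o (fun z => fine (u z))).
  have [] := @integral_fine K' u (cst 1) mK' iuK' (measurable_cst _).
    by exists 1 => z _; rewrite normr1.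
  by move=> + _; under [X in _.-integrable _ (_ \o X)]eq_fun do rewrite mulr1.
have [Q /ltW Q0 bQ] := continuous_compact_bounded cK' (fun z Kz => cq z (K'D z Kz)).
pose A : R := (\int[area]_(z in K') `|fine (u z)|)%R.
have A0 : 0 <= A by apply: Rintegral_ge0 => z _.
apply/eqP; rewrite -subr_eq0 -normr_le0; apply/ler_addgt0Pl => e e0.
rewrite addr0.
pose eta := e / (1 + (1 + Q) * A).
have den : 0 < 1 + (1 + Q) * A by rewrite ltr_pwDl // mulr_ge0 // addr_ge0.
have eta0 : 0 < eta by rewrite divr_gt0.
have [psi [spsi psiK' d1 d2]] := H eta eta0.
have C2psi : C2 setT psi by apply: Ck2_C2; exact: spsi.
have tpsi : test_function D psi by split => //; exists K'; split.
have [i2 E2] := red psi C2psi psiK'.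
have := Hu psi tpsi; rewrite E2 => E3.
have -> : phi w = (phi w - psi w) + fine (\int[area]_(z in K') (fine (u z) * schrodinger q psi z)%:E)%E.
  by rewrite E3 /= subrK.
set I1 := fine _; set I2 := fine _.
have -> : I1 - (phi w - psi w + I2) = (I1 - I2) + (psi w - phi w) by ring.
have -> : e = (1 + Q) * A * eta + eta by rewrite /eta; field; rewrite gt_eqF.
apply: le_trans (ler_normD _ _) _; apply: lerD => //.
have -> : I1 - I2 = (\int[area]_(z in K')
   (fine (u z) * schrodinger q phi z - fine (u z) * schrodinger q psi z))%R.
  by rewrite /I1 /I2 RintegralB.
apply: le_trans (le_normr_Rintegral mK' _) _; first exact: (integrableB mK' i1 i2).
rewrite -mulrA [A * _]mulrC mulrA /A -RintegralZl //; last first.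
  exact: (integrable_norm iU).
apply: le_Rintegral => //.
- exact: (integrable_norm (integrableB mK' i1 i2)).
- exact: (integrableZl mK' _ (integrable_norm iU)).
move=> z Kz; rewrite -mulrBr normrM mulrC ler_wpM2r // /schrodinger.
have alg (a b c d f : R) : a - c * d - (b - c * f) = - (b - a) + c * (f - d) by ring.
rewrite alg.
apply: le_trans (ler_normD _ _) _; rewrite normrN mulrDl mul1r.
by apply: lerD => //; rewrite normrM; apply: ler_pM => //; exact: bQ.
Qed.

End WeakFormulation.

(** * Spline truncations of the line *)

Section Splines.
Set Implicit Arguments.
Unset Strict Implicit.
Context {R : realType}.
Implicit Types (t x y s o : R).

Definition pos x : R := Num.max x 0.

Lemma pos_eq0 x : x <= 0 -> pos x = 0.
Proof. by move=> x0; rewrite /pos max_r. Qed.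

Lemma pos_id x : 0 <= x -> pos x = x.
Proof. by move=> x0; rewrite /pos max_l. Qed.

Lemma pos_ge0 x : 0 <= pos x.
Proof. by rewrite /pos le_max lexx orbT. Qed.

Lemma pos_norm x : pos x <= `|x|.
Proof. by rewrite /pos ge_max ler_norm normr_ge0. Qed.

Lemma continuous_pos : continuous pos.
Proof.
move=> x; apply: (@continuous_max _ _ (id : R -> R) (cst 0)).
  exact: cvg_id.
exact: cvg_cst.
Qed.

(** At 0 the difference quotient is at most the norm of the increment. *)
Lemma is_derive_posX (n : nat) x :
  is_derive x 1 (fun y => pos y ^+ n.+2) (n.+2%:R * pos x ^+ n.+1).
Proof.
have [x0|x0|->] := ltgtP x 0.
- have nx : \forall y \near x, cst 0 y = pos y ^+ n.+2.
    near=> y; rewrite pos_eq0 ?expr0n //; apply: ltW; near: y; exact: lt_nbhsl.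
  apply: near_eq_is_derive nx _.
  by rewrite pos_eq0 ?(ltW x0) // expr0n mulr0; exact: (is_derive_cst (0 : R) x 1).
- have nx : \forall y \near x, y ^+ n.+2 = pos y ^+ n.+2.
    near=> y; rewrite pos_id //; apply: ltW; near: y; exact: lt_nbhsr.
  apply: near_eq_is_derive nx _; rewrite pos_id ?(ltW x0) //.
  apply: DeriveDef; first exact: exprn_derivable.
  by rewrite exp_derive /GRing.scale /= mulr1.
- rewrite [pos 0]pos_eq0 // expr0n mulr0.
  have L : h^-1 *: (pos (h *: 1 + 0) ^+ n.+2 - pos 0 ^+ n.+2) @[h --> (0 : R)^'] --> (0 : R).
    apply/cvgrPdist_le => e e0; near=> h.
    rewrite sub0r normrN [pos 0]pos_eq0 // expr0n subr0 addr0 [_%:A]mulr1.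
    rewrite normrM normfV normrX (ger0_norm (pos_ge0 _)) exprSr mulrCA.
    have hn0 : 0 < `|h| by rewrite normr_gt0; near: h; exact: nbhs_dnbhs_neq.
    have h1 : `|h| <= 1 by near: h; apply: dnbhs0_le.
    have he : `|h| <= e by near: h; apply: dnbhs0_le.
    apply: le_trans (_ : pos h ^+ n.+1 * 1 <= _).
      rewrite ler_wpM2l ?exprn_ge0 ?pos_ge0 // mulrC ler_pdivrMr // mul1r.
      exact: pos_norm.
    rewrite mulr1 exprS (le_trans _ he) //.
    rewrite -[leRHS]mulr1; apply: ler_pM; rewrite ?exprn_ge0 ?pos_ge0 ?pos_norm //.
    by rewrite exprn_ile1 ?pos_ge0 // (le_trans (pos_norm h)).
  apply: DeriveDef; first by apply/cvg_ex; exists 0.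
  exact: cvg_lim L.
Unshelve. all: by end_near. Qed.

(** The tent of mass one on the interval from 0 to 2 with its first and second
    primitives. *)
Definition hat0 y : R := pos y - 2 * pos (y - 1) + pos (y - 2).
Definition hat1 y : R := (pos y ^+ 2 - 2 * pos (y - 1) ^+ 2 + pos (y - 2) ^+ 2) / 2.
Definition hat2 y : R := (pos y ^+ 3 - 2 * pos (y - 1) ^+ 3 + pos (y - 2) ^+ 3) / 6.

Lemma is_derive_shiftX (n : nat) (c x : R) :
  is_derive x 1 (fun y => pos (y - c) ^+ n.+2) (n.+2%:R * pos (x - c) ^+ n.+1).
Proof.
have := @is_derive1_comp _ (fun y => pos y ^+ n.+2) (fun s : R => s - c) x _ _
  (is_derive_posX n (x - c)) (is_derive_shift c x).
by rewrite mulr1.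
Qed.

Lemma hat2_derive x : is_derive x 1 hat2 (hat1 x).
Proof.
have d0 := is_derive_posX 1 x; have d1 := is_derive_shiftX 1 1 x.
have d2 := is_derive_shiftX 1 2 x.
have D := is_deriveZ (6^-1) (is_deriveD (is_deriveB d0 (is_deriveZ 2 d1)) d2).
have -> : hat2 = (6^-1 \*: ((fun y => pos y ^+ 3) - 2 \*: (fun y => pos (y - 1) ^+ 3)
   + (fun y => pos (y - 2) ^+ 3)) : R -> R).
  by apply/funext => y; rewrite /hat2 /GRing.scale /= mulrC.
apply: is_derive_eq D _; rewrite /hat1 /GRing.scale /=; by field.
Qed.

Lemma hat1_derive x : is_derive x 1 hat1 (hat0 x).
Proof.
have d0 := is_derive_posX 0 x; have d1 := is_derive_shiftX 0 1 x.
have d2 := is_derive_shiftX 0 2 x.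
have D := is_deriveZ (2^-1) (is_deriveD (is_deriveB d0 (is_deriveZ 2 d1)) d2).
have -> : hat1 = (2^-1 \*: ((fun y => pos y ^+ 2) - 2 \*: (fun y => pos (y - 1) ^+ 2)
   + (fun y => pos (y - 2) ^+ 2)) : R -> R).
  by apply/funext => y; rewrite /hat1 /GRing.scale /= mulrC.
apply: is_derive_eq D _; rewrite /hat0 /GRing.scale /= !expr1; by field.
Qed.

Lemma continuous_hat0 : continuous hat0.
Proof.
move=> y; rewrite /hat0.
have cp (c : R) : {for y, continuous (fun y => pos (y - c))}.
  apply: (@continuous_comp _ _ _ (fun y : R => y - c) pos); last exact: continuous_pos.
  by apply: cvgB; [exact: cvg_id|exact: cvg_cst].
apply: cvgD (cp 2); apply: cvgB; first exact: continuous_pos.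
by apply: cvgM; [exact: cvg_cst|exact: (cp 1)].
Qed.

Lemma hat_le0 y : y <= 0 -> [/\ hat0 y = 0, hat1 y = 0 & hat2 y = 0].
Proof.
move=> y0; rewrite /hat0 /hat1 /hat2 !pos_eq0; [|lra..].
by rewrite !expr0n; split; ring.
Qed.

Lemma hat_ge2 y : 2 <= y -> [/\ hat0 y = 0, hat1 y = 1 & hat2 y = y - 1].
Proof.
move=> y0; rewrite /hat0 /hat1 /hat2 !pos_id; [|lra..].
by split; field.
Qed.

Lemma hat0_ge0 y : 0 <= hat0 y.
Proof.
rewrite /hat0.
have [y0|y0] := leP y 0; first by rewrite !pos_eq0; lra.
have [y1|y1] := leP y 1; first by rewrite (pos_id (ltW y0)) !pos_eq0; lra.
have [y2|y2] := leP y 2; first by rewrite (pos_id (ltW y0)) (pos_id (_ : 0 <= y - 1)) ?(pos_eq0 (_ : y - 2 <= 0)); lra.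
by rewrite !pos_id; lra.
Qed.

Lemma hat0_1 : hat0 1 = 1.
Proof. by rewrite /hat0 !(pos_id (_ : 0 <= 1)) // !pos_eq0 ?pos_id; lra. Qed.

(** A tent of mass one between - o - 2 s and - o. The signs are such that [ramp]
    is the derivative of [kink] and [hat] is minus the derivative of [ramp]. *)
Definition hat s o t : R := s^-1 * hat0 ((- t - o) / s).
Definition ramp s o t : R := hat1 ((- t - o) / s).
Definition kink s o t : R := - s * hat2 ((- t - o) / s).

Lemma is_derive_aff s o t : is_derive t 1 (fun t => (- t - o) / s) (- s^-1).
Proof.
have D := is_deriveZ (s^-1) (is_deriveB (is_deriveN (is_derive_id t 1)) (is_derive_cst o t 1)).
have -> : (fun t => (- t - o) / s) = (s^-1 \*: (- id - cst o) : R -> R).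
  by apply/funext => y; rewrite /GRing.scale /= mulrC.
by apply: is_derive_eq D _; rewrite /GRing.scale /= subr0 mulrN1.
Qed.

Lemma ramp_derive s o t : is_derive t 1 (ramp s o) (- hat s o t).
Proof.
have := @is_derive1_comp _ hat1 (fun t => (- t - o) / s) t _ _ (hat1_derive _) (is_derive_aff s o t).
by move/is_derive_eq; apply; rewrite /hat mulrN mulrC.
Qed.

Lemma kink_derive s o t : s != 0 -> is_derive t 1 (kink s o) (ramp s o t).
Proof.
move=> s0; have := @is_derive1_comp _ hat2 (fun t => (- t - o) / s) t _ _ (hat2_derive _) (is_derive_aff s o t).
move=> /(is_deriveZ (- s)) D; apply: is_derive_eq D _.
by rewrite /GRing.scale /= /ramp; field.
Qed.

Lemma continuous_hat s o : continuous (hat s o).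
Proof.
move=> t; apply: cvgM; first exact: cvg_cst.
apply: (@continuous_comp _ _ _ (fun t : R => (- t - o) / s) hat0); last exact: continuous_hat0.
exact: (is_derive_continuous (is_derive_aff s o)).
Qed.

Lemma hat_ge0 s o t : 0 < s -> 0 <= hat s o t.
Proof. by move=> s0; rewrite mulr_ge0 ?hat0_ge0 // invr_ge0 ltW. Qed.

Lemma hat_right s o t : 0 < s -> - o <= t ->
  [/\ hat s o t = 0, ramp s o t = 0 & kink s o t = 0].
Proof.
move=> s0 h; have : (- t - o) / s <= 0 by rewrite ler_pdivrMr // mul0r; lra.
by rewrite /hat /ramp /kink => /hat_le0[-> -> ->]; rewrite !mulr0.
Qed.

Lemma hat_left s o t : 0 < s -> t <= - o - 2 * s ->
  [/\ hat s o t = 0, ramp s o t = 1 & kink s o t = t + o + s].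
Proof.
move=> s0 h; have : 2 <= (- t - o) / s by rewrite ler_pdivlMr //; lra.
rewrite /hat /ramp /kink => /hat_ge2[-> -> ->]; rewrite mulr0; split => //.
by field; rewrite gt_eqF.
Qed.

Lemma hat_supp s o t : 0 < s -> hat s o t != 0 -> - o - 2 * s <= t <= - o.
Proof.
move=> s0 h; apply/andP; split; rewrite leNgt; apply/negP => /ltW H.
  by have [E _ _] := hat_left s0 H; rewrite E eqxx in h.
by have [E _ _] := hat_right s0 H; rewrite E eqxx in h.
Qed.

(** Zero to the right of - o1, constant to the left of - o2 - 2 s2, and a
    translate of the identity in between. *)
Definition trunc s1 o1 s2 o2 t : R := kink s1 o1 t - kink s2 o2 t.

End Splines.

(** * Potentials with a single pole and their flux *)

Section PolePotentialDef.
Set Implicit Arguments.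
Unset Strict Implicit.

(** What the Green function shares with the logarithm, and all that is used to
    recover the value of a solution at the pole: v is harmonic off w, tends to
    -oo at w and only there, and its negative sublevel sets are compact. *)
Record pole_potential {R : realType} (Om : set (R * R)) (w : R * R)
    (v : R * R -> R) : Prop := PolePotential {
  pp_open : open Om;
  pp_mem : Om w;
  pp_C2 : C2 (Om `\ w) v;
  pp_harm : forall z, (Om `\ w) z -> laplacian v z = 0;
  pp_compact : forall a, a < 0 ->
    compact [set z | z = w \/ (Om `\ w) z /\ v z <= a];
  pp_conc : forall V, nbhs w V ->
    exists M, forall z, (Om `\ w) z -> v z <= - M -> V z;
  pp_pole : forall M, \forall z \near w, z <> w -> v z <= M }.

End PolePotentialDef.

Section PolePotential.
Set Implicit Arguments.
Unset Strict Implicit.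
Context {R : realType}.
Variables (Om : set (R * R)) (w : R * R) (v : R * R -> R).
Hypothesis PP : pole_potential Om w v.
Local Notation P2 := (measurableTypeR R * measurableTypeR R)%type.
Implicit Types (F f : R -> R) (z : R * R).

Let E : set (R * R) := Om `\ w.

Lemma open_punctured (A : set (R * R)) (y : R * R) : open A -> open (A `\ y).
Proof.
move=> oA; rewrite setDE; apply: openI => //; apply: closed_openC.
apply: compact_closed; first exact: norm_hausdorff.
exact: compact_set1.
Qed.

Let oE : open E. Proof. exact: open_punctured (pp_open PP). Qed.

Definition level (a : R) : set (R * R) := [set z | z = w \/ E z /\ v z <= a].

Lemma level_compact a : a < 0 -> compact (level a).
Proof. exact: pp_compact. Qed.

Lemma level_sub a : level a `<=` Om.
Proof. by move=> z [->|[[]]] //; exact: pp_mem PP. Qed.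

(** F(v) on the punctured set, the value k at the pole and 0 outside Om. *)
Definition lift F (k : R) z : R :=
  if z == w then k else if `[< Om z >] then F (v z) else 0.

Lemma liftE F k z : E z -> lift F k z = F (v z).
Proof.
move=> [Oz zw]; rewrite /lift; case: eqP => // _.
by case: asboolP.
Qed.

Lemma lift_w F k : lift F k w = k.
Proof. by rewrite /lift eqxx. Qed.

Lemma lift_out F k z : ~ Om z -> lift F k z = 0.
Proof.
move=> nO; rewrite /lift; case: eqP => [zw|_].
  by exfalso; apply: nO; rewrite zw; exact: pp_mem PP.
by case: asboolP.
Qed.

(** F is constant far to the left and vanishes to the right of a negative
    number; F(v) then extends across the pole and has compact support. *)
Definition cut F (k a b : R) :=
  [/\ b < 0, forall t, b <= t -> F t = 0 & forall t, t <= a -> F t = k].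

Lemma lift_nearE F k z : E z -> \forall y \near z, (F \o v) y = lift F k y.
Proof.
move=> Ez; near=> y; rewrite liftE //; near: y.
by apply: open_nbhs_nbhs.
Unshelve. all: by end_near. Qed.

Lemma lift_vanish F k a b : cut F k a b -> vanish_off (level b) (lift F k).
Proof.
move=> [b0 Fb Fa] z nL; case: (pselect (E z)) => [Ez|nE].
  rewrite liftE // Fb // leNgt; apply/negP => /ltW h; apply: nL.
  by right.
case: (eqVneq z w) => [zw|zw]; first by exfalso; apply: nL; left.
by rewrite lift_out // => Oz; apply: nE; split => //; exact/eqP.
Qed.

Lemma lift_near_cst F k a b z : cut F k a b -> ~ E z ->
  \forall y \near z, lift F k z = lift F k y.
Proof.
move=> cF nE; have [b0 Fb Fa] := cF.
case: (eqVneq z w) => [->|zw].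
  have p1 := pp_pole PP a.
  have p2 : \forall y \near w, Om y.
    by apply: open_nbhs_nbhs; split; [exact: pp_open PP|exact: pp_mem PP].
  near=> y; rewrite lift_w; case: (eqVneq y w) => [->|/eqP yw].
    by rewrite lift_w.
  have Ey : E y by split => //; near: y.
  by rewrite liftE // Fa //; move: yw; near: y.
have nO : ~ Om z by move=> Oz; apply: nE; split => //; exact/eqP.
rewrite lift_out //.
apply: (near_vanish (level_compact b0) (lift_vanish cF)).
by move=> /level_sub.
Unshelve. all: by end_near. Qed.

Lemma cut0_off F a b z : cut F 0 a b -> ~ E z -> lift F 0 z = 0.
Proof.
move=> cF nE; case: (eqVneq z w) => [->|zw]; first by rewrite lift_w.
by rewrite lift_out // => Oz; apply: nE; split => //; exact/eqP.
Qed.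

Lemma lift_mul_Cc f a b (g : R * R -> R) : cut f 0 a b -> continuous f ->
  (forall z, E z -> {for z, continuous g}) -> Cc (fun z => lift f 0 z * g z).
Proof.
move=> cF cf cg; have [b0 _ _] := cF; split; last first.
  exists (level b); first exact: level_compact.
  by move=> z nL; rewrite (lift_vanish cF) // mul0r.
move=> z; case: (pselect (E z)) => Ez.
  apply: cvgM; last exact: cg.
  apply: (continuous_near (lift_nearE f 0 Ez)).
  apply: continuous_comp_pt; last exact: cf.
  by have [c _ _] := pp_C2 PP; exact: c.
apply: (@continuous_near _ (cst 0)); last exact: cst_continuous.
apply: filterS (lift_near_cst cF Ez) => y.
by rewrite (cut0_off cF Ez) => <-; rewrite mul0r.
Qed.

Definition grad2 z : R := dd ex v z ^+ 2 + dd ey v z ^+ 2.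
(** The Laplacian of F(v) when f = F'', because v is harmonic. *)
Definition dens f z : R := lift f 0 z * grad2 z.

Let c2 z : E z -> [/\ {for z, continuous v}, {for z, continuous (dd ex v)},
  {for z, continuous (dd ey v)}, {for z, continuous (dd ex (dd ex v))} &
  {for z, continuous (dd ey (dd ey v))}].
Proof.
move=> Ez; have [cv Cx Cy] := pp_C2 PP.
have [_ _ c1 c2] := Cx z Ez; have [_ _ c3 c4] := Cy z Ez.
by split => //; exact: cv.
Qed.

Lemma grad2_cont z : E z -> {for z, continuous grad2}.
Proof.
move=> Ez; have [_ cx cy _ _] := c2 Ez.
have -> : grad2 = (fun y => dd ex v y * dd ex v y + dd ey v y * dd ey v y).
  by apply/funext => y; rewrite /grad2 !expr2.
exact: (cvgD (cvgM cx cx) (cvgM cy cy)).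
Qed.

Lemma dens_Cc f a b : cut f 0 a b -> continuous f -> Cc (dens f).
Proof. by move=> cf cont; apply: lift_mul_Cc cf cont _ => z; exact: grad2_cont. Qed.

Lemma grad2_ge0 z : 0 <= grad2 z.
Proof. by rewrite addr_ge0 // sqr_ge0. Qed.

Lemma dens_ge0 f a b z : cut f 0 a b -> (forall t, 0 <= f t) -> 0 <= dens f z.
Proof.
move=> cf f0; rewrite mulr_ge0 ?grad2_ge0 //.
case: (pselect (E z)) => Ez; first by rewrite liftE.
by rewrite (cut0_off cf Ez).
Qed.

Lemma lift_C2 F F' F'' k a b :
  (forall t : R, is_derive t 1 F (F' t)) ->
  (forall t : R, is_derive t 1 F' (F'' t)) -> continuous F'' ->
  cut F k a b -> cut F'' 0 a b ->
  [/\ C2 setT (lift F k), laplacian (lift F k) = dens F'' &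
      Cc (dens F'')].
Proof.
move=> dF dF' cF'' cF c0.
have [cv Cx Cy] := pp_C2 PP.
have [Dx _ Lx] := C2dir_comp oE cv Cx dF dF' cF''.
have [Dy _ Ly] := C2dir_comp oE cv Cy dF dF' cF''.
have CF := is_derive_continuous dF.
have dir (e : R * R) : C2dir e E (F \o v) -> C2dir e setT (lift F k).
  move=> De; apply: C2dir_near => z _; case: (pselect (E z)) => Ez.
    by exists (F \o v), E; split => //; exact: lift_nearE.
  exists (fun=> lift F k z), setT; split => //; first exact: C2dir_cst.
  exact: (lift_near_cst cF Ez).
split; [split| |exact: dens_Cc c0 cF''].
- move=> z _; case: (pselect (E z)) => Ez.
    apply: (continuous_near (lift_nearE F k Ez)).
    by apply: continuous_comp_pt; [exact: cv|exact: CF].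
  by apply: continuous_near (lift_near_cst cF Ez) _; exact: cst_continuous.
- exact: dir.
- exact: dir.
apply/funext => z; rewrite laplacianE; case: (pselect (E z)) => Ez.
  have L (e : R * R) : dd e (dd e (lift F k)) z = dd e (dd e (F \o v)) z.
    by rewrite (nbhs_singleton (dd_near e (dd_near e (lift_nearE F k Ez)))).
  rewrite !L Lx // Ly // /dens liftE // /grad2.
  have := pp_harm PP Ez; rewrite laplacianE => H.
  have -> : forall p q r s t u : R, p * q + r * s + (p * t + r * u) =
    p * (q + t) + r * (s + u) by move=> *; ring.
  by rewrite H mulr0 addr0.
have L (e : R * R) : dd e (dd e (lift F k)) z = 0.
  have H := dd_near e (dd_near e (lift_near_cst cF Ez)).
  by rewrite -(nbhs_singleton H) !dd_cst.
by rewrite !L addr0 /dens (cut0_off c0 Ez) mul0r.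
Qed.

(** One direction of the divergence of f(v) grad v. *)
Lemma flux_dir (e : R * R) f f' a b :
  (forall h, vanish_off (level b) h -> (forall z, diffb e h z) ->
     continuous (dd e h) -> intp (dd e h) = 0) ->
  C2dir e E v ->
  (forall t : R, is_derive t 1 f (f' t)) -> continuous f' ->
  cut f 0 a b -> cut f' 0 a b ->
  [/\ Cc (fun z => lift f' 0 z * dd e v z ^+ 2),
      Cc (fun z => lift f 0 z * dd e (dd e v) z) &
  intp (fun z => lift f' 0 z * dd e v z ^+ 2) +
  intp (fun z => lift f 0 z * dd e (dd e v) z) = 0].
Proof.
move=> I0 Ce df cf' cf c0.
have CF := is_derive_continuous df.
have C1 : Cc (fun z => lift f' 0 z * dd e v z ^+ 2).
  apply: lift_mul_Cc c0 cf' _ => z Ez; have [_ _ c1 _] := Ce z Ez.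
  have -> : (fun z => dd e v z ^+ 2) = (fun z => dd e v z * dd e v z).
    by apply/funext => y; rewrite expr2.
  exact: (cvgM c1 c1).
have C2' : Cc (fun z => lift f 0 z * dd e (dd e v) z).
  by apply: lift_mul_Cc cf CF _ => z Ez; have [_ _ _ c1] := Ce z Ez.
split => //.
rewrite -(intpD C1 C2').
pose h z := lift f 0 z * dd e v z.
have hK : vanish_off (level b) h.
  by move=> z nz; rewrite /h (lift_vanish cf) // mul0r.
have dh z : isd e h z (lift f' 0 z * dd e v z ^+ 2 + lift f 0 z * dd e (dd e v) z).
  case: (pselect (E z)) => Ez.
    have [d1 d2 _ _] := Ce z Ez.
    have D1 : isd e (lift f 0) z (f' (v z) * dd e v z).
      by apply: isd_near (lift_nearE f 0 Ez) _; apply: isd_comp => //; exact: isd_dd.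
    have := isdM D1 (isd_dd d2).
    rewrite (liftE f' 0 Ez).
    by rewrite expr2 mulrA.
  rewrite (cut0_off cf Ez) (cut0_off c0 Ez).
  rewrite !mul0r addr0; apply: (@isd_near _ _ (cst 0)); last exact: isd_cst.
  apply: filterS (lift_near_cst cf Ez) => y.
  by rewrite (cut0_off cf Ez) /h => <-; rewrite mul0r.
have E1 : dd e h = (fun z => lift f' 0 z * dd e v z ^+ 2 + lift f 0 z * dd e (dd e v) z).
  by apply/funext => z; have /isdP[] := dh z.
rewrite -E1; apply: (I0 h hK) => [z|]; first by have /isdP[] := dh z.
rewrite E1 => z; exact: cvgD (C1.1 z) (C2'.1 z).
Qed.

Lemma addr_cancel (p q r t : R) :
  p + q = 0 -> r + t = 0 -> q + t = 0 -> p + r = 0.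
Proof. by move=> h1 h2 h3; lra. Qed.

(** The field f(v) grad v has compact support and its divergence is f'(v) |grad
    v|^2, which therefore has integral zero. *)
Lemma flux0 f f' a b : (forall t : R, is_derive t 1 f (f' t)) -> continuous f' ->
  cut f 0 a b -> cut f' 0 a b -> intp (dens f') = 0.
Proof.
move=> df cf' cf c0; have [b0 _ _] := cf; have [_ Cx Cy] := pp_C2 PP.
have cK := level_compact b0.
have [X1 X2 X3] := flux_dir (fun h => @int_dd_ex _ _ h cK) Cx df cf' cf c0.
have [Y1 Y2 Y3] := flux_dir (fun h => @int_dd_ey _ _ h cK) Cy df cf' cf c0.
have -> : dens f' = (fun z => lift f' 0 z * dd ex v z ^+ 2 + lift f' 0 z * dd ey v z ^+ 2).
  by apply/funext => z; rewrite /dens /grad2 mulrDr.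
rewrite (intpD X1 Y1).
have Z : intp (fun z => lift f 0 z * dd ex (dd ex v) z) +
         intp (fun z => lift f 0 z * dd ey (dd ey v) z) = 0.
  rewrite -(intpD X2 Y2) /intp /Rintegral integral0_eq // => z _.
  rewrite -mulrDr -laplacianE; case: (pselect (E z)) => Ez.
    by rewrite (pp_harm PP Ez) mulr0.
  by rewrite (cut0_off cf Ez) mul0r.
exact: (addr_cancel X3 Y3 Z).
Qed.

Lemma cut_hat s o : 0 < s -> 0 < o -> cut (hat s o) 0 (- o - 2 * s) (- o).
Proof.
move=> s0 o0; split; first by lra.
  by move=> t ht; have [] := hat_right s0 ht.
by move=> t ht; have [] := hat_left s0 ht.
Qed.

(** By [flux_hat] any other tent of mass one gives the same number: it is the
    flux of grad v through the level curves. *)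
Definition flux : R := intp (dens (hat 1 1)).

Lemma flux_ge0 : 0 <= flux.
Proof.
apply: Rintegral_ge0 => z _; apply: (dens_ge0 z (cut_hat ltr01 ltr01)) => t.
exact: hat_ge0.
Qed.

Lemma cut_weaken f a b a' b' : a' <= a -> b <= b' -> b' < 0 -> cut f 0 a b -> cut f 0 a' b'.
Proof.
move=> aa bb b0 [_ h1 h2]; split => // t ht; [apply: h1|apply: h2].
  exact: le_trans bb ht.
exact: le_trans ht aa.
Qed.

(** Subtracting k times a fixed ramp from f reduces this to [flux0]. *)
Lemma flux_cut f f' k a b : (forall t : R, is_derive t 1 f (f' t)) ->
  continuous f' -> cut f k a b -> cut f' 0 a b -> intp (dens f') = - k * flux.
Proof.
move=> df cf' cf c0.
have ch : continuous (hat (1:R) 1) by exact: continuous_hat.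
pose g t := f t - k * ramp 1 1 t.
pose g' t := f' t + k * hat 1 1 t.
pose a' := Num.min a (- 1 - 2 * 1); pose b' := Num.max b (- 1).
have [b0 fb fa] := cf.
have b'0 : b' < 0 by rewrite gt_max b0 ltrN10.
have cg' : continuous g'.
  by move=> t; apply: cvgD; [exact: cf'|apply: cvgM; [exact: cvg_cst|exact: ch]].
have dg (t : R) : is_derive t 1 g (g' t).
  have D := is_deriveB (df t) (is_deriveZ k (ramp_derive 1 1 t)).
  have -> : g = (f - k \*: ramp 1 1 : R -> R) by apply/funext => y.
  by apply: is_derive_eq D _; rewrite /g' /GRing.scale /= mulrN opprK.
have aa : a' <= a /\ a' <= - 1 - 2 * 1 by rewrite !ge_min !lexx orbT.
have bb : b <= b' /\ - 1 <= b' by rewrite !le_max !lexx orbT.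
have cg : cut g 0 a' b'.
  split => // t ht; rewrite /g.
    rewrite fb; last exact: le_trans bb.1 ht.
    by have [_ -> _] := hat_right ltr01 (le_trans bb.2 ht); rewrite mulr0 subr0.
  rewrite fa; last exact: le_trans ht aa.1.
  by have [_ -> _] := hat_left ltr01 (le_trans ht aa.2); rewrite mulr1 subrr.
have c0' := cut_weaken aa.1 bb.1 b'0 c0.
have ch' := cut_weaken aa.2 bb.2 b'0 (cut_hat ltr01 ltr01).
have cg0 : cut g' 0 a' b'.
  have [_ h1 h2] := c0'; have [_ h3 h4] := ch'.
  by split => // t ht; rewrite /g' ?(h1 t ht) ?(h2 t ht) ?(h3 t ht) ?(h4 t ht) mulr0 addr0.
have := flux0 dg cg' cg cg0.
have -> : dens g' = (fun z => dens f' z + k * dens (hat 1 1) z).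
  apply/funext => z; rewrite /dens; case: (pselect (E z)) => Ez.
    by rewrite !liftE // /g'; ring.
  by rewrite (cut0_off cg0 Ez) (cut0_off c0 Ez) (cut0_off ch' Ez) !mul0r mulr0 addr0.
rewrite intpD; [|exact: dens_Cc c0 cf'|exact: Cc_cstM (dens_Cc ch' ch)].
rewrite intpZ; last exact: dens_Cc ch' ch.
by rewrite -/flux => /eqP; rewrite addr_eq0 mulNr => /eqP.
Qed.

Lemma flux_hat s o : 0 < s -> 0 < o -> intp (dens (hat s o)) = flux.
Proof.
move=> s0 o0.
have ch : continuous (fun t => - hat s o t).
  by move=> t; apply: cvgN; exact: continuous_hat.
have cr : cut (ramp s o) 1 (- o - 2 * s) (- o).
  split; first by lra.
    by move=> t ht; have [] := hat_right s0 ht.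
  by move=> t ht; have [] := hat_left s0 ht.
have cN : cut (fun t => - hat s o t) 0 (- o - 2 * s) (- o).
  have [h0 h1 h2] := cut_hat s0 o0.
  by split => // t ht; rewrite ?(h1 t ht) ?(h2 t ht) oppr0.
have := flux_cut (ramp_derive s o) ch cr cN.
have -> : dens (fun t => - hat s o t) = (fun z => (-1) * dens (hat s o) z).
  apply/funext => z; rewrite /dens; case: (pselect (E z)) => Ez.
    by rewrite !liftE //; ring.
  by rewrite (cut0_off cN Ez) (cut0_off (cut_hat s0 o0) Ez) !mul0r mulr0.
rewrite intpZ; last exact: dens_Cc (cut_hat s0 o0) (@continuous_hat _ s o).
by rewrite !mulN1r => /oppr_inj.
Qed.

(** The weight [dens (hat s o)] is nonnegative, has total mass [flux] and is
    carried by the band between the levels - o - 2 s and - o: it averages psi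
    over that band. *)
Lemma window (psi : R * R -> R) s o l eta : 0 < s -> 0 < o -> 0 <= eta ->
  measurable_fun [set: P2] psi ->
  (forall z, E z -> - o - 2 * s <= v z <= - o -> `|psi z - l| <= eta) ->
  area.-integrable setT (EFin \o (fun z => psi z * dens (hat s o) z)) /\
  `|intp (fun z => psi z * dens (hat s o) z) - l * flux| <= eta * flux.
Proof.
move=> s0 o0 eta0 mpsi H.
have ch := @continuous_hat _ s o; have cuth := cut_hat s0 o0.
have CD := dens_Cc cuth ch.
have D0 z : 0 <= dens (hat s o) z.
  by apply: (dens_ge0 z cuth) => t; exact: hat_ge0.
have iD := Cc_integrable CD.
have mD := continuous_measurableT CD.1.
have supp z : dens (hat s o) z != 0 -> E z /\ - o - 2 * s <= v z <= - o.
  rewrite /dens; case: (pselect (E z)) => Ez; last by rewrite (cut0_off cuth Ez) mul0r eqxx.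
  rewrite liftE // mulf_eq0 negb_or => /andP[h _]; split => //.
  exact: hat_supp h.
have bd z : `|(psi z - l) * dens (hat s o) z| <= eta * dens (hat s o) z.
  rewrite normrM (ger0_norm (D0 z)).
  have [->|/supp[Ez h]] := eqVneq (dens (hat s o) z) 0; first by rewrite !mulr0.
  by rewrite ler_wpM2r // H.
have i1 : area.-integrable setT (EFin \o (fun z => (psi z - l) * dens (hat s o) z)).
  apply: (le_integrable measurableT _ _ (Cc_integrable (Cc_cstM eta CD))).
    apply/measurable_EFinP; apply: measurable_funM => //.
    by apply: measurable_funB => //; exact: measurable_cst.
  move=> z _ /=; rewrite lee_fin (le_trans (bd z)) // ler_norm //.
have i2 := Cc_integrable (Cc_cstM l CD).
have e1 : (fun z => psi z * dens (hat s o) z) =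
  (fun z => (psi z - l) * dens (hat s o) z + l * dens (hat s o) z).
  by apply/funext => z; ring.
have i3 : area.-integrable setT (EFin \o (fun z => psi z * dens (hat s o) z)).
  by rewrite e1; exact: (integrableD measurableT i1 i2).
split => //.
rewrite e1 /intp (RintegralD measurableT i1 i2) -/(intp _) -/(intp _).
rewrite (intpZ l CD) flux_hat // addrK.
rewrite (le_trans (le_normr_Rintegral measurableT i1)) //.
rewrite -[leRHS](_ : intp (fun z => eta * dens (hat s o) z) = _); last first.
  by rewrite intpZ // flux_hat.
apply: le_Rintegral => //; first exact: (integrable_norm i1).
exact: Cc_integrable (Cc_cstM eta CD).
Qed.

End PolePotential.

(** * Recovering a solution at a pole *)

Section Representation.
Set Implicit Arguments.
Unset Strict Implicit.
Context {R : realType}.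
Local Notation P2 := (measurableTypeR R * measurableTypeR R)%type.
Implicit Types (phi psi : R * R -> R) (K Om : set (R * R)).

Lemma hat2_bound (y : R) : 0 <= hat2 y <= pos y.
Proof.
rewrite /hat2.
have [y0|y0] := leP y 0.
  by rewrite !pos_eq0; [|lra..]; rewrite expr0n /=; apply/andP; split; lra.
have [y1|y1] := leP y 1.
  rewrite (pos_id (ltW y0)) !pos_eq0; [|lra..]; rewrite expr0n /=.
  have h : 0 <= y ^+ 3 by rewrite exprn_ge0 // ltW.
  have h' : y ^+ 3 <= y by rewrite -[leRHS]expr1 ler_wiXn2l // ltW.
  by apply/andP; split; lra.
have [y2|y2] := leP y 2.
  rewrite (pos_id (ltW y0)) (pos_id (_ : 0 <= y - 1)); last lra.
  rewrite pos_eq0; last lra; rewrite expr0n /=.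
  have -> : y = 1 + (y - 1) by lra.
  set t := y - 1; have t0 : 0 <= t by rewrite /t; lra.
  have t1 : t <= 1 by rewrite /t; lra.
  have -> : 1 + t - 1 = t by ring.
  have a1 : 0 <= t ^+ 3 by rewrite exprn_ge0.
  have a2 : t ^+ 3 <= t by rewrite -[leRHS]expr1 ler_wiXn2l.
  have a3 : t ^+ 2 <= t by rewrite -[leRHS]expr1 ler_wiXn2l.
  have a4 : 0 <= t ^+ 2 by rewrite exprn_ge0.
  have -> : (1 + t) ^+ 3 = 1 + 3 * t + 3 * t ^+ 2 + t ^+ 3 by ring.
  by apply/andP; split; lra.
rewrite !pos_id; [|lra..].
have -> : (y ^+ 3 - 2 * (y - 1) ^+ 3 + (y - 2) ^+ 3) / 6 = y - 1 by field.
by apply/andP; split; lra.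
Qed.

(** A majorant independent of the parameters, for dominated convergence. *)
Lemma kink_bound (s o t : R) : 0 < s -> 0 < o -> `|kink s o t| <= `|t|.
Proof.
move=> s0 o0; rewrite /kink normrM normrN (gtr0_norm s0).
have /andP[h1 h2] := hat2_bound ((- t - o) / s).
rewrite ger0_norm //.
have [t0|t0] := leP (- t) o.
  rewrite (_ : hat2 _ = 0) ?mulr0 //.
  have : (- t - o) / s <= 0 by rewrite ler_pdivrMr // mul0r; lra.
  by case/hat_le0.
apply: le_trans (_ : s * ((- t - o) / s) <= _).
  rewrite ler_wpM2l ?(ltW s0) // (le_trans h2) // pos_id //.
  by rewrite divr_ge0 ?(ltW s0) //; lra.
rewrite mulrCA divff ?gt_eqF // mulr1 ler0_norm; lra.
Qed.

Lemma trunc_bound (s1 o1 s2 o2 t : R) : 0 < s1 -> 0 < o1 -> 0 < s2 -> 0 < o2 ->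
  `|trunc s1 o1 s2 o2 t| <= 2 * `|t|.
Proof.
move=> *; rewrite /trunc (le_trans (ler_normB _ _)) // mulr2n mulrDl mul1r.
by apply: lerD; exact: kink_bound.
Qed.

Lemma trunc_mid (s1 o1 s2 o2 t : R) : 0 < s1 -> 0 < s2 ->
  - o2 <= t -> t <= - o1 - 2 * s1 -> trunc s1 o1 s2 o2 t = t + o1 + s1.
Proof.
move=> h1 h2 h3 h4; rewrite /trunc.
by have [_ _ ->] := hat_left h1 h4; have [_ _ ->] := hat_right h2 h3; rewrite subr0.
Qed.

Local Notation mu := (@lebesgue_measure R).

Lemma area_point (a : R * R) : area ([set a] : set P2) = 0%E.
Proof.
have -> : ([set a] : set P2) = ([set a.1] : set (measurableTypeR R)) `*`
    ([set a.2] : set (measurableTypeR R)).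
  apply/seteqP; split => z /=; first by move=> ->.
  by case: z => x y [/= -> ->]; rewrite -surjective_pairing.
have -> : area (([set a.1] : set (measurableTypeR R)) `*`
    ([set a.2] : set (measurableTypeR R))) = (mu [set a.1] * mu [set a.2])%E.
  by apply: product_measure1E; exact: measurable_set1.
by rewrite !lebesgue_measure_set1 mule0.
Qed.

Lemma measurable_point (a : R * R) : measurable ([set a] : set P2).
Proof.
by apply: compact_measurable_plane; exact: compact_set1.
Qed.

Lemma ae_off_point (a : R * R) (P : R * R -> Prop) : (forall z, z <> a -> P z) ->
  {ae (@area R), forall z, P z}.
Proof.
move=> H; exists ([set a] : set P2); split; first exact: measurable_point.
  exact: area_point.
by move=> z /= nP; apply: contrapT => za; apply: nP; exact: H.
Qed.

Lemma intp_off_point (a : R * R) (f g : R * R -> R) : measurable_fun [set: P2] f ->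
  measurable_fun [set: P2] g -> (forall z, z <> a -> f z = g z) -> intp f = intp g.
Proof.
move=> mf mg fg; rewrite /intp /Rintegral; congr fine.
apply: ae_eq_integral => //; [exact/measurable_EFinP|exact/measurable_EFinP|].
by apply: (ae_off_point (a:=a)) => z za _ /=; rewrite fg.
Qed.

Lemma dominated_intp (a : R * R) (f_ : nat -> R * R -> R) (f g : R * R -> R) :
  (forall n, measurable_fun [set: P2] (f_ n)) -> measurable_fun [set: P2] f ->
  area.-integrable setT (EFin \o g) ->
  (forall n z, `|f_ n z| <= g z) ->
  (forall z, z <> a -> f_ n z @[n --> \oo] --> f z) ->
  intp (f_ n) @[n --> \oo] --> intp f.
Proof.
move=> mf_ mf ig fg fcvg.
have mE n : measurable_fun [set: P2] (EFin \o f_ n) by apply/measurable_EFinP.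
have mEf : measurable_fun [set: P2] (EFin \o f) by apply/measurable_EFinP.
have cE z : z <> a -> (EFin \o f_ n) z @[n --> \oo] --> (EFin \o f) z.
  by move=> za; apply: cvg_EFin; [exact: nearW|exact: fcvg].
have gE z n : [set: R * R] z -> (`|(EFin \o f_ n) z| <= (EFin \o g) z)%E.
  by move=> _; rewrite /= lee_fin; exact: fg.
have a1 : {ae (@area R), forall z, [set: R * R] z ->
    (EFin \o f_ n) z @[n --> \oo] --> (EFin \o f) z}.
  by apply: (ae_off_point (a:=a)) => z za _; exact: cE.
have a2 : {ae (@area R), forall z n, [set: R * R] z ->
    (`|(EFin \o f_ n) z| <= (EFin \o g) z)%E}.
  by apply: aeW => z n; exact: gE.
have [i1 _ C] := @dominated_convergence _ _ _ (@area R) setT measurableT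
  (fun n => EFin \o f_ n) (EFin \o f) (EFin \o g) mE mEf
  a1 ig a2.
have fin : (\int[area]_z (f z)%:E)%E \is a fin_num by exact: (integrable_fin_num _ i1).
by apply: fine_cvg; rewrite fineK.
Qed.

Section Potential.
Variables (Om : set (R * R)) (w : R * R) (v : R * R -> R).
Hypothesis PP : pole_potential Om w v.

(** The potential, made constant near the pole and zero near the boundary: a C^2
    test function whose Laplacian is carried by the two bands where v is bent. *)
Definition plateau (s1 o1 s2 o2 : R) : R * R -> R :=
  lift Om w v (trunc s1 o1 s2 o2) (o1 + s1 - o2 - s2).

Lemma plateau_spec (s1 o1 s2 o2 : R) : 0 < s1 -> 0 < o1 -> 0 < s2 -> 0 < o2 ->
  o1 <= o2 -> o1 + 2 * s1 <= o2 + 2 * s2 ->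
  [/\ C2 setT (plateau s1 o1 s2 o2), vanish_off (level Om w v (- o1)) (plateau s1 o1 s2 o2) &
   laplacian (plateau s1 o1 s2 o2) =
    (fun z => dens Om w v (hat s2 o2) z - dens Om w v (hat s1 o1) z)].
Proof.
move=> s10 o10 s20 o20 o12 os12.
have c1 := cut_hat s10 o10; have c2 := cut_hat s20 o20.
pose b := - o1; pose a := - o2 - 2 * s2.
have b0 : b < 0 by rewrite /b; lra.
have cF : cut (trunc s1 o1 s2 o2) (o1 + s1 - o2 - s2) a b.
  split => // t; rewrite /a /b /trunc => ht.
    have ht2 : - o2 <= t by lra.
    have [_ _ ->] := hat_right s10 ht.
    by have [_ _ ->] := hat_right s20 ht2; rewrite subrr.
  have ht1 : t <= - o1 - 2 * s1 by lra.
  have [_ _ ->] := hat_left s10 ht1.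
  by have [_ _ ->] := hat_left s20 ht; ring.
have dF (t : R) : is_derive t 1 (trunc s1 o1 s2 o2) (ramp s1 o1 t - ramp s2 o2 t).
  by apply: is_deriveB; apply: kink_derive; rewrite gt_eqF.
have dF' (t : R) : is_derive t 1 (fun t => ramp s1 o1 t - ramp s2 o2 t)
    (hat s2 o2 t - hat s1 o1 t).
  apply: is_derive_eq (is_deriveB (ramp_derive s1 o1 t) (ramp_derive s2 o2 t)) _.
  by rewrite opprK addrC.
have cF'' : continuous (fun t => hat s2 o2 t - hat s1 o1 t).
  by move=> t; apply: cvgB; exact: continuous_hat.
have c1' : cut (hat s1 o1) 0 a b by apply: cut_weaken c1; rewrite // /a /b; lra.
have c2' : cut (hat s2 o2) 0 a b by apply: cut_weaken c2; rewrite // /a /b; lra.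
have c0 : cut (fun t => hat s2 o2 t - hat s1 o1 t) 0 a b.
  have [_ h1 h2] := c1'; have [_ h3 h4] := c2'.
  by split => // t ht; rewrite ?(h1 t ht) ?(h2 t ht) ?(h3 t ht) ?(h4 t ht) subr0.
have [X1 X2 X3] := lift_C2 PP dF dF' cF'' cF c0.
split => //; first exact: (lift_vanish PP cF).
rewrite X2; apply/funext => z; rewrite /dens -mulrBl; congr (_ * _).
case: (pselect ((Om `\ w) z)) => Ez; first by rewrite !liftE.
by rewrite (cut0_off PP c0 Ez) (cut0_off PP c1' Ez) (cut0_off PP c2' Ez) subrr.
Qed.

Lemma C2_cst (c : R) (U : set (R * R)) : C2 U (fun=> c).
Proof. by split; [move=> z _; exact: cst_continuous|exact: C2dir_cst..]. Qed.

Lemma intp_laplacian K phi : compact K -> vanish_off K phi -> C2 setT phi ->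
  intp (laplacian phi) = 0.
Proof.
move=> cK fK C2p.
have := green cK (@openT _) (fun _ _ => I) fK C2p (C2_cst 1 setT).
have -> : (fun z => laplacian phi z * 1) = laplacian phi.
  by apply/funext => z; rewrite mulr1.
move=> <-; rewrite /intp /Rintegral integral0_eq // => z _.
by rewrite laplacianE !dd_cst addr0 mulr0.
Qed.

(** On the support of the Laplacian of phi, v is a plateau up to a constant.
    Green's identity moves the Laplacian to the plateau, whose inner band
    shrinks to the pole while phi tends to phi(w) there. *)
Lemma pairing K phi delta : C2 setT phi -> compact K -> vanish_off K phi ->
  0 < delta -> K `<=` level Om w v (- delta) ->
  (\forall z \near w, laplacian phi z = 0) ->
  Cc (fun z => v z * laplacian phi z) /\
  intp (fun z => v z * laplacian phi z) = flux Om w v * phi w.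
Proof.
move=> C2p cK fK d0 Kd lapw.
have cphi : continuous phi by case: C2p => c _ _ z; exact: c.
(* the outer band of width 2 d at level - d lies above K *)
pose d := delta / 4; have dd0 : 0 < d by rewrite /d; lra.
have [M1 HM1] := pp_conc PP lapw.
have Cl := laplacian_Cc cK fK C2p.
have main M : M1 <= M -> delta + 1 <= M ->
   Cc (fun z => v z * laplacian phi z) /\
   intp (fun z => v z * laplacian phi z) = intp (fun z => phi z * dens Om w v (hat 1 M) z).
  move=> M1M dM; have M0 : 0 < M by lra.
  have [T1 T2 T3] := @plateau_spec d d 1 M dd0 dd0 ltr01 M0
     ltac:(rewrite /d; lra) ltac:(rewrite /d; lra).
  have G := green cK (@openT _) (fun _ _ => I) fK C2p T1.
  have E1 : (fun z => laplacian phi z * plateau d d 1 M z) =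
     (fun z => v z * laplacian phi z + 2 * d * laplacian phi z).
    apply/funext => z; have [->|l0] := eqVneq (laplacian phi z) 0.
      by rewrite mul0r !mulr0 addr0.
    have Kz : K z.
      by apply: contrapT => nK; rewrite (vanish_laplacian cK fK nK) eqxx in l0.
    have [zw|[Ez vz]] := Kd z Kz.
      by rewrite zw (nbhs_singleton lapw) eqxx in l0.
    rewrite /plateau liftE // trunc_mid //; last 2 first.
    - rewrite leNgt; apply/negP => /ltW vM; move/eqP: l0; apply.
      by apply: HM1 => //; lra.
    - by move: vz; rewrite /d => vz; lra.
    by ring.
  have E2 : (fun z => phi z * laplacian (plateau d d 1 M) z) =
     (fun z => phi z * dens Om w v (hat 1 M) z).
    apply/funext => z; rewrite T3.
    case: (pselect (K z)) => Kz; last by rewrite fK // !mul0r.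
    suff -> : dens Om w v (hat d d) z = 0 by rewrite subr0.
    rewrite /dens; have [->|[Ez vz]] := Kd z Kz; first by rewrite lift_w mul0r.
    rewrite liftE // (_ : hat d d (v z) = 0) ?mul0r //.
    have h : v z <= - d - 2 * d by move: vz; rewrite /d => vz; lra.
    by have [] := hat_left dd0 h.
  have Ct : Cc (fun z => laplacian phi z * plateau d d 1 M z).
    by apply: CcM => //; case: T1 => c _ _ z; exact: c.
  have Cv : Cc (fun z => v z * laplacian phi z).
    have -> : (fun z => v z * laplacian phi z) =
       (fun z => laplacian phi z * plateau d d 1 M z + (- (2 * d)) * laplacian phi z).
      have /(congr1 (fun f => fun z => f z + (- (2 * d)) * laplacian phi z)) /= -> := E1.
      by apply/funext => z /=; ring.
    have [c1 _] := Ct; have [c2 _] := Cl; split.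
      by move=> z; apply: cvgD; [exact: c1|apply: cvgM; [exact: cvg_cst|exact: c2]].
    exists K => // z nK; rewrite (vanish_laplacian cK fK nK).
    by rewrite mul0r mulr0 addr0.
  split; first exact: Cv.
  have S := etrans (congr1 intp E1) (intpD Cv (Cc_cstM (2 * d) Cl)).
  have Z : intp (fun z => 2 * d * laplacian phi z) = 0.
    by rewrite (intpZ (2 * d) Cl) (intp_laplacian cK fK C2p) mulr0.
  rewrite Z addr0 in S.
  exact: (etrans (esym S) (etrans (esym G) (congr1 intp E2))).
have [Cv _] := main (Num.max M1 (delta + 1)) ltac:(by rewrite le_max lexx)
  ltac:(by rewrite le_max lexx orbT).
split => //; apply/eqP; rewrite -subr_eq0 -normr_le0; apply/ler_addgt0Pl => e e0.
rewrite addr0.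
have fl0 := flux_ge0 PP.
pose eta := e / (flux Om w v + 1).
have eta0 : 0 < eta by rewrite divr_gt0 // ltr_wpDl.
have nw : \forall z \near w, `|phi z - phi w| <= eta.
  have H : \forall z \near w, `|phi w - phi z| <= eta.
    exact: (cvgr_dist_le _ _ (cphi w) _ eta0).
  by apply: filterS H => z; rewrite distrC.
have [M2 HM2] := pp_conc PP nw.
pose M := Num.max (Num.max M1 (delta + 1)) M2.
have M1M : M1 <= M by rewrite !le_max lexx.
have dM : delta + 1 <= M by rewrite !le_max lexx orbT.
have M2M : M2 <= M by rewrite !le_max lexx !orbT.
have [_ ->] := main M M1M dM.
have M0 : 0 < M by lra.
have [||_] := @window _ _ _ _ PP phi 1 M (phi w) eta ltr01 M0 (ltW eta0).
- exact: continuous_measurableT.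
- by move=> z Ez /andP[_ h]; apply: HM2 => //; lra.
rewrite mulrC => /le_trans; apply.
by rewrite /eta mulrAC ler_pdivrMr ?ltr_wpDl // ler_wpM2l ?(ltW e0) //; lra.
Qed.

(** Test the equation for U (Laplacian U = q U + kappa delta_y) against plateaus
    of v. As the bands move to the boundary and to the pole, the outer one
    contributes 0 because U vanishes at the boundary, the inner one flux times
    U(w), and the plateaus converge to v on the other side. *)
Lemma representation (U q : R * R -> R) (y : R * R) (kappa : R) :
  measurable_fun [set: P2] U -> measurable_fun [set: P2] q ->
  (Om `\ w) y -> (forall z, (Om `\ w) z -> v z < 0) ->
  {for w, continuous U} ->
  (forall eta, 0 < eta -> exists2 d, 0 < d &
     forall z, (Om `\ w) z -> - d <= v z -> `|U z| <= eta) ->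
  (forall z, ~ (Om `\ w) z -> U z * q z = 0) ->
  area.-integrable setT (EFin \o (fun z => U z * q z * v z)) ->
  (forall phi K, compact K -> K `<=` Om -> vanish_off K phi -> C2 setT phi ->
     (\forall z \near y, laplacian phi z = 0) ->
     intp (fun z => U z * laplacian phi z) =
     intp (fun z => U z * q z * phi z) + kappa * phi y) ->
  flux Om w v * U w = intp (fun z => U z * q z * v z) + kappa * v y.
Proof.
move=> mU mq Ey vneg cU bdU Uq0 iUqv HU.
have fl0 := flux_ge0 PP.
have [cv _ _] := pp_C2 PP.
have vy := vneg y Ey.
(* outer band of width 2 d n at level - d n, inner band of width 2 at level - M
   n *)
pose d (n : nat) : R := n.+1%:R^-1.
pose M (n : nat) : R := n.+1%:R + 2.
have d0 n : 0 < d n by rewrite invr_gt0 ltr0n.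
have d1 n : d n <= 1 by rewrite invf_le1 ?ler1n ?ltr0n.
have M0 n : 0 < M n by rewrite addr_gt0 // ltr0n.
have dM n : d n + 2 * d n <= M n + 2 * 1.
  have := d1 n; have : (0 : R) < n.+1%:R by rewrite ltr0n.
  by rewrite /M => *; lra.
have dM' n : d n <= M n.
  have h : (0 : R) < n.+1%:R by rewrite ltr0n.
  by have := d1 n; rewrite /M; lra.
pose T n := plateau (d n) (d n) 1 (M n).
have TS n := @plateau_spec (d n) (d n) 1 (M n) (d0 n) (d0 n) ltr01 (M0 n) (dM' n) (dM n).
have dcvg : d n @[n --> \oo] --> (0 : R) by exact: cvg_harmonic.
have dsmall (e : R) : 0 < e -> \forall n \near \oo, d n <= e.
  move=> e0; have H : \forall n \near \oo, `|d n| <= e.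
    exact: (cvgr0_norm_le _ dcvg _ e0).
  by apply: filterS H => n; rewrite ger0_norm // ltW.
have Mbig (e : R) : \forall n \near \oo, e <= M n.
  near=> n; apply: le_trans (_ : n%:R <= _).
    near: n; exact: nbhs_infty_ger.
  by rewrite /M -natr1; lra.
have Tval z : (Om `\ w) z -> v z < 0 ->
    \forall n \near \oo, T n z = v z + 2 * d n.
  move=> Ez vz; near=> n.
  have h1 : d n <= - v z / 4 by near: n; apply: dsmall; lra.
  have h2 : - v z <= M n by near: n; exact: Mbig.
  by rewrite /T /plateau liftE // trunc_mid //; [ring|lra|lra].
have Tcvg : intp (fun z => U z * q z * T n z) @[n --> \oo] -->
    intp (fun z => U z * q z * v z).
  apply: (@dominated_intp w _ _ (fun z => 2 * `|U z * q z * v z|)).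
  - move=> n; apply: measurable_funM; first exact: measurable_funM.
    apply: continuous_measurableT => z.
    by have [[c _ _] _ _] := TS n; exact: c.
  - by apply/measurable_EFinP; exact: measurable_int iUqv.
  - exact: (integrableZl measurableT 2 (integrable_norm iUqv)).
  - move=> n z; case: (pselect ((Om `\ w) z)) => Ez; last by rewrite Uq0 // !mul0r normr0 mulr0.
    rewrite !normrM [leRHS]mulrCA ler_wpM2l // -?normrM //.
    by rewrite /T /plateau liftE // trunc_bound.
  - move=> z _; case: (pselect ((Om `\ w) z)) => Ez; last first.
      rewrite Uq0 // mul0r; under eq_fun do rewrite mul0r; exact: cvg_cst.
    apply: cvgM; first exact: cvg_cst.
    have H : v z + 2 * d n @[n --> \oo] --> v z.
      rewrite -[X in _ --> X]addr0 -(mulr0 2); apply: cvgD; first exact: cvg_cst.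
      by apply: cvgM; [exact: cvg_cst|exact: dcvg].
    apply: cvg_trans H; apply: near_eq_cvg.
    by apply: filterS (Tval z Ez (vneg z Ez)) => n ->.
have rhs : intp (fun z => U z * q z * T n z) + kappa * T n y @[n --> \oo] -->
    intp (fun z => U z * q z * v z) + kappa * v y.
  apply: cvgD => //; apply: cvgM; first exact: cvg_cst.
  have H : v y + 2 * d n @[n --> \oo] --> v y.
    rewrite -[X in _ --> X]addr0 -(mulr0 2); apply: cvgD; first exact: cvg_cst.
    by apply: cvgM; [exact: cvg_cst|exact: dcvg].
  apply: cvg_trans H; apply: near_eq_cvg.
  by apply: filterS (Tval y Ey vy) => n ->.
have lhs : intp (fun z => U z * q z * T n z) + kappa * T n y @[n --> \oo] -->
    flux Om w v * U w.
  apply/cvgrPdist_le => e e0.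
  pose eta := e / (2 * (flux Om w v + 1)).
  have den : 0 < 2 * (flux Om w v + 1) by rewrite mulr_gt0 // ltr_wpDl.
  have eta0 : 0 < eta by rewrite divr_gt0.
  have nw : \forall z \near w, `|U z - U w| <= eta.
    have H : \forall z \near w, `|U w - U z| <= eta.
      exact: (cvgr_dist_le _ _ cU _ eta0).
    by apply: filterS H => z; rewrite distrC.
  have [M2 HM2] := pp_conc PP nw.
  have [d2 d20 Hd2] := bdU eta eta0.
  near=> n.
  have h1 : d n <= - v y / 4 by near: n; apply: dsmall; lra.
  have h2 : - v y + 1 <= M n by near: n; exact: Mbig.
  have h3 : M2 <= M n by near: n; exact: Mbig.
  have h4 : d n <= d2 / 3 by near: n; apply: dsmall; lra.
  have [T1 T2 T3] := TS n.
  have lapy : \forall z \near y, laplacian (T n) z = 0.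
    have n1 : \forall z \near y, (Om `\ w) z.
      by apply: open_nbhs_nbhs; split => //; apply: open_punctured; exact: pp_open PP.
    have n2 : \forall z \near y, v z < - (d n) - 2 * d n.
      by apply: (cvgr_lt _ (cv y Ey)); lra.
    have n3 : \forall z \near y, - M n < v z.
      by apply: (cvgr_gt _ (cv y Ey)); lra.
    near=> z.
    have Ez : (Om `\ w) z by near: z.
    have z2 : v z <= - (d n) - 2 * d n by apply: ltW; near: z.
    have z3 : - M n <= v z by apply: ltW; near: z.
    rewrite T3 /dens !liftE //.
    have [-> _ _] := hat_left (d0 n) z2.
    have [-> _ _] := hat_right ltr01 z3.
    by rewrite !mul0r subrr.
  have dn0 : - d n < 0 by rewrite oppr_lt0.
  have cK := level_compact PP dn0.
  have <- := HU (T n) _ cK (@level_sub _ _ _ _ PP _) T2 T1 lapy.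
  have w1 : 0 <= eta by exact: ltW.
  have [|iA HA] := @window _ _ _ _ PP U 1 (M n) (U w) eta ltr01 (M0 n) w1 mU.
    by move=> z Ez /andP[_ hz]; apply: HM2 => //; lra.
  have [|iB HB] := @window _ _ _ _ PP U (d n) (d n) 0 eta (d0 n) (d0 n) w1 mU.
    by move=> z Ez /andP[hz _]; rewrite subr0; apply: Hd2 => //; lra.
  have -> : (fun z => U z * laplacian (T n) z) =
    (fun z => U z * dens Om w v (hat 1 (M n)) z - U z * dens Om w v (hat (d n) (d n)) z).
    by apply/funext => z; rewrite T3 mulrBr.
  rewrite /intp (RintegralB measurableT iA iB) -/(intp _) -/(intp _).
  move: HA HB; rewrite mul0r subr0 (mulrC (U w)).
  set A := intp _; set B := intp _ => HA HB.
  have -> : flux Om w v * U w - (A - B) = B - (A - flux Om w v * U w) by ring.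
  apply: le_trans (ler_normB _ _) _.
  apply: le_trans (lerD HB HA) _.
  rewrite -mulr2n -mulr_natl /eta.
  rewrite (_ : 2 * (e / _ * _) = e * (flux Om w v / (flux Om w v + 1))); last first.
    by field; rewrite gt_eqF // ltr_wpDl.
  rewrite -[leRHS]mulr1 ler_wpM2l ?(ltW e0) // ler_pdivrMr ?ltr_wpDl // mul1r; lra.
exact: (cvg_unique _ lhs rhs).
Unshelve. all: by end_near. Qed.

End Potential.
End Representation.

(** * The weak maximum principle *)

Section MaximumPrinciple.
Set Implicit Arguments.
Unset Strict Implicit.
Context {R : realType}.
Implicit Types (v : R * R -> R) (E K : set (R * R)) (a z : R * R).

Definition sqd a z : R := (z.1 - a.1) ^+ 2 + (z.2 - a.2) ^+ 2.

Lemma sqd_ge0 a z : 0 <= sqd a z.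
Proof. by rewrite addr_ge0 // sqr_ge0. Qed.

Lemma sqd_gt0 a z : z <> a -> 0 < sqd a z.
Proof.
move=> za; rewrite lt_neqAle sqd_ge0 andbT eq_sym; apply/eqP => h; apply: za.
move/eqP: h; rewrite paddr_eq0 ?sqr_ge0 // !sqrf_eq0 !subr_eq0.
by move=> /andP[/eqP h1 /eqP h2]; rewrite (surjective_pairing z) h1 h2 -surjective_pairing.
Qed.

Lemma continuous_sqd a : continuous (sqd a).
Proof.
move=> z; have c1 := @continuous_fst_sub R a.1 z; have c2 := @continuous_snd_sub R a.2 z.
have -> : sqd a = (fun z : R * R =>
    (z.1 - a.1) * (z.1 - a.1) + (z.2 - a.2) * (z.2 - a.2)).
  by apply/funext => y; rewrite /sqd !expr2.
exact: (cvgD (cvgM c1 c1) (cvgM c2 c2)).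
Qed.

Lemma sqd_box (B : R) a z : box B a -> box B z -> sqd a z <= 8 * B ^+ 2.
Proof.
have sq (s t : R) : `[- B, B]%classic s -> `[- B, B]%classic t -> (t - s) ^+ 2 <= 4 * B ^+ 2.
  rewrite /= !in_itv /= => /andP[s1 s2] /andP[t1 t2].
  have -> : 4 * B ^+ 2 = (2 * B) ^+ 2 by ring.
  have h : 0 <= 2 * B by lra.
  rewrite -[leLHS]real_normK ?num_real // ler_sqr ?nnegrE //.
  by rewrite ler_norml; apply/andP; split; lra.
move=> [a1 a2] [z1 z2]; rewrite /sqd.
by apply: le_trans (lerD (sq _ _ a1 z1) (sq _ _ a2 z2)) _; rewrite -mulrDl; lra.
Qed.

(** Were h2 positive, h would increase to the right of its critical point x. *)
Lemma second_derivative_at_max (h h1 : R -> R) (x h2 : R) :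
  (\forall y \near x, is_derive (y : R) 1 h (h1 y)) -> is_derive x 1 h1 h2 ->
  (\forall y \near x, h y <= h x) -> h2 <= 0.
Proof.
move=> dh dh1 hmax; rewrite leNgt; apply/negP => h20.
have H0 : \forall y \near x, is_derive (y : R) 1 h (h1 y) /\ h y <= h x.
  by near=> y; split; near: y.
have /nbhs_ballP[e /= e0 He] := H0.
have inb y : x - e < y -> y < x + e -> ball x e y.
  by move=> y1 y2; rewrite /ball /= ltr_norml; apply/andP; split; lra.
have h1x : h1 x = 0.
  have ab : x - e < x + e by lra.
  have dhy (y : R) : y \in `]x - e, x + e[ -> derivable h y 1.
    by rewrite in_itv /= => /andP[y1 y2]; have [[]] := He y (inb y y1 y2).
  have hm y : y \in `]x - e, x + e[ -> h y <= h x.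
    by rewrite in_itv /= => /andP[y1 y2]; have [_] := He y (inb y y1 y2).
  have xin : x \in `]x - e, x + e[ by rewrite in_itv /=; apply/andP; split; lra.
  have [_ E1] := derive1_at_max (ltW ab) dhy xin hm.
  by have [[_ <-] _] := He x (ballxx _ e0).
have L : k^-1 *: (h1 (k *: 1 + x) - h1 x) @[k --> (0 : R)^'] --> h2.
  by have [/cvg_ex[l hl] <-] := dh1; rewrite /derive (cvg_lim _ hl).
have : \forall k \near (0 : R)^', 0 < k^-1 *: (h1 (k *: 1 + x) - h1 x).
  exact: (cvgr_gt _ L).
move=> [d /= d0 Hd].
pose t := Num.min d e / 2.
have t0 : 0 < t by rewrite divr_gt0 // lt_min d0 e0.
have td : t < d /\ t < e.
  by split; rewrite ltr_pdivrMr // gt_min; apply/orP; [left|right]; lra.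
have xt : x < x + t by lra.
have dhI y : y \in `]x, x + t[ -> is_derive y 1 h (h1 y).
  rewrite in_itv /= => /andP[y1 y2].
  by have [] := He y (inb y ltac:(lra) ltac:(lra)).
have ch : {within `[x, x + t], continuous h}.
  apply: continuous_in_subspaceT => y /set_mem; rewrite /= in_itv /= => /andP[y1 y2].
  apply: differentiable_continuous; apply/derivable1_diffP.
  by have [[]] := He y (inb y ltac:(lra) ltac:(lra)).
have [c cin E2] := MVT xt dhI ch.
rewrite in_itv /= in cin; move/andP: cin => [c1 c2].
have h1c : 0 < h1 c.
  have := Hd (c - x); rewrite /ball /= sub0r normrN gtr0_norm; last lra.
  rewrite [(_)%:A]mulr1 subrK h1x subr0 => /(_ ltac:(lra)) H.
  have cx0 : c - x != 0 by rewrite gt_eqF //; lra.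
  by move: (H cx0); rewrite /GRing.scale /= pmulr_rgt0 // invr_gt0; lra.
have xe : ball x e (x + t) by apply: inb; lra.
have [_ H] := He (x + t) xe.
have : 0 < h (x + t) - h x by rewrite E2 mulr_gt0 // addrAC subrr add0r.
by rewrite subr_gt0 ltNge H.
Unshelve. all: by end_near. Qed.

Lemma laplacian_at_max v (k : R) (a b : R * R) E : open E -> E b -> C2 E v ->
  (forall z, E z -> v z + k * sqd a z <= v b + k * sqd a b) ->
  laplacian v b + 4 * k <= 0.
Proof.
move=> oE Eb [_ Cx Cy] mx; rewrite laplacianE.
have sq (c t : R) : is_derive t 1 (fun t => (t - c) ^+ 2) (2 * (t - c)).
  have D := is_deriveM (is_derive_shift c t) (is_derive_shift c t).
  have -> : (fun t => (t - c) ^+ 2) = ((fun s : R => s - c) * (fun s : R => s - c)).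
    by apply/funext => y; rewrite expr2.
  by apply: is_derive_eq D _; rewrite /GRing.scale /=; ring.
have lin (c t : R) : is_derive t 1 (fun t => 2 * (t - c)) 2.
  by apply: is_derive_eq (is_deriveZ 2 (is_derive_shift c t)) _; rewrite /GRing.scale /= mulr1.
case: b Eb mx => x y Eb mx.
have nE : nbhs ((x, y) : R * R) E by apply: open_nbhs_nbhs; split.
have Ex : \forall t \near x, E (t, y).
  exact: (@continuous_hline R y x _ nE).
have Ey : \forall t \near y, E (x, t).
  exact: (@continuous_vline R x y _ nE).
have hx : dd ex (dd ex v) (x, y) + 2 * k <= 0.
  apply: (@second_derivative_at_max (fun t => v (t, y) + k * (t - a.1) ^+ 2)
     (fun t => dd ex v (t, y) + k * (2 * (t - a.1))) x).
  - near=> t; have Et : E (t, y) by near: t.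
    have [d1 _ _ _] := Cx _ Et.
    exact: (is_deriveD (iffLR (isd_ex v t y _) (isd_dd d1)) (is_deriveZ k (sq a.1 t))).
  - have [_ d2 _ _] := Cx _ Eb; rewrite (mulrC 2 k).
    exact: (is_deriveD (iffLR (isd_ex _ x y _) (isd_dd d2)) (is_deriveZ k (lin a.1 x))).
  - near=> t; have Et : E (t, y) by near: t.
    by have := mx _ Et; rewrite /sqd /= !mulrDr !addrA lerD2r.
have hy : dd ey (dd ey v) (x, y) + 2 * k <= 0.
  apply: (@second_derivative_at_max (fun t => v (x, t) + k * (t - a.2) ^+ 2)
     (fun t => dd ey v (x, t) + k * (2 * (t - a.2))) y).
  - near=> t; have Et : E (x, t) by near: t.
    have [d1 _ _ _] := Cy _ Et.
    exact: (is_deriveD (iffLR (isd_ey v x t _) (isd_dd d1)) (is_deriveZ k (sq a.2 t))).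
  - have [_ d2 _ _] := Cy _ Eb; rewrite (mulrC 2 k).
    exact: (is_deriveD (iffLR (isd_ey _ x y _) (isd_dd d2)) (is_deriveZ k (lin a.2 y))).
  - near=> t; have Et : E (x, t) by near: t.
    have := mx _ Et; rewrite /sqd /= !mulrDr !addrA => h.
    by rewrite -(lerD2l (k * (x - a.1) ^+ 2)); move: h; rewrite !addrA ![k * _ + _]addrC.
move: hx hy; set p := dd ex _ _; set q := dd ey _ _ => hx hy; lra.
Unshelve. all: by end_near. Qed.

(** Otherwise v plus a small multiple of |z - a|^2 would have an interior
    maximum, although its Laplacian is positive. *)
Lemma weak_max v E : open E -> bounded_set E -> C2 E v ->
  (forall z, E z -> laplacian v z = 0) ->
  (forall eta, 0 < eta -> exists K, [/\ compact K, K `<=` E &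
     forall z, E z -> eta < v z -> K z]) ->
  forall z, E z -> v z <= 0.
Proof.
move=> oE bE C2v harm HK a Ea; rewrite leNgt; apply/negP => va.
have [K [cK KE KH]] := HK (v a / 2) ltac:(lra).
have Ka : K a by apply: KH => //; lra.
have [B B0 EB] := bounded_box bE.
have NB z : E z -> 0 <= sqd a z <= 8 * B ^+ 2.
  by move=> Ez; rewrite sqd_ge0 /= sqd_box //; exact: EB.
have B2 : 0 < 8 * B ^+ 2 by rewrite mulr_gt0 // exprn_gt0.
(* so that k |z - a|^2 is at most v(a) / 4 on E *)
pose k := v a / (4 * (8 * B ^+ 2)).
have k0 : 0 < k by rewrite divr_gt0 // mulr_gt0.
have kN z : E z -> 0 <= k * sqd a z <= v a / 4.
  move=> /NB /andP[n1 n2]; rewrite mulr_ge0 ?(ltW k0) //=.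
  have -> : v a / 4 = k * (8 * B ^+ 2) by rewrite /k; field; rewrite gt_eqF.
  by rewrite ler_wpM2l ?(ltW k0).
have [cv _ _] := C2v.
have cN z : {for z, continuous (fun z => k * sqd a z)}.
  by apply: cvgM; [exact: cvg_cst|exact: continuous_sqd].
have [||b bK bmax] := @compact_EVT_max _ _ (fun z => v z + k * sqd a z) K _ cK.
  by exists a.
  apply: continuous_in_subspaceT => z /set_mem Kz.
  by apply: cvgD; [exact: (cv z (KE z Kz))|exact: cN].
move/set_mem in bK; have Eb := KE b bK.
have fa : v a <= v b + k * sqd a b.
  have := bmax a (mem_set Ka); have := kN a Ea; move=> /andP[h _] h2.
  by apply: le_trans h2; rewrite lerDl.
have := @laplacian_at_max v k a b E oE Eb C2v.
rewrite (harm b Eb) add0r => H.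
have : 4 * k <= 0.
  apply: H => z Ez; case: (pselect (K z)) => Kz; first exact: (bmax z (mem_set Kz)).
  have vz : v z <= v a / 2 by rewrite leNgt; apply/negP => /(KH z Ez).
  have /andP[_ h] := kN z Ez.
  by apply: le_trans (lerD vz h) (le_trans _ fa); lra.
by rewrite pmulr_rle0 // leNgt k0.
Qed.

End MaximumPrinciple.

(** * The logarithmic potential *)

Section LogPotential.
Set Implicit Arguments.
Unset Strict Implicit.
Context {R : realType}.
Implicit Types (z a : R * R).
Local Notation P2 := (measurableTypeR R * measurableTypeR R)%type.
Local Notation mu := (@lebesgue_measure R).

Lemma C2dir_intro (e : R * R) (U : set (R * R)) (f f1 f2 : R * R -> R) : open U ->
  (forall z, U z -> isd e f z (f1 z)) -> (forall z, U z -> isd e f1 z (f2 z)) ->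
  (forall z, U z -> {for z, continuous f1}) ->
  (forall z, U z -> {for z, continuous f2}) ->
  [/\ C2dir e U f, forall z, U z -> dd e f z = f1 z &
      forall z, U z -> dd e (dd e f) z = f2 z].
Proof.
move=> oU d1 d2 c1 c2.
have E1 z : U z -> dd e f z = f1 z by move=> /d1/isdP[].
have N1 z : U z -> \forall y \near z, f1 y = dd e f y.
  by move=> Uz; near=> y; rewrite E1 //; near: y; exact: open_nbhs_nbhs.
have D2 z : U z -> isd e (dd e f) z (f2 z).
  by move=> Uz; exact: isd_near (N1 z Uz) (d2 z Uz).
have N2 z : U z -> \forall y \near z, f2 y = dd e (dd e f) y.
  move=> Uz; near=> y; have Uy : U y by near: y; exact: open_nbhs_nbhs.
  by have /isdP[_ ->] := D2 y Uy.
split => // z Uz; last by have /isdP[_ ->] := D2 z Uz.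
split.
- by have /isdP[] := d1 z Uz.
- by have /isdP[] := D2 z Uz.
- exact: continuous_near (N1 z Uz) (c1 z Uz).
- exact: continuous_near (N2 z Uz) (c2 z Uz).
Unshelve. all: by end_near. Qed.

Lemma isd_fst (c : R) z : isd ex (fun z : R * R => z.1 - c) z 1 /\
  isd ey (fun z : R * R => z.1 - c) z 0.
Proof.
case: z => x y; split; [apply/isd_ex|apply/isd_ey] => /=.
  exact: is_derive_shift.
exact: is_derive_cst.
Qed.

Lemma isd_snd (c : R) z : isd ey (fun z : R * R => z.2 - c) z 1 /\
  isd ex (fun z : R * R => z.2 - c) z 0.
Proof.
case: z => x y; split; [apply/isd_ey|apply/isd_ex] => /=.
  exact: is_derive_shift.
exact: is_derive_cst.
Qed.

Lemma isd_sqd a z : isd ex (sqd a) z (2 * (z.1 - a.1)) /\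
  isd ey (sqd a) z (2 * (z.2 - a.2)).
Proof.
have -> : sqd a = (fun z : R * R =>
    (z.1 - a.1) * (z.1 - a.1) + (z.2 - a.2) * (z.2 - a.2)).
  by apply/funext => y; rewrite /sqd !expr2.
have [x1 x2] := isd_fst a.1 z; have [y1 y2] := isd_snd a.2 z.
set p := z.1 - a.1 in x1 x2 *; set q := z.2 - a.2 in y1 y2 *.
split.
  have -> : 2 * p = 1 * p + p * 1 + (0 * q + q * 0) by ring.
  exact: isdD (isdM x1 x1) (isdM y2 y2).
have -> : 2 * q = 0 * p + p * 0 + (1 * q + q * 1) by ring.
exact: isdD (isdM x2 x2) (isdM y1 y1).
Qed.

(** The constant of the logarithm of the squared distance. *)
Definition kap : R := (4 * pi)^-1.

Lemma kap_gt0 : 0 < kap.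
Proof. by rewrite invr_gt0 mulr_gt0 // pi_gt0. Qed.

(** This is (2 pi)^-1 log |z - a| + s, written without a square root. *)
Definition Lam a (s : R) z : R := kap * ln (sqd a z) + s.

Lemma LamE a s z : z <> a -> Lam a s z = (2 * pi)^-1 * ln (cmod (z - a)) + s.
Proof.
move=> za; congr (_ + s); have N0 := sqd_gt0 za.
have -> : cmod (z - a) = Num.sqrt (sqd a z) by [].
have s0 : 0 < Num.sqrt (sqd a z) by rewrite sqrtr_gt0.
rewrite -[in LHS](sqr_sqrtr (ltW N0)) lnXn // mulr2n /kap.
have pn : (pi : R) != 0 by rewrite gt_eqF // pi_gt0.
move: (ln _) (pi : R) pn => t p pn; by field.
Qed.

Lemma Lam_dir (e : R * R) (l : R * R -> R) a s :
  (forall z, isd e (sqd a) z (2 * l z)) -> (forall z, isd e l z 1) ->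
  continuous l ->
  [/\ C2dir e ([set: R * R] `\ a) (Lam a s),
      forall z, z <> a -> dd e (Lam a s) z = kap * (2 * l z / sqd a z) &
      forall z, z <> a -> dd e (dd e (Lam a s)) z =
         kap * (2 / sqd a z - 4 * l z ^+ 2 / sqd a z ^+ 2)].
Proof.
move=> dS dl cl.
have oU : open ([set: R * R] `\ a) by apply: open_punctured; exact: openT.
have D1 z : ([set: R * R] `\ a) z -> isd e (Lam a s) z (kap * (2 * l z / sqd a z)).
  move=> [_ za]; have N0 := sqd_gt0 za.
  have H := isd_comp (is_derive1_ln N0) (dS z).
  have H2 := isdD (isdM (isd_cst e kap z) H) (isd_cst e s z).
  have -> : kap * (2 * l z / sqd a z) =
      0 * (@ln R \o sqd a) z + kap * ((sqd a z)^-1 * (2 * l z)) + 0.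
    by rewrite mul0r add0r addr0 [_^-1 * _]mulrC.
  exact: H2.
have D2 z : ([set: R * R] `\ a) z ->
    isd e (fun z => kap * (2 * l z / sqd a z)) z
      (kap * (2 / sqd a z - 4 * l z ^+ 2 / sqd a z ^+ 2)).
  move=> [_ za]; have N0 := sqd_gt0 za.
  have Nn : sqd a z != 0 by rewrite gt_eqF.
  have dV : is_derive (sqd a z) 1 (fun y : R => y^-1) (- (sqd a z) ^- 2).
    have := @is_deriveV _ id (sqd a z) 1 1 Nn (is_derive_id (sqd a z) (1 : R)).
    by rewrite [_ *: 1]mulr1.
  have HV := isd_comp dV (dS z).
  have H := isdM (isd_cst e kap z) (isdM (isdM (isd_cst e 2 z) (dl z)) HV).
  move: H; rewrite /=; set l0 := l z; set n0 := sqd a z => H.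
  have -> : kap * (2 / n0 - 4 * l0 ^+ 2 / n0 ^+ 2) =
     0 * (2 * l0 / n0) + kap * ((0 * l0 + 2 * 1) / n0 + 2 * l0 * (- n0 ^- 2 * (2 * l0))).
    by field.
  exact: H.
have cV z : ([set: R * R] `\ a) z -> {for z, continuous (fun z => (sqd a z)^-1)}.
  by move=> [_ za]; apply: cvgV; [rewrite gt_eqF // sqd_gt0|exact: continuous_sqd].
have cf1 z : ([set: R * R] `\ a) z ->
    {for z, continuous (fun z => kap * (2 * l z / sqd a z))}.
  move=> Uz; apply: cvgM; first exact: cvg_cst.
  by apply: cvgM (cV z Uz); apply: cvgM; [exact: cvg_cst|exact: cl].
have cf2 z : ([set: R * R] `\ a) z -> {for z, continuous
    (fun z => kap * (2 / sqd a z - 4 * l z ^+ 2 / sqd a z ^+ 2))}.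
  move=> Uz.
  have -> : (fun z => kap * (2 / sqd a z - 4 * l z ^+ 2 / sqd a z ^+ 2)) =
     (fun z => kap * (2 * (sqd a z)^-1 -
        4 * ((l z * (sqd a z)^-1) * (l z * (sqd a z)^-1)))).
    apply/funext => y; congr (kap * (_ - _)).
    by rewrite -mulrA -expr2 exprMn exprVn.
  apply: cvgM; first exact: cvg_cst.
  apply: cvgB; apply: cvgM; [exact: cvg_cst|exact: cV|exact: cvg_cst|].
  by apply: cvgM; apply: cvgM; [exact: cl|exact: cV|exact: cl|exact: cV].
have [A B C] := C2dir_intro oU D1 D2 cf1 cf2.
by split => // z za; [apply: B|apply: C].
Qed.

Lemma Lam_C2 a s : C2 ([set: R * R] `\ a) (Lam a s) /\
  forall z, z <> a -> laplacian (Lam a s) z = 0 /\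
    grad2 (Lam a s) z = 4 * kap ^+ 2 / sqd a z.
Proof.
have [A1 B1 C1] := @Lam_dir ex (fun z => z.1 - a.1) a s
  (fun z => (isd_sqd a z).1) (fun z => (isd_fst a.1 z).1) (@continuous_fst_sub R a.1).
have [A2 B2 D2] := @Lam_dir ey (fun z => z.2 - a.2) a s
  (fun z => (isd_sqd a z).2) (fun z => (isd_snd a.2 z).1) (@continuous_snd_sub R a.2).
split.
  split => // z [_ za]; have N0 := sqd_gt0 za.
  apply: cvgD; last exact: cvg_cst.
  apply: cvgM; first exact: cvg_cst.
  apply: (@continuous_comp_pt _ (@ln R) (sqd a)); first exact: continuous_sqd.
  exact: continuous_ln.
move=> z za; have N0 := sqd_gt0 za.
rewrite laplacianE C1 // D2 // /grad2 B1 // B2 //.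
have : sqd a z = (z.1 - a.1) ^+ 2 + (z.2 - a.2) ^+ 2 by [].
move: (z.1 - a.1) (z.2 - a.2) (sqd a z) N0 => p q n n0 e.
have nn : n != 0 by rewrite gt_eqF.
split.
  have -> : kap * (2 / n - 4 * p ^+ 2 / n ^+ 2) + kap * (2 / n - 4 * q ^+ 2 / n ^+ 2) =
    kap * (4 * (n - (p ^+ 2 + q ^+ 2)) / n ^+ 2) by field.
  by rewrite -e subrr mulr0 mul0r mulr0.
have -> : (kap * (2 * p / n)) ^+ 2 + (kap * (2 * q / n)) ^+ 2 =
   4 * kap ^+ 2 * (p ^+ 2 + q ^+ 2) / n ^+ 2 by field.
by rewrite -e; field.
Qed.

Lemma sqd_norm a z : `|z - a| ^+ 2 <= sqd a z /\ sqd a z <= 2 * `|z - a| ^+ 2.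
Proof.
have -> : sqd a z = `|z.1 - a.1| ^+ 2 + `|z.2 - a.2| ^+ 2.
  by rewrite /sqd !real_normK ?num_real.
rewrite prod_normE /=; set p := `|z.1 - a.1|; set q := `|z.2 - a.2|.
have p0 : 0 <= p by exact: normr_ge0.
have q0 : 0 <= q by exact: normr_ge0.
have p2 : 0 <= p ^+ 2 by exact: exprn_ge0.
have q2 : 0 <= q ^+ 2 by exact: exprn_ge0.
have [pq|pq] := leP p q.
  have h : p ^+ 2 <= q ^+ 2 by rewrite ler_sqr.
  by split; lra.
have h : q ^+ 2 <= p ^+ 2 by rewrite ler_sqr ?nnegrE // ltW.
by split; lra.
Qed.

Lemma Lam_le a s z (t : R) : z <> a ->
  (Lam a s z <= t) = (sqd a z <= expR ((t - s) / kap)).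
Proof.
move=> za; have N0 := sqd_gt0 za.
rewrite /Lam -lerBrDr mulrC -ler_pdivlMr ?kap_gt0 //.
by rewrite -[in RHS](lnK N0) ler_expR.
Qed.

Lemma Lam_pole a s : pole_potential setT a (Lam a s).
Proof.
have [C2L HL] := Lam_C2 a s.
split => //.
- exact: openT.
- by move=> z [_ za]; have [] := HL z za.
- move=> t _; set r := expR ((t - s) / kap).
  have -> : [set z | z = a \/ ([set: R * R] `\ a) z /\ Lam a s z <= t] =
      [set z | sqd a z <= r].
    apply/seteqP; split => z /=.
      move=> [->|[[_ za]]]; last by rewrite Lam_le.
      by rewrite /sqd !subrr expr0n addr0 expR_ge0.
    move=> h; case: (pselect (z = a)) => za; [by left|right].
    by rewrite Lam_le.
  have cl : closed [set z | sqd a z <= r].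
    have -> : [set z | sqd a z <= r] = sqd a @^-1` [set t | t <= r] by [].
    by apply: closed_comp; [move=> z _; exact: continuous_sqd|exact: closed_le].
  have bd : bounded_set [set z | sqd a z <= r].
    exists (`|a| + r + 1); split; first exact: num_real.
    move=> x hx z /= hz; apply: le_trans (ltW hx).
    have [h1 _] := sqd_norm a z.
    have h2 : `|z - a| <= r + 1.
      rewrite leNgt; apply/negP => h.
      have r0 : 0 < r by exact: expR_gt0.
      have : (r + 1) ^+ 2 < `|z - a| ^+ 2 by rewrite ltr_sqr ?nnegrE //; lra.
      have -> : (r + 1) ^+ 2 = r ^+ 2 + 2 * r + 1 by ring.
      have r2 : 0 <= r ^+ 2 by rewrite exprn_ge0 // ltW.
      move=> h3; have h4 : `|z - a| ^+ 2 <= r by exact: le_trans h1 hz.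
      by lra.
    have := ler_normD (z - a) a; rewrite subrK.
    by lra.
  have [B B0 HB] := bounded_box bd.
  exact: subclosed_compact cl (@box_compact R B) HB.
- move=> V /nbhs_ballP[e /= e0 He].
  exists (- (kap * ln (e ^+ 2 / 2) + s)) => z [_ za]; rewrite opprK Lam_le //.
  rewrite addrK mulrAC mulfV ?gt_eqF ?kap_gt0 // mul1r lnK; last first.
    by rewrite posrE divr_gt0 // exprn_gt0.
  move=> h; apply: He; rewrite -ball_normE /= distrC.
  have [h1 _] := sqd_norm a z.
  have e2 : 0 < e ^+ 2 by rewrite exprn_gt0.
  by rewrite -ltr_sqr ?nnegrE ?(ltW e0) //; lra.
- move=> M; have r0 : 0 < expR ((M - s) / kap) by exact: expR_gt0.
  have : \forall z \near a, sqd a z < expR ((M - s) / kap).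
    have c := @continuous_sqd R a a.
    by apply: (cvgr_lt _ c); rewrite /sqd !subrr expr0n addr0.
  by apply: filterS => z hz za; rewrite Lam_le // ltW.
Qed.

End LogPotential.

(** * The logarithmic potential has flux one *)

Section LogFlux.
Set Implicit Arguments.
Unset Strict Implicit.
Context {R : realType}.
Implicit Types (z a : R * R).
Local Notation P2 := (measurableTypeR R * measurableTypeR R)%type.
Local Notation mu := (@lebesgue_measure R).

(** The flux is computed by comparison with this Gaussian, whose integral over
    the plane is pi. *)
Definition gauss2 a z : R := expR (- sqd a z).

Lemma gauss2_cont a : continuous (gauss2 a).
Proof.
move=> z; apply: (@continuous_comp_pt _ (@expR R) (fun z => - sqd a z)).
  by apply: cvgN; exact: continuous_sqd.
exact: continuous_expR.
Qed.

Lemma gauss2_integral a : (\int[area]_z (gauss2 a z)%:E = pi%:E)%E.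
Proof.
have mg := continuous_measurableT (@gauss2_cont a).
have mE : measurable_fun [set: P2] (EFin \o gauss2 a) by apply/measurable_EFinP.
have g0 z : (0 <= (EFin \o gauss2 a) z)%E by rewrite /= lee_fin expR_ge0.
have -> : (\int[area]_z (gauss2 a z)%:E =
    \int[mu]_x \int[mu]_y (gauss2 a (x, y))%:E)%E.
  exact: (@fubini_tonelli1 _ _ _ _ R mu mu _ mE g0).
have cg := @continuous_gauss_fun R; have gg := @gauss_fun_ge0 R.
have cs (c : R) : continuous (fun x => gauss_fun (x - c) : R).
  move=> x; apply: (@continuous_comp _ _ _ (fun x : R => x - c) gauss_fun); last exact: cg.
  by apply: cvgB; [exact: cvg_id|exact: cvg_cst].
have ms (c : R) : measurable_fun setT (fun x : R => (gauss_fun (x - c))%:E).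
  by apply/measurable_EFinP; exact: continuous_measurable_fun.
have g0' (c x : R) : (0 <= (gauss_fun (x - c))%:E)%E by rewrite lee_fin gg.
have inner (x : R) : (\int[mu]_y (gauss2 a (x, y))%:E =
    (gauss_fun (x - a.1))%:E * (Num.sqrt pi)%:E)%E.
  rewrite -integralT_gauss -(integral_shift a.2 cg gg).
  have := @ge0_integralZl _ _ _ mu setT measurableT _
      (ms a.2) (gauss_fun (x - a.1))%:E (fun t _ => g0' a.2 t) (g0' a.1 x).
  move=> <-; apply: eq_integral => t _.
  by rewrite -EFinM /gauss2 /gauss_fun -expRD /sqd /= opprD.
transitivity (\int[mu]_x ((gauss_fun (x - a.1))%:E * (Num.sqrt pi)%:E))%E.
  by apply: eq_integral => x _; exact: inner.
have p0 : (0 <= (Num.sqrt pi : R)%:E)%E by rewrite lee_fin sqrtr_ge0.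
have := @ge0_integralZr _ _ _ mu setT measurableT _ (ms a.1) (Num.sqrt pi)%:E
      (fun t _ => g0' a.1 t) p0.
move=> ->; rewrite (integral_shift a.1 cg gg) integralT_gauss -EFinM -expr2.
by rewrite sqr_sqrtr // pi_ge0.
Qed.

Lemma gauss2_integrable a : area.-integrable setT (EFin \o gauss2 a).
Proof.
apply/integrableP; split.
  by apply/measurable_EFinP; exact: continuous_measurableT (@gauss2_cont a).
have -> : (\int[area]_z `|(EFin \o gauss2 a) z| = \int[area]_z (gauss2 a z)%:E)%E.
  by apply: eq_integral => z _; rewrite /= ger0_norm // expR_ge0.
by rewrite gauss2_integral ltry.
Qed.

(** Adding a constant to the potential translates the tent, which does not
    change its integral by [flux_hat]. *)
Lemma flux_Lam_shift a (s : R) : s <= 0 ->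
  flux setT a (Lam a s) = flux setT a (Lam a 0).
Proof.
move=> s0; have o0 : 0 < 1 - s by lra.
rewrite -(flux_hat (Lam_pole a s) ltr01 o0) /flux.
congr intp; apply/funext => z; rewrite /dens.
case: (pselect (z = a)) => za; first by rewrite za !lift_w !mul0r.
have [_ H] := Lam_C2 a s; have [_ H0] := Lam_C2 a 0.
rewrite !liftE //; have [_ ->] := H z za; have [_ ->] := H0 z za.
by congr (_ * _); rewrite /hat /Lam; congr (_ * hat0 (_ / _)); ring.
Qed.

Lemma hat1_bound (y : R) : 0 <= hat1 y <= 1.
Proof.
rewrite /hat1.
have [y0|y0] := leP y 0.
  by rewrite !pos_eq0; [|lra..]; rewrite expr0n /=; apply/andP; split; lra.
have [y1|y1] := leP y 1.
  rewrite (pos_id (ltW y0)) !pos_eq0; [|lra..]; rewrite expr0n /=.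
  have h : 0 <= y ^+ 2 by rewrite sqr_ge0.
  have h' : y ^+ 2 <= 1 by rewrite exprn_ile1 // ltW.
  by apply/andP; split; lra.
have [y2|y2] := leP y 2.
  rewrite (pos_id (ltW y0)) (pos_id (_ : 0 <= y - 1)); last lra.
  rewrite pos_eq0; last lra; rewrite expr0n /=.
  have -> : (y ^+ 2 - 2 * (y - 1) ^+ 2 + 0) / 2 = 1 - (2 - y) ^+ 2 / 2 by field.
  have h : 0 <= (2 - y) ^+ 2 by rewrite sqr_ge0.
  have h' : (2 - y) ^+ 2 <= 1 by rewrite exprn_ile1 //; lra.
  by apply/andP; split; lra.
rewrite !pos_id; [|lra..].
have -> : (y ^+ 2 - 2 * (y - 1) ^+ 2 + (y - 2) ^+ 2) / 2 = 1 by field.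
by apply/andP; split; lra.
Qed.

(** A smoothed indicator of the interval from 1 / n to 1 - 1 / n, with its
    primitive. *)
Definition win (n y : R) : R := hat1 (n * y - 1) + hat1 (n * (1 - y) - 1) - 1.
Definition winI (n y : R) : R :=
  n^-1 * (hat2 (n * y - 1) - hat2 (n * (1 - y) - 1)) - y + (1 - 2 / n).

Lemma win_norm (n y : R) : `|win n y| <= 1.
Proof.
have /andP[h1 h2] := hat1_bound (n * y - 1).
have /andP[h3 h4] := hat1_bound (n * (1 - y) - 1).
by rewrite /win ler_norml; apply/andP; split; lra.
Qed.

Lemma win_left (n y : R) : 4 <= n -> y <= n^-1 -> win n y = 0 /\ winI n y = 0.
Proof.
move=> n4 yn; have n0 : 0 < n by lra.
have h1 : n * y - 1 <= 0 by have := ler_wpM2l (ltW n0) yn; rewrite divff ?gt_eqF //; lra.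
have h2 : 2 <= n * (1 - y) - 1 by lra.
rewrite /win /winI; have [_ -> ->] := hat_le0 h1; have [_ -> ->] := hat_ge2 h2.
by split; [ring|field; rewrite gt_eqF].
Qed.

Lemma win_right (n y : R) : 4 <= n -> 1 - n^-1 <= y -> win n y = 0 /\ winI n y = 1 - 4 / n.
Proof.
move=> n4 yn; have n0 : 0 < n by lra.
have h1 : n - 1 <= n * y.
  by have := ler_wpM2l (ltW n0) yn; rewrite mulrBr mulr1 divff ?gt_eqF.
have h2 : n * (1 - y) - 1 <= 0 by lra.
have h3 : 2 <= n * y - 1 by lra.
rewrite /win /winI; have [_ -> ->] := hat_le0 h2; have [_ -> ->] := hat_ge2 h3.
by split; [ring|field; rewrite gt_eqF].
Qed.

Lemma win_derive (n y : R) : n != 0 -> is_derive y 1 (winI n) (win n y).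
Proof.
move=> n0.
have d1 : is_derive y 1 (fun y => n * y - 1) n.
  have -> : (fun y => n * y - 1) = (n \*: id - cst 1 : R -> R) by apply/funext.
  have D := is_deriveB (is_deriveZ n (is_derive_id y (1 : R))) (is_derive_cst (1 : R) y 1).
  by apply: is_derive_eq D _; rewrite subr0 /GRing.scale /= mulr1.
have d2 : is_derive y 1 (fun y => n * (1 - y) - 1) (- n).
  have -> : (fun y => n * (1 - y) - 1) = (n \*: (cst 1 - id) - cst 1 : R -> R).
    by apply/funext.
  have D := is_deriveB (is_deriveZ n (is_deriveB (is_derive_cst (1 : R) y 1)
    (is_derive_id y (1 : R)))) (is_derive_cst (1 : R) y 1).
  by apply: is_derive_eq D _; rewrite subr0 sub0r /GRing.scale /= mulrN1.
have e1 := @is_derive1_comp _ hat2 (fun y => n * y - 1) y _ _ (hat2_derive _) d1.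
have e2 := @is_derive1_comp _ hat2 (fun y => n * (1 - y) - 1) y _ _ (hat2_derive _) d2.
have D := is_deriveD (is_deriveB (is_deriveZ n^-1 (is_deriveB e1 e2)) (is_derive_id y (1 : R)))
  (is_derive_cst (1 - 2 / n) y 1).
have -> : winI n = (n^-1 \*: ((hat2 \o (fun y => n * y - 1)) - (hat2 \o (fun y => n * (1 - y) - 1)))
   - id + cst (1 - 2 / n) : R -> R).
  by apply/funext => t.
by apply: is_derive_eq D _; rewrite /win /GRing.scale /=; field.
Qed.

Lemma continuous_hat1 : continuous (@hat1 R).
Proof. exact: is_derive_continuous (@hat1_derive R). Qed.

Lemma continuous_win (n : R) : continuous (win n).
Proof.
move=> y; apply: cvgB; last exact: cvg_cst.
have c0 : continuous (fun y : R => n * y - 1).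
  move=> t; apply: cvgB; last exact: cvg_cst.
  by apply: cvgM; [exact: cvg_cst|exact: cvg_id].
have c1 : continuous (fun y : R => n * (1 - y) - 1).
  move=> t; apply: cvgB; last exact: cvg_cst.
  by apply: cvgM; [exact: cvg_cst|apply: cvgB; [exact: cvg_cst|exact: cvg_id]].
apply: cvgD.
  by apply: (@continuous_comp _ _ _ (fun y : R => n * y - 1) hat1); [exact: c0|exact: continuous_hat1].
by apply: (@continuous_comp _ _ _ (fun y : R => n * (1 - y) - 1) hat1); [exact: c1|exact: continuous_hat1].
Qed.

(** For f(t) = winI n (exp (- exp (4 pi t))), up to a shift of t, the density of
    Lam a 0 weighted by the derivative of f is minus 4 kap times a windowed
    Gaussian. *)
Lemma flux_win a (n : R) : 4 <= n ->
  4 * kap * intp (fun z => win n (gauss2 a z) * gauss2 a z) =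
  (1 - 4 / n) * flux setT a (Lam a 0).
Proof.
move=> n4; have n0 : 0 < n by lra.
have k0 := @kap_gt0 R.
have lnn : 0 <= ln n by apply: ln_ge0; lra.
(* with this shift the window lies to the left of the level - 1 *)
pose s := 1 + kap * ln n.
have s0 : - s <= 0 by rewrite oppr_le0 addr_ge0 // mulr_ge0 // ltW.
rewrite -(flux_Lam_shift a s0).
pose X t := expR ((t + s) / kap).
pose Y t := expR (- X t).
have dX (t : R) : is_derive t 1 X (X t / kap).
  have dA : is_derive t 1 (fun t => (t + s) / kap) kap^-1.
    have -> : (fun t => (t + s) / kap) = (kap^-1 \*: (id + cst s) : R -> R).
      by apply/funext => y; rewrite /GRing.scale /= mulrC.
    have D := is_deriveZ kap^-1 (is_deriveD (is_derive_id t (1 : R)) (is_derive_cst s t 1)).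
    by apply: is_derive_eq D _; rewrite addr0 /GRing.scale /= mulr1.
  exact: (@is_derive1_comp _ expR (fun t => (t + s) / kap) t _ _ (is_derive_expR _) dA).
have dY (t : R) : is_derive t 1 Y (Y t * (- (X t / kap))).
  exact: (@is_derive1_comp _ expR (fun t => - X t) t _ _ (is_derive_expR _) (is_deriveN (dX t))).
pose f t := winI n (Y t).
pose f' t := win n (Y t) * (Y t * (- (X t / kap))).
have nn : n != 0 by rewrite gt_eqF.
have df (t : R) : is_derive t 1 f (f' t).
  exact: (@is_derive1_comp _ (winI n) Y t _ _ (win_derive _ nn) (dY t)).
have cX := is_derive_continuous dX; have cY := is_derive_continuous dY.
have cf' : continuous f'.
  move=> t; apply: cvgM.
    by apply: (@continuous_comp _ _ _ Y (win n)); [exact: cY|exact: continuous_win].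
  apply: cvgM; first exact: cY.
  by apply: cvgN; apply: cvgM; [exact: cX|exact: cvg_cst].
pose b : R := - 1; pose lo := - s - kap * ln n.
have Yb t : b <= t -> Y t <= n^-1.
  rewrite /b => bt; have : n <= X t.
    rewrite /X -[leLHS]lnK ?posrE // ler_expR ler_pdivlMr // /s; lra.
  move=> nX; rewrite /Y expRN lef_pV2 ?posrE ?expR_gt0 //.
  by apply: le_trans nX _; apply: le_trans (expR_ge1Dx _); rewrite lerDr.
have Ylo t : t <= lo -> 1 - n^-1 <= Y t.
  rewrite /lo => tl; have : X t <= n^-1.
    rewrite /X -[leRHS]lnK ?posrE ?invr_gt0 // ler_expR ler_pdivrMr // lnV ?posrE //; lra.
  move=> Xn; apply: le_trans (expR_ge1Dx _); lra.
have cf : cut f (1 - 4 / n) lo b.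
  split; first by rewrite /b; lra.
    by move=> t /Yb /(win_left n4)[_].
  by move=> t /Ylo /(win_right n4)[_].
have c0 : cut f' 0 lo b.
  split; first by rewrite /b; lra.
    by move=> t /Yb /(win_left n4)[h _]; rewrite /f' h mul0r.
  by move=> t /Ylo /(win_right n4)[h _]; rewrite /f' h mul0r.
have := flux_cut (Lam_pole a (- s)) df cf' cf c0.
have -> : dens setT a (Lam a (- s)) f' =
    (fun z => - (4 * kap) * (win n (gauss2 a z) * gauss2 a z)).
  apply/funext => z; rewrite /dens.
  case: (pselect (z = a)) => za.
    rewrite za lift_w mul0r /gauss2 /sqd !subrr expr0n addr0 oppr0 expR0.
    have h1 : 1 - n^-1 <= 1 by rewrite gerBl invr_ge0 ltW.
    by have [-> _] := win_right n4 h1; rewrite mul0r mulr0.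
  have N0 := sqd_gt0 za.
  rewrite liftE //; have [_ H] := Lam_C2 a (- s); have [_ ->] := H z za.
  have XE : X (Lam a (- s) z) = sqd a z.
    by rewrite /X /Lam subrK mulrAC mulfV ?gt_eqF // mul1r lnK.
  rewrite /f' /Y XE -/(gauss2 a z).
  by field; rewrite !gt_eqF.
have ig : area.-integrable setT (EFin \o (fun z => win n (gauss2 a z) * gauss2 a z)).
  have cw : continuous (fun z => win n (gauss2 a z) * gauss2 a z).
    move=> z; apply: cvgM; last exact: gauss2_cont.
    by apply: continuous_comp_pt; [exact: gauss2_cont|exact: continuous_win].
  apply: (le_integrable measurableT _ _ (gauss2_integrable a)).
    by apply/measurable_EFinP; exact: continuous_measurableT.
  move=> z _ /=; rewrite lee_fin normrM -[leRHS]mul1r ler_wpM2r //.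
  exact: win_norm.
rewrite /intp RintegralZl // -/(intp _).
by rewrite !mulNr => /oppr_inj.
Qed.

(** As n grows, the windowed Gaussians tend to the Gaussian and their integrals
    to pi, and 4 kap pi = 1. *)
Theorem flux_Lam a : flux setT a (Lam a 0) = 1.
Proof.
pose nn (n : nat) : R := n%:R + 4.
have n4 n : 4 <= nn n by rewrite lerDr.
have cE := @gauss2_cont a.
have mE := continuous_measurableT cE.
have mw n : measurable_fun [set: P2] (fun z => win (nn n) (gauss2 a z) * gauss2 a z).
  apply: continuous_measurableT => z; apply: cvgM; last exact: cE.
  by apply: continuous_comp_pt; [exact: cE|exact: continuous_win].
have nnoo : nn n @[n --> \oo] --> +oo.
  by apply/cvgryPge => M; near=> n; apply: le_trans (_ : n%:R <= _);
    [near: n; exact: nbhs_infty_ger|rewrite /nn; lra].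
have lim1 : intp (fun z => win (nn n) (gauss2 a z) * gauss2 a z) @[n --> \oo] --> intp (gauss2 a).
  apply: (@dominated_intp _ a _ _ (gauss2 a)) => //.
  - exact: gauss2_integrable.
  - move=> n z; rewrite normrM -[leRHS]mul1r; apply: ler_pM => //; first exact: win_norm.
    by rewrite ger0_norm // expR_ge0.
  - move=> z za.
    have N0 := sqd_gt0 za.
    have y0 : 0 < gauss2 a z by exact: expR_gt0.
    have y1 : gauss2 a z < 1 by rewrite expR_lt1 oppr_lt0.
    set y := gauss2 a z in y0 y1 *.
    have : \forall n \near \oo, y = win (nn n) y * y.
      near=> n.
      have h1 : 3 / y <= nn n by near: n; exact: cvgry_ge nnoo _.
      have h2 : 3 / (1 - y) <= nn n by near: n; exact: cvgry_ge nnoo _.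
      have h3 : 2 <= nn n * y - 1 by rewrite ler_pdivrMr // in h1; lra.
      have h4 : 2 <= nn n * (1 - y) - 1 by rewrite ler_pdivrMr in h2; lra.
      by rewrite /win; have [_ -> _] := hat_ge2 h3; have [_ -> _] := hat_ge2 h4;
        rewrite addrK mul1r.
    move=> H.
    have C : (fun _ : nat => y) n @[n --> \oo] --> y by exact: cvg_cst.
    by apply: cvg_trans C; apply: near_eq_cvg; exact: H.
have If : intp (gauss2 a) = pi by rewrite /intp /Rintegral gauss2_integral.
have k0 := @kap_gt0 R.
have ninv : (nn n)^-1 @[n --> \oo] --> (0 : R).
  by apply/gtr0_cvgV0 => //; near=> n; have := n4 n; lra.
have lim2 : (1 - 4 / nn n) * flux setT a (Lam a 0) @[n --> \oo] -->
    (1 - 4 * 0) * flux setT a (Lam a 0).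
  apply: cvgM; last exact: cvg_cst.
  by apply: cvgB; [exact: cvg_cst|apply: cvgM; [exact: cvg_cst|exact: ninv]].
have lim3 : (1 - 4 / nn n) * flux setT a (Lam a 0) @[n --> \oo] --> 4 * kap * pi.
  rewrite -If.
  have -> : (fun n => (1 - 4 / nn n) * flux setT a (Lam a 0)) =
     (fun n => 4 * kap * intp (fun z => win (nn n) (gauss2 a z) * gauss2 a z)).
    by apply/funext => n; rewrite flux_win.
  by apply: cvgM; [exact: cvg_cst|exact: lim1].
have := cvg_unique _ lim2 lim3; rewrite mulr0 subr0 mul1r => ->.
have pn : (pi : R) != 0 by rewrite gt_eqF // pi_gt0.
by rewrite /kap; move: (pi : R) pn => p pn; field.
Unshelve. all: by end_near. Qed.

End LogFlux.

(** * Compactness and comparison in a bounded domain *)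

Section Domain.
Set Implicit Arguments.
Unset Strict Implicit.
Context {R : realType}.
Local Notation P2 := (measurableTypeR R * measurableTypeR R)%type.
Variable D : set (R * R).
Hypotheses (oD : open D) (bD : bounded_set D).
Implicit Types (f : R * R -> R) (S K : set (R * R)).

Lemma boundaryP z : ~ D z -> closure D z -> boundary D z.
Proof.
by move=> nD cD; split => // /interior_subset.
Qed.

Lemma not_closure_near z : ~ closure D z -> \forall y \near z, ~ D y.
Proof.
move=> nc; apply: contrapT => H; apply: nc => B nB.
apply: contrapT => DB; apply: H.
apply: filterS nB => y By Dy; apply: DB; exists y; split => //.
Qed.

(** S stays away from the boundary of D, so it is closed in the plane. *)
Lemma compact_in_domain S : S `<=` D ->
  (forall z, D z -> ~ S z -> \forall y \near z, ~ S y) ->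
  (forall z, boundary D z -> \forall y \near z, D y -> ~ S y) -> compact S.
Proof.
move=> SD H1 H2.
have [B B0 DB] := bounded_box bD.
apply: (subclosed_compact _ (@box_compact R B)); last by move=> z /SD /DB.
rewrite -[S]setCK; apply: open_closedC; rewrite openE => z nS.
case: (pselect (D z)) => Dz; first exact: H1.
case: (pselect (closure D z)) => cz.
  by have := H2 z (boundaryP Dz cz); apply: filterS => y h Sy; apply: (h (SD y Sy)).
by have := not_closure_near cz; apply: filterS => y h /SD.
Qed.

Lemma open_punctured_D w : open (D `\ w).
Proof. exact: open_punctured. Qed.

Lemma near_punctured w z : (D `\ w) z -> \forall y \near z, (D `\ w) y.
Proof. by move=> Ez; apply: open_nbhs_nbhs; split => //; exact: open_punctured_D. Qed.

(** The pole counts as a boundary point, where the upper limit has to be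
    nonpositive as well. *)
Lemma weak_max_punctured w f : D w -> C2 (D `\ w) f ->
  (forall z, (D `\ w) z -> laplacian f z = 0) ->
  (forall eta z, 0 < eta -> boundary D z -> \forall y \near z, D y -> f y < eta) ->
  (forall eta, 0 < eta -> \forall y \near w, y <> w -> f y < eta) ->
  forall z, (D `\ w) z -> f z <= 0.
Proof.
move=> Dw C2f harm fb fw.
have [cf _ _] := C2f.
apply: weak_max => //.
- exact: open_punctured_D.
- have [M [Mr hM]] := bD; exists M; split => // x xM z [Dz _]; exact: hM.
- move=> eta eta0.
  pose S := [set z | (D `\ w) z /\ eta <= f z].
  exists S; split; last 2 first.
  + by move=> z [].
  + by move=> z Ez h; split => //; exact: ltW.
  apply: compact_in_domain; first by move=> z [[]].
  + move=> z Dz nS; have [->|/eqP zw] := eqVneq z w.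
      have := fw eta eta0; apply: filterS => y hy [[_ yw]] h.
      by have := hy yw; rewrite ltNge h.
    have Ez : (D `\ w) z by [].
    have fz : f z < eta by rewrite ltNge; apply/negP => h; apply: nS.
    have : \forall y \near z, f y < eta by apply: (cvgr_lt _ (cf z Ez)).
    by apply: filterS => y h [_]; rewrite leNgt h.
  + move=> z bz; have := fb eta z eta0 bz; apply: filterS => y h Dy [_].
    by rewrite leNgt h.
Qed.

Lemma C2_lin (U : set (R * R)) (c d : R) (f h : R * R -> R) : open U ->
  C2 U f -> C2 U h ->
  C2 U (fun z => c * f z + d * h z) /\
  forall z, U z -> laplacian (fun z => c * f z + d * h z) z =
    c * laplacian f z + d * laplacian h z.
Proof.
move=> oU [cf fx fy] [ch hx hy].
have lin (e : R * R) (p q : R * R -> R) z dp dq : isd e p z dp -> isd e q z dq ->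
    isd e (fun z => c * p z + d * q z) z (c * dp + d * dq).
  move=> hp hq.
  have := isdD (isdM (isd_cst e c z) hp) (isdM (isd_cst e d z) hq).
  by rewrite !mul0r !add0r.
have clin (p q : R * R -> R) z : {for z, continuous p} -> {for z, continuous q} ->
    {for z, continuous (fun z => c * p z + d * q z)}.
  by move=> cp cq; apply: cvgD; apply: cvgM => //; exact: cvg_cst.
have dir (e : R * R) : C2dir e U f -> C2dir e U h ->
   C2dir e U (fun z => c * f z + d * h z) /\
   forall z, U z -> dd e (dd e (fun z => c * f z + d * h z)) z =
     c * dd e (dd e f) z + d * dd e (dd e h) z.
  move=> Hf Hh.
  have [A B C] := @C2dir_intro _ e U (fun z => c * f z + d * h z)
    (fun z => c * dd e f z + d * dd e h z)
    (fun z => c * dd e (dd e f) z + d * dd e (dd e h) z) oU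
    (fun z Uz => let: And4 a1 a2 a3 a4 := Hf z Uz in
                 let: And4 b1 b2 b3 b4 := Hh z Uz in lin _ _ _ _ _ _ (isd_dd a1) (isd_dd b1))
    (fun z Uz => let: And4 a1 a2 a3 a4 := Hf z Uz in
                 let: And4 b1 b2 b3 b4 := Hh z Uz in lin _ _ _ _ _ _ (isd_dd a2) (isd_dd b2))
    (fun z Uz => let: And4 a1 a2 a3 a4 := Hf z Uz in
                 let: And4 b1 b2 b3 b4 := Hh z Uz in clin _ _ _ a3 b3)
    (fun z Uz => let: And4 a1 a2 a3 a4 := Hf z Uz in
                 let: And4 b1 b2 b3 b4 := Hh z Uz in clin _ _ _ a4 b4).
  by split.
have [X1 X2] := dir ex fx hx; have [Y1 Y2] := dir ey fy hy.
split; first by split => // z Uz; apply: clin; [exact: cf|exact: ch].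
move=> z Uz.
have alg (a1 a2 b1 b2 : R) :
  c * a1 + d * b1 + (c * a2 + d * b2) = c * (a1 + a2) + d * (b1 + b2) by ring.
have E1 := congr2 (fun s t => c * s + d * t) (laplacianE f z) (laplacianE h z).
have E2 := congr2 +%R (X2 z Uz) (Y2 z Uz).
exact: (etrans (laplacianE _ z) (etrans E2 (etrans (alg _ _ _ _) (esym E1)))).
Qed.

Lemma C2_near U f h : C2 U f ->
  (forall z, U z -> \forall y \near z, f y = h y) ->
  C2 U h /\ forall z, U z -> laplacian h z = laplacian f z.
Proof.
move=> [cf fx fy] fh; split.
  split => [z Uz||].
  - exact: continuous_near (fh z Uz) (cf z Uz).
  - by apply: C2dir_near => z Uz; exists f, U; split => //; exact: fh.
  - by apply: C2dir_near => z Uz; exists f, U; split => //; exact: fh.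
move=> z Uz; rewrite (laplacianE f) (laplacianE h).
have L (e : R * R) : dd e (dd e h) z = dd e (dd e f) z.
  exact: (esym (nbhs_singleton (dd_near e (dd_near e (fh z Uz))))).
by rewrite (L ex) (L ey).
Qed.

End Domain.

(** * The Green function as a potential with a pole *)

Section GreenFunction.
Set Implicit Arguments.
Unset Strict Implicit.
Context {R : realType}.
Local Notation P2 := (measurableTypeR R * measurableTypeR R)%type.
Variables (D : set (R * R)) (g : R * R -> R * R -> \bar R).
Hypotheses (oD : open D) (bD : bounded_set D) (cD : connected D)
  (hg : green_function D g).
Implicit Types (z a y : R * R).

(** The Green function with pole a, made real valued and measurable on the whole
    plane. *)
Definition gam a z : R := if `[< (D `\ a) z >] then fine (g z a) else 0.

Lemma gamE a z : (D `\ a) z -> gam a z = fine (g z a).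
Proof. by rewrite /gam => h; case: asboolP. Qed.

Lemma gam_off a z : ~ (D `\ a) z -> gam a z = 0.
Proof. by rewrite /gam => h; case: asboolP. Qed.

Lemma gam_fin a z : D a -> (D `\ a) z -> g z a = (gam a z)%:E.
Proof.
move=> Da Ez; have [_ [fin _] _ _ _] := hg Da.
by rewrite gamE // fineK // fin //; case: Ez.
Qed.

Lemma gam_near a z : (D `\ a) z ->
  \forall y \near z, (fine \o (fun z => g z a)) y = gam a y.
Proof.
by move=> Ez; have := near_punctured oD Ez; apply: filterS => y Ey; rewrite gamE.
Qed.

Lemma gam_C2 a : D a -> C2 (D `\ a) (gam a) /\
  forall z, (D `\ a) z -> laplacian (gam a) z = 0.
Proof.
move=> Da; have [_ [_ [hC hl]] _ _ _] := hg Da.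
have [A B] := C2_near (Ck2_C2 hC) (@gam_near a).
split; first exact: A.
move=> z Ez; exact: (etrans (B z Ez) (hl z Ez)).
Qed.

Lemma gam_asym a : D a -> exists2 C, 0 <= C &
  \forall z \near a, z <> a -> `|gam a z - Lam a 0 z| <= C.
Proof.
move=> Da; have [_ _ _ [M0 [M0r hb]] _] := hg Da.
pose M := `|M0| + 1; have hM : M0 < M by rewrite /M (le_lt_trans (ler_norm _)) // ltrDl.
exists M; first by rewrite /M addr_ge0.
have nD : \forall z \near a, D z by apply: open_nbhs_nbhs.
have H : \forall z \near a, z != a ->
  `|fine (g z a) - (2 * pi)^-1 * ln (cmod (z - a))| <= M by exact: hb M hM.
near=> z => za.
have Ez : (D `\ a) z by split => //; near: z.
rewrite gamE // LamE // addr0.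
have : z != a by apply/eqP.
by near: z.
Unshelve. all: by end_near. Qed.

Lemma boundary_neq a zeta : D a -> boundary D zeta -> \forall z \near zeta, z <> a.
Proof.
move=> Da [_ nz].
have Ez : ([set: R * R] `\ a) zeta.
  by split => // za; apply: nz; rewrite za; exact: open_nbhs_nbhs.
have : \forall z \near zeta, ([set: R * R] `\ a) z.
  by apply: open_nbhs_nbhs; split => //; apply: open_punctured; exact: openT.
by apply: filterS => z [].
Qed.

Lemma vanishing_near_boundary (u : R * R -> \bar R) zeta (eta : R) :
  vanishes_on_boundary D u -> 0 < eta -> boundary D zeta ->
  \forall z \near zeta, D z -> `|fine (u z)| < eta.
Proof.
move=> vb eta0 bz; have V := vb zeta bz.
have n1 : \forall z \near zeta, D z -> (u z < eta%:E)%E.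
  have H : nbhs (0%E : \bar R) [set x | (x < eta%:E)%E].
    apply: open_nbhs_nbhs; split; first exact: open_ereal_lt_ereal.
    by rewrite /= lte_fin.
  exact: V _ H.
have n2 : \forall z \near zeta, D z -> ((- eta)%:E < u z)%E.
  have H : nbhs (0%E : \bar R) [set x | ((- eta)%:E < x)%E].
    apply: open_nbhs_nbhs; split; first exact: open_ereal_gt_ereal.
    by rewrite /= lte_fin oppr_lt0.
  exact: V _ H.
near=> z => Dz.
have h1 : (u z < eta%:E)%E by move: Dz; near: z.
have h2 : ((- eta)%:E < u z)%E by move: Dz; near: z.
by move: h1 h2; case: (u z) => [r||] //=; rewrite !lte_fin ltr_norml => -> ->.
Unshelve. all: by end_near. Qed.

Lemma gam_boundary a zeta (eta : R) : D a -> 0 < eta -> boundary D zeta ->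
  \forall z \near zeta, D z -> `|gam a z| < eta.
Proof.
move=> Da eta0 bz; have [_ _ _ _ vb] := hg Da.
have n1 := vanishing_near_boundary vb eta0 bz.
near=> z => Dz; case: (pselect ((D `\ a) z)) => Ez; last by rewrite gam_off // normr0.
by rewrite gamE //; move: Dz; near: z.
Unshelve. all: by end_near. Qed.

(** Sublevel sets are compact because the Green function tends to 0 at the
    boundary, and shrink to the pole because it is bounded away from the pole. *)
Lemma gam_pole_potential a : D a -> pole_potential D a (gam a).
Proof.
move=> Da; have [C2g hl] := gam_C2 Da; have [cg _ _] := C2g.
split => //.
- move=> t t0; apply: (compact_in_domain bD).
  + by move=> z [->|[[]]].
  + move=> z Dz nS.
    have Ez : (D `\ a) z by split => // za; apply: nS; left.
    have gz : t < gam a z by rewrite ltNge; apply/negP => h; apply: nS; right.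
    have n1 : \forall y \near z, t < gam a y by apply: (cvgr_gt _ (cg z Ez)).
    have n2 := near_punctured oD Ez.
    near=> y; move=> [ya|[_]].
      by have [_] : (D `\ a) y by near: y.
    by apply/negP; rewrite -ltNge; near: y.
  + move=> z bz.
    have n1 := gam_boundary Da (_ : 0 < - t) bz.
    have n2 := boundary_neq Da bz.
    near=> y => Dy; move=> [ya|[_]].
      by move: ya; near: y.
    apply/negP; rewrite -ltNge.
    have : `|gam a y| < - t by move: Dy; near: y; apply: n1; rewrite oppr_gt0.
    by rewrite ltr_norml opprK => /andP[].
- move=> V nV; have [_ _ bd _ _] := hg Da.
  have [M0 [_ hM]] := bd V nV.
  exists (`|M0| + 2) => z Ez h; apply: contrapT => nVz.
  have := hM (`|M0| + 1); rewrite (le_lt_trans (ler_norm _)) ?ltrDl // => /(_ isT).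
  move=> /(_ z) /=; rewrite -gamE // => H.
  have /H : (D `\` V) z by case: Ez.
  rewrite ler_norml => /andP[h2 _].
  by move: h h2; move: (gam a z) `|M0| => p q h h2; lra.
- move=> M; have [C C0 nC] := gam_asym Da.
  have n1 := pp_pole (Lam_pole a 0) (M - C).
  near=> z => za.
  have h1 : `|gam a z - Lam a 0 z| <= C by move: za; near: z.
  have h2 : Lam a 0 z <= M - C by move: za; near: z.
  by move: h1 h2; rewrite ler_norml => /andP[_]; lra.
Unshelve. all: by end_near. Qed.

Lemma gam_le0 a z : D a -> (D `\ a) z -> gam a z <= 0.
Proof.
move=> Da; have [C2g hl] := gam_C2 Da.
apply: (weak_max_punctured oD bD Da C2g hl) => [eta y eta0 yb|eta eta0].
  have := gam_boundary Da eta0 yb; apply: filterS => x h Dx.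
  exact: le_lt_trans (ler_norm _) (h Dx).
have := pp_pole (gam_pole_potential Da) 0; apply: filterS => x h xa.
exact: le_lt_trans (h xa) eta0.
Qed.

End GreenFunction.

(** * Two-sided bounds on the Green function *)

Section GreenProperties.
Set Implicit Arguments.
Unset Strict Implicit.
Context {R : realType}.
Local Notation P2 := (measurableTypeR R * measurableTypeR R)%type.
Variables (D : set (R * R)) (g : R * R -> R * R -> \bar R).
Hypotheses (oD : open D) (bD : bounded_set D) (cD : connected D)
  (hg : green_function D g).
Implicit Types (z a y b : R * R).
Local Notation G := (gam D g).

Lemma Lam_bounded_domain : exists2 C, 0 <= C &
  forall a z, D a -> D z -> z <> a -> Lam a (- C) z <= 0.
Proof.
have [B B0 DB] := bounded_box bD.
pose C := `|kap * ln (8 * B ^+ 2)|; exists C; first exact: normr_ge0.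
move=> a z /DB Ba /DB Bz za.
have N0 := sqd_gt0 za.
have b0 : 0 < 8 * B ^+ 2 by rewrite mulr_gt0 // exprn_gt0.
have h := sqd_box Ba Bz.
rewrite /Lam subr_le0 (le_trans _ (ler_norm _)) // ler_wpM2l ?(ltW kap_gt0) //.
by rewrite ler_ln.
Qed.

(** For d > 0, (1 + d) (Lam a (- C)) - G a is nonpositive at the boundary and
    tends to -oo at the pole, hence is nonpositive; let d tend to 0. Since C
    only depends on D, this controls the singularity uniformly in the pole. *)
Lemma gam_lower : exists2 C, 0 <= C & forall a z, D a -> (D `\ a) z ->
  Lam a (- C) z <= G a z <= 0.
Proof.
have [C C0 HC] := Lam_bounded_domain; exists C => // a z Da Ez.
rewrite (gam_le0 oD bD hg Da Ez) andbT.
have [C2g lg] := gam_C2 oD hg Da.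
have [C2L LL] := Lam_C2 a (- C).
have subT : D `\ a `<=` [set: R * R] `\ a by move=> x [].
have C2L' : C2 (D `\ a) (Lam a (- C)).
  by have [c1 c2 c3] := C2L; split => x /subT; [exact: c1|exact: c2|exact: c3].
have [C1 C10 nC] := gam_asym oD hg Da.
have key (d : R) : 0 < d -> (1 + d) * Lam a (- C) z - G a z <= 0.
  move=> d0.
  have [A1 A2] := C2_lin (1 + d) (-1) (@open_punctured R D a oD) C2L' C2g.
  have E0 x : (1 + d) * Lam a (- C) x + -1 * G a x = (1 + d) * Lam a (- C) x - G a x.
    by rewrite mulN1r.
  rewrite -E0; apply: (weak_max_punctured oD bD Da A1) Ez.
  - move=> x Ex; apply: (etrans (A2 x Ex)).
    have l0 := (LL x (proj2 Ex)).1.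
    rewrite (lg x Ex); move: l0; move: (laplacian _ x) => l ->.
    by rewrite !mulr0 addr0.
  - move=> eta x eta0 bx.
    have n1 := gam_boundary hg Da eta0 bx.
    have n2 := boundary_neq oD Da bx.
    near=> y => Dy; rewrite E0.
    have ya : y <> a by near: y.
    have h1 : `|G a y| < eta by move: Dy; near: y.
    have h2 := HC a y Da Dy ya.
    move: h1; rewrite ltr_norml => /andP[h1 _].
    have h3 : (1 + d) * Lam a (- C) y <= 0 by rewrite pmulr_rle0 //; lra.
    by lra.
  - move=> eta eta0.
    have n1 := pp_pole (Lam_pole a 0) (- C1 / d).
    near=> y => ya; rewrite E0.
    have h1 : `|G a y - Lam a 0 y| <= C1 by move: ya; near: y.
    have h2 : Lam a 0 y <= - C1 / d by move: ya; near: y.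
    move: h2; rewrite ler_pdivlMr // => h2.
    have -> : Lam a (- C) y = Lam a 0 y - C by rewrite /Lam addr0.
    move: h1; rewrite ler_norml => /andP[h1 _].
    have h3 : 0 <= d * C by rewrite mulr_ge0 // ltW.
    have -> : (1 + d) * (Lam a 0 y - C) = Lam a 0 y + Lam a 0 y * d - C - d * C by ring.
    by lra.
apply/ler_addgt0Pl => e e0.
set L := Lam a (- C) z in key *.
have n0 : 0 < `|L| + 1 by rewrite ltr_wpDl.
have d0 : 0 < e / (`|L| + 1) by rewrite divr_gt0.
have := key _ d0; rewrite mulrDl mul1r.
have : `|e / (`|L| + 1) * L| <= e.
  rewrite normrM (gtr0_norm d0) mulrAC ler_pdivrMr // ler_wpM2l ?(ltW e0) //; lra.
by rewrite ler_norml => /andP[]; lra.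
Unshelve. all: by end_near. Qed.

Lemma measurable_gam a : D a -> measurable_fun [set: P2] (G a).
Proof.
move=> Da; have [[cg _ _] _] := gam_C2 oD hg Da.
have oE := @open_punctured R D a oD.
have -> : G a = (G a) \_ (D `\ a).
  apply/funext => z; rewrite patchE; case: ifPn => //.
  by rewrite notin_setE => /gam_off ->.
apply/(measurable_restrictT _ (open_measurable_plane oE)).
exact: continuous_measurable_plane.
Qed.

(** The mean value property averaged over thin annuli around b: plateaus of Lam
    b show that the average of G a over the annulus through z is G a b = 0, and
    G a is nonpositive. *)
Lemma gam_zero_near a b : D a -> (D `\ a) b -> G a b = 0 ->
  \forall z \near b, (D `\ a) z /\ G a z = 0.
Proof.
move=> Da Eb Gb; have [C2g lg] := gam_C2 oD hg Da; have [cg _ _] := C2g.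
have oE := @open_punctured R D a oD.
have PL := Lam_pole b (0 : R).
have [M HM] := pp_conc PL (near_punctured oD Eb).
pose A0 := Num.max M 1.
have mG := measurable_gam Da.
have main A : A0 <= A -> intp (fun z => G a z * dens setT b (Lam b 0) (hat 1 A) z) = 0 /\
   area.-integrable setT (EFin \o (fun z => G a z * dens setT b (Lam b 0) (hat 1 A) z)).
  move=> A0A; have MA : M <= A by rewrite (le_trans _ A0A) // le_max lexx.
  have A1 : 1 <= A by rewrite (le_trans _ A0A) // le_max lexx orbT.
  have Ap : 0 < A by lra.
  have lev : level setT b (Lam b 0) (- A) `<=` D `\ a.
    move=> z [->|[Ez h]] //; apply: (HM z Ez); lra.
  have cK : compact (level setT b (Lam b 0) (- A)) by apply: level_compact PL _ _; lra.
  have integ L : 0 <= L -> area.-integrable setT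
      (EFin \o (fun z => G a z * dens setT b (Lam b 0) (hat 1 (A + L)) z)).
    move=> L0; have p : 0 < A + L by lra.
    have Cd := dens_Cc PL (cut_hat ltr01 p) (@continuous_hat _ 1 (A + L)).
    apply: Cc_integrable; split; last first.
      have [_ [K cK' vK]] := Cd; exists K => // z /vK ->; exact: mulr0.
    have -> : (fun z => G a z * dens setT b (Lam b 0) (hat 1 (A + L)) z) =
              (fun z => dens setT b (Lam b 0) (hat 1 (A + L)) z * G a z).
      by apply/funext => z; rewrite mulrC.
    apply: (continuous_mul_vanish cK oE lev _ Cd.1 cg) => z nz.
    have := lift_vanish PL (cut_hat ltr01 p); rewrite /dens => h.
    rewrite h ?mul0r // => - [zb|[Ez hz]]; apply: nz; [by left|right; split => //; lra].
  have eqL L : 0 < L -> intp (fun z => G a z * dens setT b (Lam b 0) (hat 1 A) z) =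
       intp (fun z => G a z * dens setT b (Lam b 0) (hat 1 (A + L)) z).
    move=> L0; have p : 0 < A + L by lra.
    have [T1 T2 T3] := @plateau_spec _ _ _ _ PL 1 A 1 (A + L) ltr01 Ap ltr01 p
      ltac:(lra) ltac:(lra).
    have := green cK oE lev T2 T1 C2g.
    have -> : intp (fun z => plateau setT b (Lam b 0) 1 A 1 (A + L) z * laplacian (G a) z) = 0.
      rewrite /intp /Rintegral integral0_eq // => z _.
      case: (pselect ((D `\ a) z)) => Ez.
        by have := lg z Ez; move: (laplacian _ z) => l ->; rewrite mulr0.
      by rewrite T2 ?mul0r // => /lev.
    have -> : (fun z => laplacian (plateau setT b (Lam b 0) 1 A 1 (A + L)) z * G a z) =
      (fun z => G a z * dens setT b (Lam b 0) (hat 1 (A + L)) z -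
                G a z * dens setT b (Lam b 0) (hat 1 A) z).
      by rewrite T3; apply/funext => z; rewrite -mulrBr mulrC.
    have i0 := integ 0 (lexx _); rewrite addr0 in i0.
    rewrite /intp (RintegralB measurableT (integ L (ltW L0)) i0) => /eqP.
    by rewrite eq_sym subr_eq0 => /eqP.
  split; last by have := integ 0 (lexx _); rewrite addr0.
  apply/eqP; rewrite -normr_le0; apply/ler_addgt0Pl => e e0; rewrite addr0.
  have nb : \forall z \near b, `|G a z| <= e.
    have c := cg b Eb; have H : \forall z \near b, `|G a b - G a z| <= e.
      exact: (cvgr_dist_le _ _ c _ e0).
    by apply: filterS H => z; rewrite Gb sub0r normrN.
  have [M2 HM2] := pp_conc PL nb.
  pose L := `|M2| + 1; have L0 : 0 < L by rewrite ltr_wpDl.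
  have ML : M2 <= L by rewrite (le_trans (ler_norm _)) // lerDl.
  rewrite (eqL L L0).
  have p : 0 < A + L by lra.
  have [|_] := @window _ _ _ _ PL (G a) 1 (A + L) 0 e ltr01 p (ltW e0) mG.
    by move=> z Ez /andP[_ hz]; rewrite subr0; apply: (HM2 z Ez); lra.
  by rewrite mul0r subr0 flux_Lam mulr1.
have n1 := pp_pole PL (- A0 - 1).
have n2 := near_punctured oD Eb.
near=> z; have Ez : (D `\ a) z by near: z.
split => //; have [->//|/eqP zb] := eqVneq z b.
have hz : Lam b 0 z <= - A0 - 1 by move: zb; near: z.
pose A := - 1 - Lam b 0 z.
have [I0 iI] := main A ltac:(rewrite /A; lra).
have A1 : 1 <= A0 by rewrite le_max lexx orbT.
have Ap : 0 < A by rewrite /A; lra.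
have cuth := cut_hat ltr01 Ap.
have D0 x : 0 <= dens setT b (Lam b 0) (hat 1 A) x.
  by apply: (dens_ge0 PL x cuth) => t; exact: hat_ge0.
pose f x := -1 * (G a x * dens setT b (Lam b 0) (hat 1 A) x).
have if_ : area.-integrable setT (EFin \o f) by exact: (integrableZl measurableT (-1) iI).
have f0 x : 0 <= f x.
  rewrite /f mulN1r oppr_ge0; case: (pselect ((D `\ a) x)) => Ex.
    by rewrite mulr_le0_ge0 // (gam_le0 oD bD hg Da Ex).
  by rewrite gam_off // mul0r.
have If : intp f = 0.
  rewrite /intp /f.
  rewrite (RintegralZl (-1) measurableT iI) -/(intp _).
  by rewrite I0 mulr0.
have cf : {for z, continuous f}.
  apply: cvgM; first exact: cvg_cst.
  apply: cvgM; first exact: (cg z Ez).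
  exact: (dens_Cc PL cuth (@continuous_hat _ 1 A)).1.
have := intp_eq0 if_ f0 If cf; rewrite /f mulN1r => /eqP; rewrite oppr_eq0 mulf_eq0.
move=> /orP[/eqP//|]; rewrite /dens liftE // mulf_eq0.
have -> : hat 1 A (Lam b 0 z) = 1.
  rewrite /hat /A invr1 mul1r mulr1.
  have -> : - Lam b 0 z - (-1 - Lam b 0 z) = 1 by ring.
  exact: hat0_1.
rewrite oner_eq0 /= (proj2 ((Lam_C2 b 0).2 z zb)) => /eqP h.
have : 0 < 4 * kap ^+ 2 / sqd b z.
  by rewrite divr_gt0 ?sqd_gt0 // mulr_gt0 // exprn_gt0 // kap_gt0.
by rewrite h ltxx.
Unshelve. all: by end_near. Qed.

(** The zeros of G a form an open and closed subset of D that misses a. *)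
Lemma gam_lt0 a z : D a -> (D `\ a) z -> G a z < 0.
Proof.
move=> Da Ez; rewrite lt_neqAle (gam_le0 oD bD hg Da Ez) andbT.
apply/eqP => Gz.
pose N : set (R * R) := [set x | (D `\ a) x /\ G a x = 0].
have oN : open N.
  by rewrite openE => x [Ex Gx]; exact: gam_zero_near.
have [[cg _ _] _] := gam_C2 oD hg Da.
have ND : N = D.
  apply: cD.
  - by exists z; split.
  - by exists N => //; apply/seteqP; split => [x [h1 h2]|x []] //; split => //; case: h1.
  - exists (closure N); first exact: closed_closure.
    apply/seteqP; split => [x Nx|x [Dx cx]].
      by split; [case: Nx => -[]|exact: subset_closure].
    have [xa|/eqP xa] := eqVneq x a.
      rewrite xa in cx.
      have [y [[[_ ya] Gy] h]] := cx _ (pp_pole (gam_pole_potential oD bD hg Da) (-1)).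
      by have := h ya; rewrite Gy; lra.
    have Ex : (D `\ a) x by [].
    split => //; apply: contrapT => /eqP Gx.
    have n1 : \forall y \near x, G a y != 0 by exact: (cvgr_neq0 _ (cg x Ex) Gx).
    by have [y [[_ Gy] /=]] := cx _ n1; rewrite Gy eqxx.
by have [[_ []]] : N a by rewrite ND.
Qed.

End GreenProperties.

(** * Flux and symmetry of the Green function *)

Section GreenSymmetry.
Set Implicit Arguments.
Unset Strict Implicit.
Context {R : realType}.
Local Notation P2 := (measurableTypeR R * measurableTypeR R)%type.
Variables (D : set (R * R)) (g : R * R -> R * R -> \bar R).
Hypotheses (oD : open D) (bD : bounded_set D) (cD : connected D)
  (hg : green_function D g).
Implicit Types (z a y b : R * R).
Local Notation G := (gam D g).

Lemma compact_level K a : compact K -> K `<=` D -> D a ->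
  exists2 d, 0 < d & K `<=` level D a (G a) (- d).
Proof.
move=> cK KD Da.
have [[cg _ _] _] := gam_C2 oD hg Da.
have cov := (iffLR (compact_near_coveringP K) cK) R 0^'+
  (fun d z => level D a (G a) (- d) z) _.
have H : \forall d \near (0:R)^'+, K `<=` level D a (G a) (- d).
  apply: cov => z Kz; have Dz := KD z Kz.
  have [->|/eqP za] := eqVneq z a.
    have n1 := pp_pole (gam_pole_potential oD bD hg Da) (-1).
    have n2 : \forall y \near a, D y by apply: open_nbhs_nbhs.
    near=> y d => /=; have [->|/eqP ya] := eqVneq y a; [by left|right].
    split; first by split => //; near: y.
    apply: (@le_trans _ _ (-1)); first by move: ya; near: y.
    by rewrite lerN2 ltW //; near: d; exact: nbhs_right_lt.
  have Ez : (D `\ a) z by [].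
  have g0 := gam_lt0 oD bD cD hg Da Ez.
  have n1 : \forall y \near z, G a y < G a z / 2 by apply: (cvgr_lt _ (cg z Ez)); lra.
  have n2 := near_punctured oD Ez.
  near=> y d => /=; right; split; first by near: y.
  have h1 : G a y < G a z / 2 by near: y.
  have h2 : d < - (G a z / 2) by near: d; apply: nbhs_right_lt; lra.
  by lra.
have [d [d0 Hd]] : exists d, 0 < d /\ K `<=` level D a (G a) (- d).
  near (0:R)^'+ => d; exists d; split => //; near: d => //.
by exists d.
Unshelve. all: by end_near. Qed.

Lemma near_boundary_compact (P : R * R -> Prop) :
  (forall zeta, boundary D zeta -> \forall z \near zeta, D z -> P z) ->
  exists K, [/\ compact K, K `<=` D & forall z, D z -> ~ K z -> P z].
Proof.
move=> HP; pose K := closure [set z | D z /\ ~ P z].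
have KD : K `<=` D.
  move=> z Kz; apply: contrapT => nD.
  have bz : boundary D z.
    by apply: boundaryP => //; apply: closure_subset Kz => x [].
  by have [y [[Dy nP] /(_ Dy)]] := Kz _ (HP z bz).
exists K; split => //.
  have [B B0 HB] := bounded_box bD.
  apply: (subclosed_compact _ (@box_compact R B)); first exact: closed_closure.
  by move=> z /KD/HB.
by move=> z Dz nK; apply: contrapT => nP; apply: nK; apply: subset_closure.
Qed.

(** The closure of the set where P fails is a compact subset of D, on which G a
    has a negative upper bound. *)
Lemma near_boundary_level (P : R * R -> Prop) a : D a ->
  (forall zeta, boundary D zeta -> \forall z \near zeta, D z -> P z) ->
  exists2 d, 0 < d & forall z, (D `\ a) z -> - d <= G a z -> P z.
Proof.
move=> Da HP; have [K [cK KD KP]] := near_boundary_compact HP.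
have [d d0 Hd] := compact_level cK KD Da.
exists (d / 2); first by lra.
move=> z Ez hz; apply: KP; first by case: Ez.
by move=> /Hd[za|[_ h]]; [case: Ez|lra].
Qed.

Lemma gam_pairing a K phi : D a -> compact K -> K `<=` D -> vanish_off K phi ->
  C2 setT phi -> (\forall z \near a, laplacian phi z = 0) ->
  intp (fun z => G a z * laplacian phi z) = flux D a (G a) * phi a.
Proof.
move=> Da cK KD vK C2p lapa; have [d d0 Hd] := compact_level cK KD Da.
by have [] := pairing (gam_pole_potential oD bD hg Da) C2p cK vK d0 Hd lapa.
Qed.

(** G a - Lam a 0 is bounded near a, so the weight of the band of Lam a 0 just
    below - B gives - B as the average of G a, up to a bounded error. Testing
    with plateaus of the logarithm of height L shows that flux L - L is bounded
    for all L. *)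
Lemma flux_gam a : D a -> flux D a (G a) = 1.
Proof.
move=> Da; have PL := Lam_pole a (0 : R).
have [C C0 nC] := gam_asym oD hg Da.
have nD : \forall z \near a, D z by apply: open_nbhs_nbhs.
have [M HM] := pp_conc PL (filterI nC nD).
pose A := Num.max M 1.
have MA : M <= A by rewrite le_max lexx.
have A1 : 1 <= A by rewrite le_max lexx orbT.
have Ap : 0 < A by lra.
have mG := measurable_gam oD hg Da.
have win B : A <= B -> area.-integrable setT
     (EFin \o (fun z => G a z * dens setT a (Lam a 0) (hat 1 B) z)) /\
   `|intp (fun z => G a z * dens setT a (Lam a 0) (hat 1 B) z) + B| <= C + 2.
  move=> AB; have B0 : 0 < B by lra.
  have C20 : 0 <= C + 2 by lra.
  have [|i H] := @window _ _ _ _ PL (G a) 1 B (- B) (C + 2) ltr01 B0 C20 mG.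
    move=> z Ez /andP[h1 h2]; have [h3 _] := HM z Ez ltac:(lra).
    move: (h3 (proj2 Ez)); rewrite !ler_norml => /andP[h4 h5].
    by apply/andP; split; lra.
  split => //; move: H.
  rewrite flux_Lam // !mulr1.
  by rewrite opprK.
have key L : 0 < L -> `|flux D a (G a) * L - L| <= 2 * (C + 2).
  move=> L0; have p : 0 < A + L by lra.
  have [T1 T2 T3] := @plateau_spec _ _ _ _ PL 1 A 1 (A + L) ltr01 Ap ltr01 p
      ltac:(lra) ltac:(lra).
  have cK : compact (level setT a (Lam a 0) (- A)) by apply: level_compact PL _ _; lra.
  have KD : level setT a (Lam a 0) (- A) `<=` D.
    by move=> z [->//|[Ez h]]; have [] := HM z Ez ltac:(lra).
  have lapa : \forall z \near a, laplacian (plateau setT a (Lam a 0) 1 A 1 (A + L)) z = 0.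
    have n1 := pp_pole PL (- (A + L) - 2 * 1).
    near=> z; rewrite T3 /dens.
    have [->|/eqP za] := eqVneq z a; first by rewrite !lift_w !mul0r subrr.
    rewrite !liftE //.
    have h : Lam a 0 z <= - (A + L) - 2 * 1 by move: za; near: z.
    have [-> _ _] := hat_left ltr01 h.
    have h' : Lam a 0 z <= - A - 2 * 1 by lra.
    have [-> _ _] := hat_left ltr01 h'.
    by rewrite !mul0r subrr.
  have := gam_pairing Da cK KD T2 T1 lapa.
  have [iA wA] := win A (lexx _); have [iL wL] := win (A + L) ltac:(lra).
  have -> : (fun z => G a z * laplacian (plateau setT a (Lam a 0) 1 A 1 (A + L)) z) =
      (fun z => G a z * dens setT a (Lam a 0) (hat 1 (A + L)) z -
                G a z * dens setT a (Lam a 0) (hat 1 A) z).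
    by rewrite T3; apply/funext => z; rewrite -mulrBr.
  rewrite /intp (RintegralB measurableT iL iA) -/(intp _) -/(intp _).
  rewrite /plateau lift_w; move: wA wL; set X := intp _; set Y := intp _.
  move=> wA wL E.
  have -> : flux D a (G a) * L - L = (X + A) - (Y + (A + L)).
    have -> : flux D a (G a) * L = - (flux D a (G a) * (A + 1 - (A + L) - 1)) by ring.
    by rewrite -E; ring.
  by rewrite (le_trans (ler_normB _ _)) // mulr2n mulrDl mul1r lerD.
apply/eqP; rewrite -subr_eq0 -normr_le0; apply/ler_addgt0Pl => e e0; rewrite addr0.
pose L := 2 * (C + 2) / e.
have c0 : 0 < 2 * (C + 2) by lra.
have L0 : 0 < L by rewrite divr_gt0.
have := key L L0.
have -> : flux D a (G a) * L - L = (flux D a (G a) - 1) * L by ring.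
rewrite normrM (gtr0_norm L0) /L mulrA ler_pdivrMr // (mulrC (2 * (C + 2))).
by rewrite ler_pM2r.
Unshelve. all: by end_near. Qed.

(** [representation] for U = G a, v = G b and q = 0. *)
Lemma gam_sym a b : D a -> (D `\ a) b -> G a b = G b a.
Proof.
move=> Da Eb; have Db : D b by case: Eb.
have Ea : (D `\ b) a by split => // ab; case: Eb => _; apply.
have [[cg _ _] _] := gam_C2 oD hg Da.
have PP := gam_pole_potential oD bD hg Db.
have mG := measurable_gam oD hg Da.
have m0 : measurable_fun [set: P2] (fun=> 0 : R) by exact: measurable_cst.
have neg z : (D `\ b) z -> G b z < 0 by exact: (gam_lt0 oD bD cD hg Db).
have bd (eta : R) : 0 < eta -> exists2 d, 0 < d &
     forall z, (D `\ b) z -> - d <= G b z -> `|G a z| <= eta.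
  move=> eta0; apply: (near_boundary_level (P := fun z => `|G a z| <= eta) Db).
  move=> zeta bz; have := gam_boundary hg Da eta0 bz.
  by apply: filterS => z h Dz; exact: ltW (h Dz).
have E0 h : (fun z => G a z * (fun=> 0 : R) z * h z) = (fun=> 0).
  by apply/funext => z; rewrite mulr0 mul0r.
have I0 h : intp (fun z => G a z * (fun=> 0 : R) z * h z) = 0.
  by rewrite E0 /intp /Rintegral integral0.
have := representation PP mG m0 Ea neg (cg b Eb) bd (kappa := 1).
rewrite flux_gam // I0 mul1r mul1r add0r; apply.
- by move=> z _; rewrite mulr0.
- by rewrite E0; exact: integrable0.
- move=> phi K cK KD vK C2p lapa.
  by rewrite I0 add0r mul1r (gam_pairing Da cK KD vK C2p lapa) flux_gam // mul1r.
Qed.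

End GreenSymmetry.

(** * An integrable power of the distance *)

Section Kernel.
Set Implicit Arguments.
Unset Strict Implicit.
Context {R : realType}.
Local Notation P2 := (measurableTypeR R * measurableTypeR R)%type.
Local Notation mu := (@lebesgue_measure R).
Implicit Types (a z : R * R).

(** The power -1/2 of the distance, away from z = a. *)
Definition nu a z : R := expR (- ln (sqd a z) / 4).

Lemma nu_ge0 a z : 0 <= nu a z.
Proof. exact: expR_ge0. Qed.

Lemma nu_sym a z : nu a z = nu z a.
Proof. by rewrite /nu /sqd -[in LHS]sqrrN -[X in _ + X]sqrrN !opprB. Qed.

Lemma measurable_nu : measurable_fun [set: P2 * P2] (fun q : P2 * P2 => nu q.1 q.2).
Proof.
apply: (@measurableT_comp _ _ _ _ _ _ expR); first exact: measurable_expR.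
apply: measurable_funM; last exact: measurable_cst.
apply: measurableT_comp => //.
apply: (@measurableT_comp _ _ _ _ _ _ (@ln R)); first exact: measurable_ln.
by apply: measurable_funD; apply: measurable_funX; apply: measurable_funB;
  apply: measurableT_comp => //; exact: measurableT_comp.
Qed.

Lemma measurable_nu1 a : measurable_fun [set: P2] (nu a).
Proof.
have -> : nu a = (fun q : P2 * P2 => nu q.1 q.2) \o (pair (a : P2)).
  by apply/funext => z.
apply: measurableT_comp; first exact: measurable_nu.
exact: pair1_measurable.
Qed.

(** (x^2 + d)^(-1/4), and a function whose derivative dominates it. *)
Definition reg (d x : R) : R := expR (- ln (x ^+ 2 + d) / 4).
Definition regI (d x : R) : R := 2 * x * reg d x.

Lemma regI_derive (d x : R) : 0 < d ->
  is_derive x 1 (regI d) (2 * reg d x - x ^+ 2 / (x ^+ 2 + d) * reg d x).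
Proof.
move=> d0; have n0 : 0 < x ^+ 2 + d by rewrite ltr_wpDl // sqr_ge0.
have d1 : is_derive x 1 (fun x : R => x ^+ 2 + d) (2 * x).
  have dI := is_derive_id x (1 : R).
  have h1 := is_deriveD (is_deriveM dI dI) (is_derive_cst d x 1).
  have -> : (fun x : R => x ^+ 2 + d) = (id * id + cst d : R -> R).
    by apply/funext => t; rewrite expr2.
  by apply: is_derive_eq h1 _; rewrite addr0 /GRing.scale /=; ring.
have d2 := @is_derive1_comp _ (@ln R) (fun x : R => x ^+ 2 + d) x _ _ (is_derive1_ln n0) d1.
have d3 := is_deriveZ (- 4^-1 : R) d2.
have d4 := @is_derive1_comp _ expR (- 4^-1 \*: (@ln R \o (fun x : R => x ^+ 2 + d))) x
  _ _ (is_derive_expR _) d3.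
have E : expR \o (- 4^-1 \*: (@ln R \o (fun x : R => x ^+ 2 + d))) = reg d.
  by apply/funext => t; rewrite /reg /= /GRing.scale /= mulrC mulrN mulNr.
rewrite E in d4.
have d5 := is_deriveM (is_deriveZ (2 : R) (is_derive_id x (1 : R))) d4.
apply: is_derive_eq d5 _.
have Ex : expR ((- 4^-1 \*: (@ln R \o (fun x : R => x ^+ 2 + d))) x) = reg d x.
  by rewrite -E.
rewrite Ex /GRing.scale /=; move: (reg d x) => r.
have -> : (2 : R) *: (x : R^o) = 2 * x by [].
by field; rewrite gt_eqF.
Qed.

Lemma reg_gt0 (d x : R) : 0 < reg d x.
Proof. exact: expR_gt0. Qed.

Lemma continuous_reg (d : R) : 0 < d -> continuous (reg d).
Proof.
move=> d0 x; have n0 : 0 < x ^+ 2 + d by rewrite ltr_wpDl // sqr_ge0.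
have c1 : {for x, continuous (fun x : R => x ^+ 2 + d)}.
  by apply: cvgD; [exact: exprn_continuous|exact: cvg_cst].
have c2 : {for x, continuous (fun x : R => ln (x ^+ 2 + d))}.
  exact: (continuous_comp c1 (continuous_ln n0)).
have c3 : {for x, continuous (fun x : R => - ln (x ^+ 2 + d) / 4)}.
  by apply: cvgM; [exact: cvgN|exact: cvg_cst].
exact: (continuous_comp c3 (@continuous_expR R _)).
Qed.

Lemma regI_bound (d x : R) : 0 < d -> d <= 1 -> `|regI d x| <= 2 * (x ^+ 2 + 2).
Proof.
move=> d0 d1; have x2 := sqr_ge0 x.
have n0 : 0 < x ^+ 2 + d by lra.
set L := ln (x ^+ 2 + d); have eL : expR L = x ^+ 2 + d by rewrite /L lnK.
have h1 : `|x| <= expR (L / 2).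
  rewrite -ler_sqr ?nnegrE ?expR_ge0 // real_normK ?num_real //.
  rewrite [expR _ ^+ 2]expr2 -expRD -splitr eL; lra.
rewrite /regI /reg -/L normrM normrM (ger0_norm (_ : 0 <= 2)) // -mulrA.
rewrite (ger0_norm (expR_ge0 _)) ler_pM2l //.
apply: (@le_trans _ _ (expR (L / 4))).
  have -> : L / 4 = L / 2 + - L / 4 by field.
  by rewrite expRD ler_wpM2r // expR_ge0.
have [L0|L0] := leP L 0.
  apply: (@le_trans _ _ 1); last by lra.
  by rewrite expR_le1; lra.
apply: (@le_trans _ _ (expR L)); last by rewrite eL; lra.
by rewrite ler_expR; lra.
Qed.

Lemma reg_integral (d B s : R) : 0 < d -> d <= 1 -> 0 < B -> `|s| <= B ->
  (\int[mu]_(x in `[(- B)%R, B]) (reg d (x - s))%:E <= (4 * (4 * B ^+ 2 + 2))%:E)%E.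
Proof.
move=> d0 d1 B0 sB.
pose h (x : R) := 2 * reg d (x - s) - (x - s) ^+ 2 / ((x - s) ^+ 2 + d) * reg d (x - s).
have dH (x : R) : is_derive x 1 (fun x => regI d (x - s)) (h x).
  have := @is_derive1_comp _ (regI d) (fun x => x - s) x _ _ (regI_derive (x - s) d0)
    (is_derive_shift s x).
  by rewrite mulr1.
have cs : continuous (fun x : R => x - s).
  by move=> x; apply: cvgB; [exact: cvg_id|exact: cvg_cst].
have cr : continuous (fun x => reg d (x - s)).
  by move=> x; exact: (@continuous_comp _ _ _ _ (reg d) x (cs x) (@continuous_reg d d0 (x - s))).
have cq : continuous (fun x : R => (x - s) ^+ 2).
  by move=> x; exact: (@continuous_comp _ _ _ _ (fun y : R => y ^+ 2) x (cs x) (@exprn_continuous R 2 (x - s))).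
have ch : continuous h.
  move=> x; apply: cvgB; first by apply: cvgM; [exact: cvg_cst|exact: cr].
  apply: cvgM; last exact: cr.
  apply: cvgM; first exact: cq.
  apply: cvgV; first by rewrite gt_eqF // ltr_wpDl // sqr_ge0.
  by apply: cvgD; [exact: cq|exact: cvg_cst].
have le x : reg d (x - s) <= h x.
  rewrite /h; have r0 := reg_gt0 d (x - s).
  have : (x - s) ^+ 2 / ((x - s) ^+ 2 + d) <= 1.
    by rewrite ler_pdivrMr ?mul1r ?ltr_wpDl ?sqr_ge0 //; lra.
  move: (_ / _) => t t1; rewrite lerBrDr.
  by have := ler_wpM2r (ltW r0) t1; lra.
apply: (@le_trans _ _ (\int[mu]_(x in `[(- B)%R, B]) (h x)%:E)%E).
  apply: ge0_le_integral => //.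
  - by move=> x _; rewrite lee_fin ltW // reg_gt0.
  - by apply/measurable_EFinP; apply: measurable_funTS; exact: continuous_measurable_fun.
  - by apply/measurable_EFinP; apply: measurable_funTS; exact: continuous_measurable_fun.
  - by move=> x _; rewrite lee_fin.
rewrite (@continuous_FTC2 _ h (fun x => regI d (x - s))).
- rewrite -EFinB lee_fin.
  have H (x : R) : `|x| <= 2 * B -> `|regI d x| <= 2 * (4 * B ^+ 2 + 2).
    move=> hx; apply: le_trans (regI_bound x d0 d1) _.
    rewrite ler_pM2l // lerD2r -[x ^+ 2]real_normK ?num_real //.
    have -> : 4 * B ^+ 2 = (2 * B) ^+ 2 by ring.
    by rewrite ler_sqr ?nnegrE //; lra.
  move: sB; rewrite ler_norml => /andP[s1 s2].
  have b1 : `|B - s| <= 2 * B by rewrite ler_norml; apply/andP; split; lra.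
  have b2 : `|- B - s| <= 2 * B by rewrite ler_norml; apply/andP; split; lra.
  move: (H _ b1) (H _ b2); rewrite !ler_norml => /andP[_ h1] /andP[h2 _]; lra.
- lra.
- by apply: continuous_subspaceT => x; exact: ch.
- have cH := is_derive_continuous dH; split.
  + by move=> x _; have [] := dH x.
  + by apply: cvg_at_right_filter; exact: cH.
  + by apply: cvg_at_left_filter; exact: cH.
- by move=> x _; rewrite derive1E; have [_ ->] := dH x.
Qed.

Lemma box_integral (B : R) (h : R -> R) : 0 < B -> measurable_fun setT h -> (forall x, 0 <= h x) ->
  (\int[area]_(z in box B) (h z.1)%:E = (2 * B)%:E * \int[mu]_(x in `[(- B)%R, B]) (h x)%:E)%E.
Proof.
move=> B0 mh h0; rewrite integral_mkcond.
pose f : P2 -> \bar R := (fun z : R * R => (h z.1)%:E) \_ (box B).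
have mf : measurable_fun [set: P2] f.
  apply/(measurable_restrictT _ (measurable_box B)); apply: measurable_funTS.
  by apply/measurable_EFinP; exact: measurableT_comp.
have f0 z : (0 <= f z)%E.
  by rewrite /f patchE; case: ifP => // _; rewrite lee_fin.
have := @fubini_tonelli1 _ _ _ _ _ mu mu f mf f0.
rewrite -/(@area R) => ->.
rewrite [in RHS]integral_mkcond -ge0_integralZl //.
- apply: eq_integral => x _; rewrite /fubini_F patchE; case: ifPn => xB.
    have -> : (fun y => f (x, y)) = (cst (h x)%:E) \_ `[(- B), B].
      apply/funext => y; rewrite /f !patchE; congr (if _ then _ else _).
      rewrite inE in xB; apply/idP/idP => yB; apply/mem_set.
        by have [] : box B (x, y) by exact: set_mem.
      by split => //; exact: set_mem.
    rewrite -integral_mkcond integral_cst //.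
    have M : mu `[(- B), B] = (2 * B)%:E.
      rewrite lebesgue_measure_itv /= lte_fin ifT; last lra.
      by rewrite -EFinB; congr (_%:E); ring.
    by rewrite muleC; congr (_ * _)%E; exact: M.
  rewrite mule0 integral0_eq // => y _; rewrite /f patchE ifF //.
  by apply/negbTE; rewrite notin_setE => -[/= hx _]; rewrite notin_setE /= in xB.
- apply/(measurable_restrictT _ (measurable_itv `[(- B), B])).
  by apply: measurable_funTS; exact/measurable_EFinP.
- by move=> x _; rewrite patchE; case: ifP => // _; rewrite lee_fin.
- by rewrite lee_fin; lra.
Qed.

(** Truncating at exp k is dominated by regularizing at d = exp (- 4 k), and the
    distance by one of its coordinates. *)
Lemma nu_trunc (a z : R * R) (k : nat) :
  Num.min (nu a z) (expR k%:R) <= 2 * reg (expR (- (4 * k%:R))) (z.1 - a.1).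
Proof.
set d := expR (- (4 * k%:R)); have d0 : 0 < d by exact: expR_gt0.
set x := z.1 - a.1; have x2 := sqr_ge0 x; have N0 := sqd_ge0 a z.
have xs : x ^+ 2 <= sqd a z by rewrite /sqd lerDl sqr_ge0.
have n0 : 0 < x ^+ 2 + d by lra.
have l2 : ln 2 / 4 <= (ln 2 : R) by have := @ln_ge0 R 2 ltac:(lra); lra.
have key (y t : R) : 0 < y -> x ^+ 2 + d <= 2 * y -> t = expR (- ln y / 4) ->
    t <= 2 * reg d x.
  move=> y0 h ->; rewrite -[2 in leRHS](@lnK R) ?posrE // -expRD ler_expR.
  have : ln (x ^+ 2 + d) <= ln 2 + ln y.
    by rewrite -lnM ?posrE // ler_ln ?posrE // mulr_gt0.
  by lra.
have [h|h] := leP d (sqd a z).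
  rewrite ge_min; apply/orP; left.
  have s0 : 0 < sqd a z by lra.
  exact: (key (sqd a z) (nu a z) s0 ltac:(lra) erefl).
rewrite ge_min; apply/orP; right.
apply: (key d (expR k%:R) d0); first lra.
have -> : ln d = - (4 * k%:R) by rewrite /d expRK.
by congr expR; field.
Qed.

(** The truncations increase to [nu], and each of them has a bound that
    integrates in one variable only. *)
Lemma nu_integral (B : R) : 0 < B -> exists2 T, 0 <= T & forall a, box B a ->
  (\int[area]_(z in box B) (nu a z)%:E <= T%:E)%E.
Proof.
move=> B0; pose T := 2 * B * (2 * (4 * (4 * B ^+ 2 + 2))).
have B2 : 0 <= B ^+ 2 by exact: sqr_ge0.
exists T; first by rewrite /T !mulr_ge0 //; lra.
move=> a /= [a1 a2].
pose f (k : nat) (z : P2) : \bar R := (Num.min (nu a z) (expR k%:R))%:E.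
have mf k : measurable_fun (box B) (f k).
  apply/measurable_EFinP; apply: measurable_funTS; apply: measurable_minr.
    exact: measurable_nu1.
  exact: measurable_cst.
have f0 k z : box B z -> (0 <= f k z)%E.
  by move=> _; rewrite lee_fin le_min nu_ge0 expR_ge0.
have nd z : box B z -> {homo f^~ z : n m / (n <= m)%N >-> (n <= m)%E}.
  move=> _ n m nm; rewrite lee_fin le_min ge_min lexx /= ge_min (@ler_expR R n%:R m%:R) ler_nat nm.
  by rewrite orbT.
have E z : limn (f^~ z) = (nu a z)%:E.
  apply/cvg_lim => //; apply: cvg_near_cst; near=> n.
  rewrite /f min_l //; apply: (@le_trans _ _ (n%:R)).
    by near: n; exact: nbhs_infty_ger.
  by apply: le_trans (expR_ge1Dx _); rewrite lerDr.
have -> : (\int[area]_(z in box B) (nu a z)%:E)%E =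
    (\int[area]_(z in box B) limn (f^~ z))%E by apply: eq_integral => z _; rewrite E.
have C := cvg_monotone_convergence (mu := @area R) (measurable_box B) mf f0 nd.
rewrite -(cvg_lim _ C) //; apply: lime_le; first by apply/cvg_ex; eexists; exact: C.
apply: nearW => k.
set d : R := expR (- (4 * k%:R)).
have d0 : 0 < d by exact: expR_gt0.
have d1 : d <= 1 by rewrite /d expR_le1 oppr_le0 mulr_ge0.
have cr : continuous (fun x : R => 2 * reg d (x - a.1)).
  move=> x; apply: cvgM; first exact: cvg_cst.
  have cs : {for x, continuous (fun x : R => x - a.1)}.
    by apply: cvgB; [exact: cvg_id|exact: cvg_cst].
  exact: (@continuous_comp _ _ _ _ (reg d) x cs (@continuous_reg d d0 (x - a.1))).
have mr : measurable_fun setT (fun x : R => 2 * reg d (x - a.1)).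
  exact: continuous_measurable_fun.
have r0 x : 0 <= 2 * reg d (x - a.1) by rewrite mulr_ge0 // ltW // reg_gt0.
apply: (@le_trans _ _ (\int[area]_(z in box B) (2 * reg d (z.1 - a.1))%:E)%E).
  apply: ge0_le_integral => //.
  - exact: measurable_box.
  - exact: f0.
  - apply/measurable_EFinP; apply: measurable_funTS.
    exact: (@measurableT_comp _ _ _ _ _ _ _ _ fst mr).
  - by move=> z _; rewrite lee_fin; exact: nu_trunc.
rewrite (box_integral B0 mr r0) /T (EFinM (2 * B) (2 * (4 * (4 * B ^+ 2 + 2)))) lee_pmul2l ?lte_fin //; last by lra.
have -> : (\int[mu]_(x in `[(- B)%R, B]) (2 * reg d (x - a.1))%:E =
   2%:E * \int[mu]_(x in `[(- B)%R, B]) (reg d (x - a.1))%:E)%E.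
  rewrite -ge0_integralZl //.
  - apply/measurable_EFinP; apply: measurable_funTS; apply: continuous_measurable_fun => x.
    have cs : {for x, continuous (fun x : R => x - a.1)}.
      by apply: cvgB; [exact: cvg_id|exact: cvg_cst].
    exact: (@continuous_comp _ _ _ _ (reg d) x cs (@continuous_reg d d0 (x - a.1))).
  - by move=> x _; rewrite lee_fin ltW // reg_gt0.
rewrite (EFinM 2 (4 * (4 * B ^+ 2 + 2))) lee_pmul2l ?lte_fin //.
by apply: reg_integral => //; move: a1; rewrite /= in_itv /= -ler_norml.
Unshelve. all: by end_near. Qed.

End Kernel.

(** * Square integrability, uniformly in the pole *)

Section KernelBounds.
Set Implicit Arguments.
Unset Strict Implicit.
Context {R : realType}.
Local Notation P2 := (measurableTypeR R * measurableTypeR R)%type.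
Implicit Types (a z : R * R).

Lemma normM_le_sqr (x y : R) : `|x| * `|y| <= x ^+ 2 + y ^+ 2.
Proof.
rewrite -[x ^+ 2]real_normK ?num_real // -[y ^+ 2]real_normK ?num_real //.
move: `|x| `|y| (normr_ge0 x) (normr_ge0 y) => s t s0 t0.
have : 0 <= (s - t) ^+ 2 by exact: sqr_ge0.
have -> : (s - t) ^+ 2 = s ^+ 2 + t ^+ 2 - 2 * (s * t) by ring.
by have := mulr_ge0 s0 t0; lra.
Qed.

(** A common majorant of |G a| and of its square, cut off to a box that contains
    D. *)
Definition kB (c B : R) a z : R := c * (1 + nu a z) * \1_(box B) z.

Lemma kB_ge0 c B a z : 0 <= c -> 0 <= kB c B a z.
Proof. by move=> c0; rewrite /kB !mulr_ge0 // ?addr_ge0 // nu_ge0. Qed.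

Lemma kB_box c B a z : box B z -> kB c B a z = c * (1 + nu a z).
Proof. by move=> h; rewrite /kB indicE mem_set // mulr1. Qed.

Lemma measurable_kB c B :
  measurable_fun [set: P2 * P2] (fun q : P2 * P2 => kB c B q.1 q.2).
Proof.
apply: measurable_funM.
  apply: measurable_funM; first exact: measurable_cst.
  by apply: measurable_funD; [exact: measurable_cst|exact: measurable_nu].
apply: (@measurableT_comp _ _ _ _ _ _ (\1_(box B) : P2 -> R) _ snd) => //.
apply: measurable_indic; exact: measurable_box.
Qed.

Lemma measurable_kB1 c B a : measurable_fun [set: P2] (kB c B a).
Proof.
have -> : kB c B a = (fun q : P2 * P2 => kB c B q.1 q.2) \o (pair (a : P2)).
  by apply/funext => z.
apply: measurableT_comp; first exact: measurable_kB.
exact: pair1_measurable.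
Qed.

Lemma kB_integral c B : 0 <= c -> 0 < B -> exists2 M, 0 <= M & forall a, box B a ->
  (\int[area]_z (kB c B a z)%:E <= M%:E)%E.
Proof.
move=> c0 B0; have [T T0 HT] := @nu_integral R B B0.
have mB := @measurable_box R B.
pose A := fine (area (box B)).
have AE : area (box B) = A%:E.
  rewrite /A fineK // ge0_fin_numE //; exact: area_box.
have A0 : 0 <= A by exact: fine_ge0.
exists (c * (A + T)); first by rewrite mulr_ge0 // addr_ge0.
move=> a Ba.
have -> : (\int[area]_z (kB c B a z)%:E = \int[area]_(z in box B) (c%:E * ((1 + nu a z)%:E)))%E.
  rewrite [RHS]integral_mkcond; apply: eq_integral => z _.
  rewrite patchE; case: (pselect (box B z)) => zB.
    by rewrite mem_set // kB_box.
  by rewrite memNset // /kB indicE memNset // mulr0.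
have m1 : measurable_fun (box B) (fun z : P2 => (1 + nu a z)%:E).
  apply/measurable_EFinP; apply: measurable_funTS; apply: measurable_funD.
    exact: measurable_cst.
  exact: measurable_nu1.
rewrite ge0_integralZl //; last by move=> z _; rewrite lee_fin addr_ge0 // nu_ge0.
rewrite EFinM lee_wpmul2l ?lee_fin //.
have -> : (\int[area]_(z in box B) (1 + nu a z)%:E = \int[area]_(z in box B) (1%:E + (nu a z)%:E))%E.
  by apply: eq_integral => z _; rewrite EFinD.
rewrite ge0_integralD //.
- rewrite integral_cst // mul1e AE EFinD leeD //; exact: HT.
- by move=> z _; rewrite lee_fin nu_ge0.
- by apply/measurable_EFinP; apply: measurable_funTS; exact: measurable_nu1.
Qed.

Lemma kB_sym c B a z : box B a -> box B z -> kB c B a z = kB c B z a.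
Proof. by move=> Ba Bz; rewrite !kB_box // nu_sym. Qed.

(** For s = sqd a z, - log s = 8 log (s^(-1/8)) <= 8 s^(-1/8), and the square of
    s^(-1/8) is [nu]. *)
Lemma Lam_nu (C : R) a z : 0 <= C -> Lam a (- C) z <= 0 ->
  (Lam a (- C) z) ^+ 2 <= (1 + 2 * C ^+ 2 + 2 * (8 * kap) ^+ 2) * (1 + nu a z).
Proof.
move=> C0 L0.
set m := expR (- ln (sqd a z) / 8); have m0 : 0 < m by exact: expR_gt0.
have mm : nu a z = m ^+ 2.
  by rewrite /nu /m expr2 -expRD; congr expR; field.
have k0 := @kap_gt0 R.
have h : - Lam a (- C) z <= C + 8 * kap * m.
  have h1 := expR_ge1Dx (- ln (sqd a z) / 8); rewrite -/m in h1.
  have -> : - Lam a (- C) z = C + kap * - ln (sqd a z) by rewrite /Lam; ring.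
  have -> : 8 * kap * m = kap * (8 * m) by ring.
  by rewrite lerD2l ler_pM2l //; lra.
have -> : Lam a (- C) z ^+ 2 = (- Lam a (- C) z) ^+ 2 by rewrite sqrrN.
have q0 : 0 <= 8 * kap * m by rewrite !mulr_ge0 // ltW.
apply: (@le_trans _ _ ((C + 8 * kap * m) ^+ 2)).
  by rewrite ler_sqr ?nnegrE //; lra.
rewrite mm; move: (8 * kap) q0 => k q0.
have c2 : 0 <= C ^+ 2 by exact: sqr_ge0.
have k2 : 0 <= k ^+ 2 by exact: sqr_ge0.
have m2 : 0 <= m ^+ 2 by exact: sqr_ge0.
have h2 : 0 <= (C - k * m) ^+ 2 by exact: sqr_ge0.
have h3 := mulr_ge0 c2 m2; have h4 := mulr_ge0 k2 m2.
rewrite -subr_ge0.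
have -> : (1 + 2 * C ^+ 2 + 2 * k ^+ 2) * (1 + m ^+ 2) - (C + k * m) ^+ 2 =
  (C - k * m) ^+ 2 + (1 + m ^+ 2 + 2 * (C ^+ 2 * m ^+ 2) + 2 * k ^+ 2) by ring.
by lra.
Qed.

Section Green.
Variables (D : set (R * R)) (g : R * R -> R * R -> \bar R).
Hypotheses (oD : open D) (bD : bounded_set D) (cD : connected D)
  (hg : green_function D g).
Local Notation G := (gam D g).

Lemma gam_kB : exists c B, [/\ 0 <= c, 0 < B, D `<=` box B & forall a z, D a ->
   `|G a z| <= kB c B a z /\ G a z ^+ 2 <= kB c B a z].
Proof.
have [C C0 HC] := gam_lower oD bD hg.
have [B B0 DB] := bounded_box bD.
pose c1 := 1 + 2 * C ^+ 2 + 2 * (8 * @kap R) ^+ 2.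
have c10 : 1 <= c1.
  have h1 : 0 <= C ^+ 2 by exact: sqr_ge0.
  have h2 : 0 <= (8 * @kap R) ^+ 2 by exact: sqr_ge0.
  by rewrite /c1; lra.
exists (1 + c1), B; split => //; first by lra.
move=> a z Da.
have k0 : 0 <= kB (1 + c1) B a z by apply: kB_ge0; lra.
case: (pselect ((D `\ a) z)) => Ez; last first.
  by rewrite gam_off // normr0 expr0n /=.
have Dz : D z by case: Ez.
have /andP[h1 h2] := HC a z Da Ez.
have n0 := nu_ge0 a z.
have sq : G a z ^+ 2 <= c1 * (1 + nu a z).
  apply: le_trans (@Lam_nu C a z C0 (le_trans h1 h2)); rewrite -[leLHS]sqrrN -[leRHS]sqrrN ler_sqr ?nnegrE //; lra.
have sq' : G a z ^+ 2 <= kB (1 + c1) B a z.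
  by rewrite kB_box; [lra|exact: DB].
split => //; rewrite kB_box; last exact: DB.
have q2 : `|G a z| <= 1 + G a z ^+ 2.
  have : 0 <= (`|G a z| - 1) ^+ 2 by exact: sqr_ge0.
  rewrite sqrrB1 real_normK ?num_real // => q1.
  have q3 : 0 <= `|G a z| by exact: normr_ge0.
  by move: q1 q3; rewrite -mulr_natl; lra.
apply: le_trans q2 _; rewrite mulrDl; lra.
Qed.

End Green.

Lemma area_sigma_finite : sigma_finite [set: P2] (@area R).
Proof.
exists (fun n => box n%:R).
  apply/seteqP; split => // z _.
  have [B B0 HB] := @bounded_box R [set z] (compact_bounded (@compact_set1 _ z)).
  have [n nB] : exists n : nat, B <= n%:R.
    by exists (Num.trunc B).+1; rewrite ltW // Num.Theory.truncnS_gt.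
  exists n => //; have [/=] := HB z erefl; rewrite !in_itv /= => /andP[h1 h2] /andP[h3 h4].
  by split; rewrite /= in_itv /=; apply/andP; split; lra.
by move=> n; split; [exact: measurable_box|exact: area_box].
Qed.

(** The measure [area] with its sigma-finiteness, as required by Tonelli's
    theorem. *)
Definition sfarea : {sigma_finite_measure set P2 -> \bar R} := HB.pack_for {sigma_finite_measure set P2 -> \bar R} (Measure.sort (@area R)) (@Measure.class _ _ _ (@area R)) (@Measure_isSigmaFinite.Build _ _ _ (@area R) area_sigma_finite).

Lemma area_swap (F : P2 * P2 -> \bar R) : measurable_fun setT F -> (forall x, (0 <= F x)%E) ->
  (\int[area]_x \int[area]_y F (x, y) = \int[area]_y \int[area]_x F (x, y))%E /\
  measurable_fun setT (fun x => \int[area]_y F (x, y))%E.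
Proof.
move=> mF F0; split.
  exact: (@fubini_tonelli _ _ _ _ _ sfarea sfarea F mF F0).
exact: (@measurable_fun_fubini_tonelli_F _ _ _ _ _ sfarea F mF F0).
Qed.

End KernelBounds.

(** * Integration against the Green function *)

Section KernelOperator.
Set Implicit Arguments.
Unset Strict Implicit.
Context {R : realType}.
Local Notation P2 := (measurableTypeR R * measurableTypeR R)%type.
Variables (D : set (R * R)) (G : R * R -> R * R -> R) (c B M : R).
Hypotheses (DB : D `<=` box B) (c0 : 0 <= c) (M0 : 0 <= M)
  (G0 : forall a z, D a -> ~ D z -> G a z = 0)
  (mG : forall a, D a -> measurable_fun [set: P2] (G a))
  (GS : forall a z, D a -> `|G a z| <= kB c B a z /\ G a z ^+ 2 <= kB c B a z)
  (SM : forall a, D a -> (\int[area]_z (kB c B a z)%:E <= M%:E)%E).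
Implicit Types (a z b : R * R) (f : R * R -> R).
Local Notation S := (kB c B).

Let S0 a z : 0 <= S a z. Proof. exact: kB_ge0. Qed.
Let mS a : measurable_fun [set: P2] (EFin \o S a).
Proof. by apply/measurable_EFinP; exact: measurable_kB1. Qed.

Lemma kB_integrable a : D a -> area.-integrable setT (EFin \o S a).
Proof.
move=> Da; apply/integrableP; split; first exact: mS.
apply: le_lt_trans (ltry M); apply: le_trans (SM Da).
by rewrite le_eqVlt; apply/orP; left; apply/eqP; apply: eq_integral => z _ /=;
  rewrite ger0_norm.
Qed.

Lemma dominated_bound f h (K : R) : measurable_fun [set: P2] f ->
  (forall z, `|f z| <= h z) -> area.-integrable setT (EFin \o h) ->
  (\int[area]_z (h z)%:E <= K%:E)%E ->
  area.-integrable setT (EFin \o f) /\ `|intp f| <= K.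
Proof.
move=> mf fh ih hK.
have i : area.-integrable setT (EFin \o f).
  apply: (le_integrable measurableT _ _ ih); first exact/measurable_EFinP.
  by move=> z _ /=; rewrite lee_fin (le_trans (fh z)) // ler_norm.
split => //; apply: (le_trans (le_normr_Rintegral measurableT i)).
apply: (@le_trans _ _ (intp h)).
  by apply: le_Rintegral => //; exact: (integrable_norm i).
rewrite -lee_fin /intp /Rintegral fineK //.
exact: (integrable_fin_num measurableT ih).
Qed.

Lemma operator_bounded f z (m : R) : D z -> measurable_fun [set: P2] f -> 0 <= m ->
  (forall y, `|f y| <= m) ->
  area.-integrable setT (EFin \o (fun y => f y * G z y)) /\
  `|intp (fun y => f y * G z y)| <= m * M.
Proof.
move=> Dz mf m0 fm.
apply: (@dominated_bound _ (fun y => m * S z y)).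
- by apply: measurable_funM => //; exact: mG.
- move=> y; rewrite normrM; apply: ler_pM => //; exact: (GS y Dz).1.
- exact: (integrableZl measurableT m (kB_integrable Dz)).
- rewrite (_ : (\int[area]_y (m * S z y)%:E)%E = (m%:E * \int[area]_y (S z y)%:E)%E).
    by rewrite EFinM lee_wpmul2l ?lee_fin //; exact: SM.
  by rewrite -ge0_integralZl //; [exact: mS|move=> y _; rewrite lee_fin].
Qed.

Lemma green_product a b y : D a -> D b -> `|G b y| * `|G a y| <= S b y + S a y.
Proof.
move=> Da Db; apply: le_trans (normM_le_sqr _ _) _.
by apply: lerD; [exact: (GS y Db).2|exact: (GS y Da).2].
Qed.

Let SD_int a b : D a -> D b -> area.-integrable setT (EFin \o (fun y => S b y + S a y)) /\
  (\int[area]_y (S b y + S a y)%:E <= (2 * M)%:E)%E.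
Proof.
move=> Da Db; split.
  exact: (integrableD measurableT (kB_integrable Db) (kB_integrable Da)).
rewrite (_ : (\int[area]_y _)%E = (\int[area]_y (S b y)%:E + \int[area]_y (S a y)%:E)%E).
  by rewrite mulr2n mulrDl mul1r EFinD leeD //; exact: SM.
rewrite -ge0_integralD //.
- by move=> y _; rewrite lee_fin.
- exact: mS.
- by move=> y _; rewrite lee_fin.
- exact: mS.
Qed.

(** Here f may be as singular as G b: products of two Green functions are
    integrable, uniformly in both poles. *)
Lemma operator_green f z b (m : R) : D z -> D b -> measurable_fun [set: P2] f -> 0 <= m ->
  (forall y, `|f y| <= m * `|G b y|) ->
  area.-integrable setT (EFin \o (fun y => f y * G z y)) /\
  `|intp (fun y => f y * G z y)| <= m * (2 * M).
Proof.
move=> Dz Db mf m0 fm; have [i1 i2] := SD_int Dz Db.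
apply: (@dominated_bound _ (fun y => m * (S b y + S z y))).
- by apply: measurable_funM => //; exact: mG.
- move=> y; rewrite normrM.
  apply: (@le_trans _ _ (m * (`|G b y| * `|G z y|))).
    by rewrite mulrA; apply: ler_wpM2r.
  by rewrite ler_wpM2l // green_product.
- exact: (integrableZl measurableT m i1).
- rewrite (_ : (\int[area]_y (m * (S b y + S z y))%:E)%E =
     (m%:E * \int[area]_y (S b y + S z y)%:E)%E).
    by rewrite EFinM lee_wpmul2l ?lee_fin.
  rewrite -ge0_integralZl //.
    apply/measurable_EFinP; apply: measurable_funD; exact: measurable_kB1.
  by move=> y _; rewrite lee_fin addr_ge0.
Qed.

Let measurable_absM (U : R * R -> R) a : D a -> measurable_fun [set: P2] U ->
  measurable_fun [set: P2] (fun y => (`|U y * G a y|)%:E).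
Proof.
move=> Da mU; apply/measurable_EFinP.
apply: (measurableT_comp (@normr_measurable R setT)).
exact: (measurable_funM mU (mG Da)).
Qed.

Let measurable_abs (U : R * R -> R) : measurable_fun [set: P2] U ->
  measurable_fun [set: P2] (fun y => (`|U y|)%:E).
Proof.
move=> mU; apply/measurable_EFinP.
exact: (measurableT_comp (@normr_measurable R setT) mU).
Qed.

Let F (U : R * R -> R) z (q : P2 * P2) : \bar R := (`|U q.2| * (S q.2 q.1 + S z q.1))%:E.
Let Phi (U : R * R -> R) z (x : P2) := (\int[area]_y F U z (x, y))%E.

Let mF U z : measurable_fun [set: P2] U -> measurable_fun setT (F U z).
Proof.
move=> mU; apply/measurable_EFinP.
have msw : measurable_fun [set: P2 * P2] (fun q : P2 * P2 => (q.2, q.1)).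
  by apply: measurable_fun_pair; [exact: measurable_snd|exact: measurable_fst].
have m1 : measurable_fun [set: P2 * P2] (fun q : P2 * P2 => `|U q.2|).
  apply: (measurableT_comp (@normr_measurable R setT)).
  exact: (measurableT_comp mU measurable_snd).
have m2 : measurable_fun [set: P2 * P2] (fun q : P2 * P2 => S q.2 q.1).
  exact: (measurableT_comp (@measurable_kB R c B) msw).
have m3 : measurable_fun [set: P2 * P2] (fun q : P2 * P2 => S z q.1).
  exact: (measurableT_comp (@measurable_kB1 R c B z) measurable_fst).
exact: (measurable_funM m1 (measurable_funD m2 m3)).
Qed.

Let F0 U z q : (0 <= F U z q)%E.
Proof. by rewrite lee_fin mulr_ge0 // addr_ge0. Qed.

Let Phi_pointwise (U : R * R -> R) z x : D z -> measurable_fun [set: P2] U ->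
  (forall y, ~ D y -> U y = 0) -> D x ->
  (\int[area]_y (`|U y * G x y|)%:E * (`|G z x|)%:E <= Phi U z x)%E.
Proof.
move=> Dz mU U0 Dx.
have mA := measurable_absM Dx mU.
have A0 y : [set: P2] y -> (0 <= (`|U y * G x y|)%:E)%E by move=> _; rewrite lee_fin.
have c1 : (0 <= (`|G z x|)%:E)%E by rewrite lee_fin.
rewrite -(ge0_integralZr (@area R) measurableT mA A0 c1).
have h1 y : [set: P2] y -> (0 <= (`|U y * G x y|)%:E * (`|G z x|)%:E)%E.
  by move=> _; rewrite -EFinM lee_fin mulr_ge0.
have h2 : measurable_fun [set: P2] (fun y => (`|U y * G x y|)%:E * (`|G z x|)%:E)%E.
  by apply: (emeasurable_funM mA); exact: measurable_cst.
have h3 : measurable_fun [set: P2] (fun y => F U z (x, y)).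
  exact: (measurableT_comp (mF z mU) (pair1_measurable (x : P2))).
apply: (ge0_le_integral (@area R) measurableT h1 h2 h3).
move=> y _; rewrite /F /= -EFinM lee_fin normrM -mulrA.
case: (pselect (D y)) => Dy; last by rewrite (U0 y Dy) normr0 !mul0r.
apply: ler_wpM2l => //; rewrite (kB_sym _ (DB Dy) (DB Dx)).
apply: le_trans (normM_le_sqr _ _) _.
by apply: lerD; [exact: (GS y Dx).2|exact: (GS x Dz).2].
Qed.

Let Phi_integral (U : R * R -> R) z : D z -> measurable_fun [set: P2] U ->
  (forall y, ~ D y -> U y = 0) ->
  (\int[area]_x Phi U z x <= (2 * M)%:E * \int[area]_y (`|U y|)%:E)%E.
Proof.
move=> Dz mU U0.
have [sw _] := area_swap (mF z mU) (F0 U z).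

have msw : measurable_fun [set: P2 * P2] (fun q : P2 * P2 => (q.2, q.1)).
  by apply: measurable_fun_pair; [exact: measurable_snd|exact: measurable_fst].
have mF2 : measurable_fun setT (fun q : P2 * P2 => F U z (q.2, q.1)).
  exact: (measurableT_comp (mF z mU) msw).
have [_ h2] := area_swap mF2 (fun q => F0 U z (q.2, q.1)).
have mA := measurable_abs mU.
have A0 y : [set: P2] y -> (0 <= (`|U y|)%:E)%E by move=> _; rewrite lee_fin.
have c2 : (0 <= (2 * M)%:E)%E by rewrite lee_fin mulr_ge0.
rewrite /Phi sw -(ge0_integralZl (@area R) measurableT mA A0 c2).
have h1 y : [set: P2] y -> (0 <= \int[area]_x F U z (x, y))%E.
  by move=> _; apply: integral_ge0 => x _; exact: F0.
have h3 : measurable_fun [set: P2] (fun y => (2 * M)%:E * (`|U y|)%:E)%E.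
  by apply: emeasurable_funM; [exact: measurable_cst|exact: mA].
apply: (ge0_le_integral (@area R) measurableT h1 h2 h3).
move=> y _; case: (pselect (D y)) => Dy; last first.
  rewrite (U0 y Dy) normr0 mule0 integral0_eq => [|x _]; first exact: lexx.
  by rewrite /F /= (U0 y Dy) normr0 mul0r.
have mSS : measurable_fun [set: P2] (fun x => (S y x + S z x)%:E).
  apply/measurable_EFinP.
  exact: (measurable_funD (@measurable_kB1 R c B y) (@measurable_kB1 R c B z)).
have SS0 x : [set: P2] x -> (0 <= (S y x + S z x)%:E)%E.
  by move=> _; rewrite lee_fin addr_ge0.
have u0 : (0 <= (`|U y|)%:E)%E by rewrite lee_fin.
rewrite (_ : (\int[area]_x F U z (x, y))%E = ((`|U y|)%:E * \int[area]_x (S y x + S z x)%:E)%E).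
  rewrite [X in (_ <= X)%E]muleC; exact: (lee_wpmul2l u0 (SD_int Dz Dy).2).
by rewrite -(ge0_integralZl (@area R) measurableT mSS SS0 u0).
Qed.

(** By Tonelli the integral in x can be done first; there |G x y| |G z x| <= S x
    y + S z x, with an integral at most 2 M. *)
Lemma double_green (U e : R * R -> R) z (Q N : R) : D z -> measurable_fun [set: P2] U ->
  (forall y, ~ D y -> U y = 0) -> 0 <= Q -> (\int[area]_y (`|U y|)%:E)%E = N%:E ->
  measurable_fun [set: P2] e ->
  (forall x, D x -> ((`|e x|)%:E <= Q%:E * \int[area]_y (`|U y * G x y|)%:E)%E) ->
  (\int[area]_x (`|e x * G z x|)%:E <= (Q * (2 * M * N))%:E)%E.
Proof.
move=> Dz mU U0 Q0 UN me eU.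
have [_ mPhi] := area_swap (mF z mU) (F0 U z).
have P0 x : [set: P2] x -> (0 <= Phi U z x)%E.
  by move=> _; apply: integral_ge0 => y _; exact: (F0 U z (x, y)).
have Q0' : (0 <= Q%:E)%E by rewrite lee_fin.
apply: (@le_trans _ _ (\int[area]_x (Q%:E * Phi U z x))%E).
  have h1 x : [set: P2] x -> (0 <= (`|e x * G z x|)%:E)%E by move=> _; rewrite lee_fin.
  have h3 : measurable_fun [set: P2] (fun x => Q%:E * Phi U z x)%E.
    by apply: emeasurable_funM; [exact: measurable_cst|exact: mPhi].
  apply: (ge0_le_integral (@area R) measurableT h1 (measurable_absM Dz me) h3).
  move=> x _; case: (pselect (D x)) => Dx; last first.
    by rewrite (G0 Dz Dx) mulr0 normr0 mule_ge0 //; exact: P0.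
  rewrite normrM EFinM.
  apply: (@le_trans _ _ (Q%:E * \int[area]_y (`|U y * G x y|)%:E * (`|G z x|)%:E)%E).
    by rewrite lee_wpmul2r ?lee_fin //; exact: eU.
  by rewrite -muleA lee_wpmul2l //; exact: Phi_pointwise.
rewrite (ge0_integralZl (@area R) measurableT mPhi P0 Q0') EFinM lee_wpmul2l //.
by apply: (le_trans (Phi_integral Dz mU U0)); rewrite UN.
Qed.

(** U is only known to be integrable. Inserting the integral equation into its
    own right-hand side leaves, besides a product of two Green functions, the
    integral of |U| against products of two Green functions in an intermediate
    variable, to which [double_green] applies. *)
Lemma apriori_bound (U q : R * R -> R) w (Q : R) : D w -> measurable_fun [set: P2] U ->
  (forall y, ~ (D `\ w) y -> U y = G w y) -> (forall y, ~ D y -> U y = 0) ->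
  area.-integrable setT (EFin \o U) ->
  (forall y, `|q y| <= Q) ->
  (forall z, (D `\ w) z -> area.-integrable setT (EFin \o (fun y => U y * q y * G z y)) /\
      U z = G w z + intp (fun y => U y * q y * G z y)) ->
  exists2 m, 0 <= m & forall z, `|U z - G w z| <= m.
Proof.
move=> Dw mU Uw U0 iU qQ rep.
have Q0 : 0 <= Q by exact: le_trans (normr_ge0 _) (qQ w).
pose N := fine (\int[area]_y (`|U y|)%:E)%E.
have UN : (\int[area]_y (`|U y|)%:E)%E = N%:E.
  by rewrite fineK //; exact: (integrable_fin_num measurableT (integrable_norm iU)).
have N0 : 0 <= N by apply: fine_ge0; apply: integral_ge0 => y _; rewrite lee_fin.
pose e z := U z - G w z.
have me : measurable_fun [set: P2] e by exact: (measurable_funB mU (mG Dw)).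
have eU x : D x -> ((`|e x|)%:E <= Q%:E * \int[area]_y (`|U y * G x y|)%:E)%E.
  move=> Dx; case: (pselect ((D `\ w) x)) => Ex; last first.
    rewrite /e Uw // subrr normr0 mule_ge0 ?lee_fin //.
    by apply: integral_ge0 => y _; rewrite lee_fin.
  have [i E] := rep x Ex.
  rewrite /e {1}E addrAC subrr add0r.
  have fi := integrable_fin_num measurableT i.
  have -> : (`|intp (fun y => U y * q y * G x y)|)%:E =
      `|\int[area]_y (U y * q y * G x y)%:E|%E.
    by rewrite /intp /Rintegral -abse_EFin fineK.
  have mi : measurable_fun [set: P2] (EFin \o (fun y => U y * q y * G x y)).
    exact: measurable_int i.
  apply: (le_trans (le_abse_integral (@area R) measurableT mi)).
  have mA := measurable_absM Dx mU.
  have A0 y : [set: P2] y -> (0 <= (`|U y * G x y|)%:E)%E by move=> _; rewrite lee_fin.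
  have Q0' : (0 <= Q%:E)%E by rewrite lee_fin.
  rewrite -(ge0_integralZl (@area R) measurableT mA A0 Q0').
  have h1 y : [set: P2] y -> (0 <= `|(EFin \o (fun y => (U y * q y * G x y)%R)) y|)%E by [].
  have h2 : measurable_fun [set: P2] (fun y => `|(EFin \o (fun y => (U y * q y * G x y)%R)) y|%E).
    exact: (measurableT_comp (@abse_measurable R setT) mi).
  have h3 : measurable_fun [set: P2] (fun y => Q%:E * (`|U y * G x y|)%:E)%E.
    by apply: emeasurable_funM; [exact: measurable_cst|exact: mA].
  apply: (ge0_le_integral (@area R) measurableT h1 h2 h3) => y _ /=.
  rewrite -EFinM lee_fin mulrAC normrM mulrC; apply: ler_wpM2r => //; exact: qQ.
(* first term: product of two Green functions; second term: double integral of
   |U| *)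
pose m := Q * (2 * M + Q * (2 * M * N)).
have m0 : 0 <= m by rewrite /m mulr_ge0 // addr_ge0 // !mulr_ge0.
exists m => // z; case: (pselect ((D `\ w) z)) => Ez; last by rewrite Uw // subrr normr0.
have Dz : D z by case: Ez.
rewrite -lee_fin; apply: (le_trans (eU z Dz)).
rewrite /m EFinM lee_wpmul2l ?lee_fin //.
have h1 y : [set: P2] y -> (0 <= (`|U y * G z y|)%:E)%E by move=> _; rewrite lee_fin.
have g1 y : [set: P2] y -> (0 <= (`|G w y * G z y|)%:E)%E by move=> _; rewrite lee_fin.
have e1 y : [set: P2] y -> (0 <= (`|e y * G z y|)%:E)%E by move=> _; rewrite lee_fin.
have mg1 := measurable_absM Dz (mG Dw); have me1 := measurable_absM Dz me.
have h2 := measurable_absM Dz mU.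
have h3 : measurable_fun [set: P2] (fun y => (`|G w y * G z y|)%:E + (`|e y * G z y|)%:E)%E.
  exact: emeasurable_funD.
apply: (@le_trans _ _ (\int[area]_y ((`|G w y * G z y|)%:E + (`|e y * G z y|)%:E))%E).
  apply: (ge0_le_integral (@area R) measurableT h1 h2 h3) => y _.
  rewrite -EFinD lee_fin; apply: le_trans (ler_normD _ _).
  by rewrite -mulrDl /e addrC subrK.
rewrite (ge0_integralD (@area R) measurableT g1 mg1 e1 me1) EFinD.
apply: leeD; last exact: (double_green Dz mU U0 Q0 UN me eU).
have [iS bS] := SD_int Dz Dw.
apply: le_trans bS.
apply: (ge0_le_integral (@area R) measurableT g1 mg1).
  apply/measurable_EFinP.
  exact: (measurable_funD (@measurable_kB1 R c B w) (@measurable_kB1 R c B z)).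
by move=> y _; rewrite lee_fin normrM; exact: green_product.
Qed.

End KernelOperator.

(** * Measurability of Green potentials *)

Section OperatorMeasurable.
Set Implicit Arguments.
Unset Strict Implicit.
Context {R : realType}.
Local Notation P2 := (measurableTypeR R * measurableTypeR R)%type.
Variables (D : set (R * R)) (G : R * R -> R * R -> R).
Hypotheses (oD : open D)
  (mG : forall a, D a -> measurable_fun [set: P2] (G a))
  (Gle0 : forall a z, D a -> G a z <= 0)
  (cG : forall y z, D z -> y <> z -> {for z, continuous (fun x => G x y)}).
Implicit Types (a z : R * R) (f : R * R -> R).

Lemma sequential_continuity f z : D z ->
  (forall s : nat -> R * R, (forall n, D (s n)) -> s n @[n --> \oo] --> z ->
     f (s n) @[n --> \oo] --> f z) -> {for z, continuous f}.
Proof.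
move=> Dz H; apply: contrapT => nc.
have [e e0 He] : exists2 e : R, 0 < e & ~ \forall y \near z, `|f z - f y| <= e.
  apply: contrapT => h; apply: nc; apply/cvgrPdist_le => e e0.
  by apply: contrapT => h'; apply: h; exists e.
have ex n : exists y, [/\ D y, ball z n.+1%:R^-1 y & e < `|f z - f y|].
  apply: contrapT => h; apply: He.
  have n1 : \forall y \near z, ball z n.+1%:R^-1 y.
    by apply: nbhsx_ballx; rewrite invr_gt0 ltr0n.
  have n2 : \forall y \near z, D y by apply: open_nbhs_nbhs.
  near=> y; rewrite leNgt; apply/negP => h'; apply: h; exists y.
  by split => //; near: y.
have [s Hs] := choice ex.
have sz : s n @[n --> \oo] --> z.
  apply/cvg_ballP => r r0; near=> n.
  have [_ b _] := Hs n; apply: le_ball b.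
  have h : r^-1 <= n.+1%:R.
    apply: (@le_trans _ _ n%:R); last by rewrite ler_nat.
    by near: n; exact: nbhs_infty_ger.
  by rewrite -[leRHS]invrK lef_pV2 // posrE ?invr_gt0 ?ltr0n.
have c := H s (fun n => let: And3 h _ _ := Hs n in h) sz.
have : \forall n \near \oo, `|f z - f (s n)| <= e by exact: (cvgr_dist_le _ _ c _ e0).
move=> [n _ /(_ n (leqnn n)) /=]; have [_ _ h] := Hs n.
by rewrite leNgt h.
Unshelve. all: by end_near. Qed.

Definition green_operator f z : R :=
  if `[< D z >] then intp (fun y => f y * G z y) else 0.

Lemma green_operatorE f z : D z -> green_operator f z = intp (fun y => f y * G z y).
Proof. by rewrite /green_operator => Dz; case: asboolP. Qed.

Let cutG (k : nat) z y : R := Num.max (G z y) (- k%:R).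

Let cutG_bound k z y : D z -> `|cutG k z y| <= k%:R.
Proof.
move=> Dz; have := Gle0 y Dz; rewrite /cutG ler_norml => h.
have k0 : (0 : R) <= k%:R by [].
by rewrite le_max ge_max lexx orbT /=; apply/andP; split; [exact: le_trans k0|lra].
Qed.

Let mcutG k z : D z -> measurable_fun [set: P2] (cutG k z).
Proof.
move=> Dz; apply: (measurable_maxr (mG Dz)); exact: measurable_cst.
Qed.

Let cut_continuous f k z : D z -> measurable_fun [set: P2] f ->
  area.-integrable setT (EFin \o f) ->
  {for z, continuous (fun x => intp (fun y => f y * cutG k x y))}.
Proof.
move=> Dz mf if_; apply: (sequential_continuity Dz) => s Ds sz.
apply: (@dominated_intp _ z (fun n y => f y * cutG k (s n) y) _ (fun y => k%:R * `|f y|)).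
- by move=> n; exact: (measurable_funM mf (mcutG k (Ds n))).
- exact: (measurable_funM mf (mcutG k Dz)).
- exact: (integrableZl measurableT k%:R (integrable_norm if_)).
- move=> n y; rewrite normrM mulrC; apply: ler_wpM2r => //.
  exact: cutG_bound.
- move=> y yz; apply: cvgM; first exact: cvg_cst.
  have c := cvg_comp _ _ sz (cG Dz yz).
  have cm : {for G z y, continuous (fun x : R => Num.max x (- k%:R))}.
    apply: (@continuous_max _ _ (id : R -> R) (cst (- k%:R))).
      exact: cvg_id.
    exact: cvg_cst.
  exact: (cvg_comp _ _ c cm).
Qed.

(** With max(G, - k) instead of G the integral is continuous in the pole, by
    dominated convergence; these integrals converge to the potential as k tends
    to infinity. *)
Lemma green_operator_measurable f : measurable_fun [set: P2] f ->
  area.-integrable setT (EFin \o f) ->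
  (forall z, D z -> area.-integrable setT (EFin \o (fun y => f y * G z y))) ->
  measurable_fun [set: P2] (green_operator f).
Proof.
move=> mf if_ ifG.
pose T k : R * R -> R := (fun z => intp (fun y => f y * cutG k z y)) \_ D.
have mT k : measurable_fun [set: P2] (T k).
  apply/(measurable_restrictT _ (open_measurable_plane oD)).
  by apply: (continuous_measurable_plane oD) => z Dz; exact: cut_continuous.
apply: (measurable_fun_cvg mT) => z _.
rewrite /T; case: (pselect (D z)) => Dz; last first.
  rewrite /green_operator; case: asboolP => // _.
  by apply: cvg_near_cst; apply: nearW => k; rewrite patchE memNset.
rewrite green_operatorE //.
have -> : (fun k => ((fun z => intp (fun y => f y * cutG k z y)) \_ D) z) =
   (fun k => intp (fun y => f y * cutG k z y)).
  by apply/funext => k; rewrite patchE mem_set.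
apply: (@dominated_intp _ z (fun k y => f y * cutG k z y) _ (fun y => `|f y * G z y|)).
- by move=> k; exact: (measurable_funM mf (mcutG k Dz)).
- exact: (measurable_funM mf (mG Dz)).
- exact: (integrable_norm (ifG z Dz)).
- move=> k y; rewrite !normrM; apply: ler_wpM2l => //.
  have h := Gle0 y Dz; have k0 : (0 : R) <= k%:R by [].
  rewrite (ler0_norm h) ler_norml opprK /cutG le_max lexx /= ge_max.
  by apply/andP; split; lra.
- move=> y _; apply: cvg_near_cst; near=> k; congr (_ * _).
  rewrite /cutG max_l // lerNl; near: k; exact: nbhs_infty_ger.
Unshelve. all: by end_near. Qed.

End OperatorMeasurable.

(** * The integral equation of the perturbed Green function *)

Section SchrodingerRepresentation.
Set Implicit Arguments.
Unset Strict Implicit.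
Context {R : realType}.
Local Notation P2 := (measurableTypeR R * measurableTypeR R)%type.
Implicit Types (f : R * R -> R) (a z : R * R).

Lemma integrable_mul_bounded f (h : R * R -> R) (m : R) : area.-integrable setT (EFin \o f) ->
  measurable_fun [set: P2] h -> (forall z, `|h z| <= m) ->
  area.-integrable setT (EFin \o (fun z => f z * h z)).
Proof.
move=> if_ mh hm.
have mf : measurable_fun [set: P2] f by apply/measurable_EFinP; exact: measurable_int if_.
have m0 : 0 <= m by exact: le_trans (normr_ge0 _) (hm (0, 0)).
have i := integrableZl measurableT m (integrable_norm if_).
apply: (le_integrable measurableT _ _ i).
  by apply/measurable_EFinP; exact: (measurable_funM mf mh).
move=> z _ /=; rewrite lee_fin !normrM normr_id (ger0_norm m0) mulrC.
by apply: ler_wpM2r.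
Qed.

Variables (D : set (R * R)) (g : R * R -> R * R -> \bar R).
Hypotheses (oD : open D) (bD : bounded_set D) (cD : connected D)
  (hg : green_function D g).
Local Notation G := (gam D g).

Lemma gam_integrable a : D a -> area.-integrable setT (EFin \o G a).
Proof.
move=> Da; have [c [B [c0 B0 DB GS]]] := gam_kB oD bD hg.
have [M M0 SM] := kB_integral c0 B0.
have i := kB_integrable c0 (fun a Da => SM a (DB a Da)) Da.
apply: (le_integrable measurableT _ _ i).
  by apply/measurable_EFinP; exact: measurable_gam.
move=> z _ /=; rewrite lee_fin; apply: le_trans (GS a z Da).1 (ler_norm _).
Qed.

Variables (w : R * R) (u : R * R -> \bar R) (q : R * R -> R) (Q : R).
Hypotheses (Dw : D w) (uw : u w = -oo%E)
  (cu : {in D `\ w, continuous (fine \o u)})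
  (fu : fundamental_solution D q w u) (vu : vanishes_on_boundary D u)
  (cq : forall z, D z -> {for z, continuous q}) (Qq : forall z, D z -> `|q z| <= Q).

Definition finite_part z : R := if `[< (D `\ w) z >] then fine (u z) else 0.
Local Notation U := finite_part.

Lemma finite_partE z : (D `\ w) z -> U z = fine (u z).
Proof. by rewrite /U => h; case: asboolP. Qed.

Lemma finite_part_off z : ~ (D `\ w) z -> U z = 0.
Proof. by rewrite /U => h; case: asboolP. Qed.

Lemma finite_part_fine z : D z -> U z = fine (u z).
Proof.
move=> Dz; case: (pselect ((D `\ w) z)) => Ez; first exact: finite_partE.
rewrite finite_part_off //; have [->|/eqP zw] := eqVneq z w; first by rewrite uw.
by exfalso; apply: Ez.
Qed.

Let oE : open (D `\ w). Proof. exact: open_punctured. Qed.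

Lemma finite_part_continuous z : (D `\ w) z -> {for z, continuous U}.
Proof.
move=> Ez; apply: (@continuous_near _ (fine \o u)); last by apply: cu; rewrite inE.
by have := near_punctured oD Ez; apply: filterS => y Ey; rewrite finite_partE.
Qed.

Lemma measurable_finite_part : measurable_fun [set: P2] U.
Proof.
have -> : U = U \_ (D `\ w).
  apply/funext => z; rewrite patchE; case: ifPn => //.
  by rewrite notin_setE => /finite_part_off ->.
apply/(measurable_restrictT _ (open_measurable_plane oE)).
by apply: (continuous_measurable_plane oE); exact: finite_part_continuous.
Qed.

Lemma finite_part_boundary (eta : R) : 0 < eta -> forall zeta, boundary D zeta ->
  \forall z \near zeta, D z -> `|U z| <= eta.
Proof.
move=> eta0 zeta bz; have := vanishing_near_boundary vu eta0 bz.
by apply: filterS => z h Dz; rewrite finite_part_fine // ltW // h.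
Qed.

(** Local integrability takes care of a compact subset of D, outside of which
    the boundary condition bounds U. *)
Lemma finite_part_integrable : area.-integrable setT (EFin \o U).
Proof.
have [K [cK KD KP]] := near_boundary_compact bD (finite_part_boundary ltr01).
have mK := compact_measurable_plane cK.
have [iK _] := fu; have m1 : measurable_fun (K : set P2) (fun=> 1 : R) by exact: measurable_cst.
have b1 : exists M : R, forall z : R * R, K z -> `|(fun=> 1 : R) z| <= M.
  by exists 1 => z _; rewrite normr1.
have [i1 _] := integral_fine mK (iK K cK KD) m1 b1.
have i2 : area.-integrable setT ((EFin \o (fun z => fine (u z) * 1)) \_ K).
  exact: (iffLR (integrable_mkcond _ mK) i1).
have [B B0 DB] := bounded_box bD.
have i3 : area.-integrable setT (EFin \o (\1_(box B) : R * R -> R)).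
  apply: (@integrable_bounded_box _ B).
  - by apply: measurable_indic; exact: measurable_box.
  - by exists 1 => z; rewrite indicE ger0_norm ?ler0n // lern1 leq_b1.
  - by move=> z nB; rewrite indicE memNset.
have i4 := integrableD measurableT (integrable_abse i2) i3.
apply: (le_integrable measurableT _ _ i4).
  by apply/measurable_EFinP; exact: measurable_finite_part.
move=> z _ /=.
have b0 : (0 : R) <= \1_(box B) z by rewrite indicE.
rewrite gee0_abs; last by apply: adde_ge0 => //; rewrite lee_fin.
case: (pselect (K z)) => Kz.
  rewrite patchE mem_set //= mulr1 -(finite_part_fine (KD z Kz)) -EFinD lee_fin lerDl //.
rewrite patchE memNset // abse0 add0e lee_fin.
case: (pselect (D z)) => Dz; last first.
  by rewrite finite_part_off ?normr0 // => -[].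
by rewrite indicE mem_set ?KP //; exact: DB.
Qed.

Let qD z : R := if `[< D z >] then q z else 0.

Let qDE z : D z -> qD z = q z.
Proof. by rewrite /qD => h; case: asboolP. Qed.

Let qD0 z : ~ D z -> qD z = 0.
Proof. by rewrite /qD => h; case: asboolP. Qed.

Let Q0 : 0 <= Q. Proof. exact: le_trans (normr_ge0 _) (Qq Dw). Qed.

Let qDQ z : `|qD z| <= Q.
Proof.
by case: (pselect (D z)) => Dz; [rewrite qDE // Qq|rewrite qD0 // normr0].
Qed.

Let mqD : measurable_fun [set: P2] qD.
Proof.
have -> : qD = q \_ D.
  apply/funext => z; rewrite patchE; case: (pselect (D z)) => Dz.
    by rewrite mem_set // qDE.
  by rewrite memNset // qD0.
apply/(measurable_restrictT _ (open_measurable_plane oD)).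
exact: continuous_measurable_plane.
Qed.

Lemma weak_identity phi K : compact K -> K `<=` D -> vanish_off K phi -> C2 setT phi ->
  intp (fun z => U z * laplacian phi z) = intp (fun z => U z * qD z * phi z) + phi w.
Proof.
move=> cK KD vK C2p.
have mK := compact_measurable_plane cK.
have E := fundamental_C2 oD cq fu C2p cK KD vK.
have [ms bs] := schrodinger_bounded cK KD oD cq C2p.
have vl := vanish_laplacian cK vK.
have s0 z : ~ K z -> schrodinger q phi z = 0.
  by move=> nK; rewrite /schrodinger (vl z nK) (vK z nK) mulr0 subr0.
have [_ E2] := integral_fine mK (fu.1 K cK KD) ms bs.
have E3 : (\int[area]_(z in D) (u z * (schrodinger q phi z)%:E) =
           \int[area]_(z in K) (u z * (schrodinger q phi z)%:E))%E.
  rewrite integral_mkcond [RHS]integral_mkcond; apply: eq_integral => z _.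
  rewrite !patchE; case: (pselect (K z)) => Kz.
    by rewrite !mem_set //; exact: KD.
  by rewrite (memNset Kz) s0 // mule0; case: ifP.
have E4 : (\int[area]_(z in K) (fine (u z) * schrodinger q phi z)%:E =
           \int[area]_z (U z * schrodinger q phi z)%:E)%E.
  rewrite integral_mkcond; apply: eq_integral => z _; rewrite patchE.
  case: (pselect (K z)) => Kz; first by rewrite mem_set // (finite_part_fine (KD z Kz)).
  by rewrite memNset // (s0 z Kz) mulr0.
have I : intp (fun z => U z * schrodinger q phi z) = phi w.
  by rewrite /intp /Rintegral -E4 -E2 -E3 E.
have iU := finite_part_integrable.
have Cl := laplacian_Cc cK vK C2p.
have [m1 _ hm1] := Cc_bounded Cl.
have cphi : continuous phi by case: C2p => c _ _ z; exact: c.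
have Cp : Cc phi by split => //; exists K.
have [m2 m20 hm2] := Cc_bounded Cp.
have i1 := integrable_mul_bounded iU (continuous_measurableT Cl.1) hm1.
have mqp : measurable_fun [set: P2] (fun z => qD z * phi z).
  by apply: measurable_funM => //; exact: continuous_measurableT.
have bqp z : `|qD z * phi z| <= Q * m2 by rewrite normrM; apply: ler_pM.
have i2 := integrable_mul_bounded iU mqp bqp.
have E5 : (fun z => U z * schrodinger q phi z) =
   (fun z => U z * laplacian phi z - U z * (qD z * phi z)).
  apply/funext => z; rewrite -mulrBr; congr (_ * _); rewrite /schrodinger.
  case: (pselect (K z)) => Kz; first by rewrite (qDE (KD z Kz)).
  by rewrite (vK z Kz) !mulr0.
have := etrans (esym (congr1 intp E5)) I.
rewrite /intp (RintegralB measurableT i1 i2) -/(intp _) -/(intp _).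
have -> : (fun z => U z * qD z * phi z) = (fun z => U z * (qD z * phi z)).
  by apply/funext => z; rewrite mulrA.
by move=> /eqP; rewrite subr_eq addrC => /eqP.
Qed.

(** U and G z are singular at different points, and near each of them the other
    factor is bounded. *)
Lemma product_integrable z : (D `\ w) z ->
  area.-integrable setT (EFin \o (fun y => U y * qD y * G z y)).
Proof.
move=> Ez; have Dz : D z by case: Ez.
have iU := finite_part_integrable; have iG := gam_integrable Dz.
pose m := `|U z| + 1.
have nV : \forall y \near z, `|U y| <= m.
  have c := finite_part_continuous Ez.
  have c1 : {for z, continuous (fun y => `|U y|)} by exact: (cvg_norm c).
  have : \forall y \near z, `|U y| < m by apply: (cvgr_lt _ c1); rewrite /m ltrDl.
  by apply: filterS => y /ltW.
have [_ _ bd _ _] := hg Dz.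
have [M0 [_ hM]] := bd _ nV.
pose M := `|M0| + 1.
have M00 : 0 <= M by rewrite /M addr_ge0.
have m00 : 0 <= m by rewrite /m addr_ge0.
have GM y : ~ (`|U y| <= m) -> `|G z y| <= M.
  move=> nVy; case: (pselect ((D `\ z) y)) => Ey; last by rewrite gam_off // normr0.
  rewrite gamE //; have := hM M; rewrite /M (le_lt_trans (ler_norm _)) ?ltrDl // => /(_ isT).
  by apply; split => //; case: Ey.
have i1 := integrableZl measurableT (Q * m) (integrable_norm iG).
have i2 := integrableZl measurableT (Q * M) (integrable_norm iU).
have i3 := integrableD measurableT i1 i2.
apply: (le_integrable measurableT _ _ i3).
  apply/measurable_EFinP.
  exact: (measurable_funM (measurable_funM measurable_finite_part mqD) (measurable_gam oD hg Dz)).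
move=> y _ /=; rewrite lee_fin.
apply: le_trans (ler_norm _).
rewrite !normrM (mulrC `|U y|) -!mulrA -mulrDr.
apply: ler_pM; [exact: normr_ge0|by rewrite mulr_ge0|exact: qDQ|].
case: (pselect (`|U y| <= m)) => h.
  apply: (@le_trans _ _ (m * `|G z y|)); first by apply: ler_wpM2r.
  by rewrite lerDl mulr_ge0.
apply: (@le_trans _ _ (M * `|U y|)); last by rewrite lerDr mulr_ge0.
by rewrite mulrC; apply: ler_wpM2r => //; exact: GM.
Qed.

(** [representation] with v = G z, whose flux is one. It asks for a coefficient
    that vanishes at the pole z, so q is changed at that point. *)
Lemma integral_equation z : (D `\ w) z ->
  U z = G w z + intp (fun y => U y * qD y * G z y).
Proof.
move=> Ez; have Dz : D z by case: Ez.
have Ew : (D `\ z) w by split => // wz; case: Ez => _; apply.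
pose q' y := if y == z then 0 else qD y.
have mq' : measurable_fun [set: P2] q'.
  have -> : q' = qD \_ (~` [set z]).
    apply/funext => y; rewrite patchE /q'; have [->|/eqP yz] := eqVneq y z.
      by rewrite memNset // => h; exact: h.
    by rewrite mem_set.
  apply/(measurable_restrictT _ (measurableC (measurable_point z))).
  exact: measurable_funTS.
have E1 : (fun y => U y * q' y * G z y) = (fun y => U y * qD y * G z y).
  apply/funext => y; rewrite /q'; case: eqP => [->|//].
  by rewrite (@gam_off _ D g z z) ?mulr0 // => -[_]; apply.
have PP := gam_pole_potential oD bD hg Dz.
have neg y : (D `\ z) y -> G z y < 0 by exact: (gam_lt0 oD bD cD hg Dz).
have mU := measurable_finite_part.
have bd (eta : R) : 0 < eta -> exists2 d, 0 < d &
     forall y, (D `\ z) y -> - d <= G z y -> `|U y| <= eta.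
  move=> eta0; apply: (near_boundary_level oD bD cD hg (P := fun y => `|U y| <= eta) Dz).
  exact: finite_part_boundary.
have := representation PP mU mq' Ew neg (finite_part_continuous Ez) bd (kappa := 1).
rewrite (flux_gam oD bD cD hg Dz) !mul1r E1.
have -> : G z w = G w z by exact: (gam_sym oD bD cD hg Dz Ew).
rewrite (addrC (intp _)); apply.
- move=> y nE; rewrite /q'; case: eqP => [_|yz]; first by rewrite mulr0.
  by rewrite qD0 ?mulr0 // => Dy; apply: nE.
- exact: product_integrable.
- move=> phi K cK KD vK C2p _; rewrite mul1r (weak_identity cK KD vK C2p).
  congr (_ + _); apply: (intp_off_point (a := z)).
  + have cphi : continuous phi by case: C2p => c _ _ y; exact: c.
    exact: (measurable_funM (measurable_funM mU mqD) (continuous_measurableT cphi)).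
  + have cphi : continuous phi by case: C2p => c _ _ y; exact: c.
    exact: (measurable_funM (measurable_funM mU mq') (continuous_measurableT cphi)).
  + by move=> y /eqP yz; rewrite /q' (negbTE yz).
Qed.

End SchrodingerRepresentation.

(** * The Neumann series and its remainders *)

Section NeumannSeries.
Set Implicit Arguments.
Unset Strict Implicit.
Context {R : realType}.
Local Notation P2 := (measurableTypeR R * measurableTypeR R)%type.
Variables (D : set (R * R)) (G : R * R -> R * R -> R) (c B M : R).
Hypotheses (oD : open D) (DB : D `<=` box B) (c0 : 0 <= c) (M0 : 0 <= M)
  (G0 : forall a z, D a -> ~ D z -> G a z = 0) (Gdiag : forall a, G a a = 0)
  (mG : forall a, D a -> measurable_fun [set: P2] (G a))
  (Gle0 : forall a z, D a -> G a z <= 0)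
  (cG : forall y z, D z -> y <> z -> {for z, continuous (fun x => G x y)})
  (GS : forall a z, D a -> `|G a z| <= kB c B a z /\ G a z ^+ 2 <= kB c B a z)
  (SM : forall a, D a -> (\int[area]_z (kB c B a z)%:E <= M%:E)%E).
Variables (w : R * R) (p : R * R -> R) (P : R).
Hypotheses (Dw : D w) (mp : measurable_fun [set: P2] p) (pP : forall y, `|p y| <= P).
Implicit Types (a z y : R * R) (f : R * R -> R).

Let P0 : 0 <= P. Proof. exact: le_trans (normr_ge0 _) (pP w). Qed.

(** The value 0 at w makes all remainders of the series vanish there, so that
    their bounds hold at every point. *)
Definition perturb f z : R :=
  if z == w then 0 else green_operator D G (fun y => p y * f y) z.

(** The terms of the series: G w, which is unbounded, and the bounded ones that
    follow. *)
Definition admissible f := [/\ measurable_fun [set: P2] f,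
  forall y, ~ D y -> f y = 0 &
  exists2 m, 0 <= m & (forall y, `|f y| <= m) \/ (forall y, `|f y| <= m * `|G w y|)].

Lemma admissible_bound f : admissible f -> exists2 K, 0 <= K & forall z, D z ->
  area.-integrable setT (EFin \o (fun y => p y * f y * G z y)) /\
  `|intp (fun y => p y * f y * G z y)| <= K.
Proof.
move=> [mf _ [m m0 H]].
have mpf : measurable_fun [set: P2] (fun y => p y * f y) by exact: measurable_funM.
have Pm : 0 <= P * m by rewrite mulr_ge0.
case: H => H.
  exists (P * m * M); first by rewrite mulr_ge0.
  move=> z Dz; apply: (operator_bounded c0 mG GS SM Dz mpf Pm) => y.
  by rewrite normrM; apply: ler_pM.
exists (P * m * (2 * M)); first by rewrite !mulr_ge0.
move=> z Dz; apply: (operator_green c0 mG GS SM Dz Dw mpf Pm) => y.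
by rewrite normrM -mulrA; apply: ler_pM.
Qed.

Let measurable_mul_p f : measurable_fun [set: P2] f ->
  measurable_fun [set: P2] (fun y => p y * f y).
Proof. by move=> mf; exact: measurable_funM. Qed.

Lemma admissible_integrable f : admissible f ->
  area.-integrable setT (EFin \o (fun y => p y * f y)).
Proof.
move=> [mf f0 [m m0 H]]; have mpf := measurable_mul_p mf.
case: H => H.
  apply: (@integrable_bounded_box _ B) => //.
    by exists (P * m) => y; rewrite normrM; apply: ler_pM.
  by move=> y nB; rewrite f0 ?mulr0 // => /DB.
have iG : area.-integrable setT (EFin \o G w).
  apply: (le_integrable measurableT _ _ (kB_integrable c0 SM Dw)).
    by apply/measurable_EFinP; exact: mG.
  by move=> z _ /=; rewrite lee_fin; apply: le_trans (GS z Dw).1 (ler_norm _).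
have i := integrableZl measurableT (P * m) (integrable_norm iG).
apply: (le_integrable measurableT _ _ i); first exact/measurable_EFinP.
move=> y _ /=; rewrite lee_fin; apply: le_trans (ler_norm _).
by rewrite normrM -mulrA; apply: ler_pM.
Qed.

Lemma perturb_admissible f : admissible f -> admissible (perturb f) /\
  exists2 m, 0 <= m & forall y, `|perturb f y| <= m.
Proof.
move=> Af; have [K K0 HK] := admissible_bound Af.
have [mf f0 _] := Af.
have bd y : `|perturb f y| <= K.
  rewrite /perturb; case: eqP => _; first by rewrite normr0.
  case: (pselect (D y)) => Dy; first by rewrite green_operatorE //; have [] := HK y Dy.
  by rewrite /green_operator; case: asboolP => // _; rewrite normr0.
have mo : measurable_fun [set: P2] (green_operator D G (fun y => p y * f y)).
  apply: (green_operator_measurable oD mG Gle0 cG (measurable_mul_p mf)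
           (admissible_integrable Af)).
  by move=> z Dz; have [] := HK z Dz.
split; last by exists K.
split; last by exists K => //; left.
  have -> : perturb f = (green_operator D G (fun y => p y * f y)) \_ (~` [set w]).
    apply/funext => y; rewrite patchE /perturb; have [->|/eqP yw] := eqVneq y w.
      by rewrite memNset // => h; exact: h.
    by rewrite mem_set.
  apply/(measurable_restrictT _ (measurableC (measurable_point w))).
  exact: measurable_funTS.
move=> y nD; rewrite /perturb; case: eqP => // _.
by rewrite /green_operator; case: asboolP.
Qed.

Fixpoint neumann n : R * R -> R := if n is n'.+1 then perturb (neumann n') else G w.

Lemma neumann_admissible n : admissible (neumann n).
Proof.
elim: n => [|n IH] /=; last by have [] := perturb_admissible IH.
split; [exact: mG|by move=> y; exact: G0|].
by exists 1 => //; right => y; rewrite mul1r.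
Qed.

Lemma neumann_w n : neumann n w = 0.
Proof. by case: n => [|n] /=; [exact: Gdiag|rewrite /perturb eqxx]. Qed.

Section Perturbation.
Variables (eps : R) (U : R * R -> R).
Hypotheses (mU : measurable_fun [set: P2] U)
  (iU : area.-integrable setT (EFin \o U))
  (U0 : forall y, ~ (D `\ w) y -> U y = 0)
  (HU : forall z, (D `\ w) z ->
    area.-integrable setT (EFin \o (fun y => U y * (eps * p y) * G z y)) /\
    U z = G w z + intp (fun y => U y * (eps * p y) * G z y)).

Definition remainder n z : R := U z - \sum_(k < n) eps ^+ k * neumann k z.
Local Notation r := remainder.

Lemma remainder_off n y : ~ (D `\ w) y -> r n y = 0.
Proof.
move=> nE; rewrite /r U0 // sub0r big1 ?oppr0 // => k _.
case: (pselect (D y)) => Dy.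
  have -> : y = w by apply: contrapT => yw; apply: nE.
  by rewrite neumann_w mulr0.
by have [_ h _] := neumann_admissible k; rewrite h // mulr0.
Qed.

Lemma measurable_remainder n : measurable_fun [set: P2] (r n).
Proof.
apply: measurable_funB => //; apply: measurable_sum => k.
by apply: measurable_funM; [exact: measurable_cst|have [] := neumann_admissible k].
Qed.

Lemma remainderS n z : r n.+1 z = r n z - eps ^+ n * neumann n z.
Proof. by rewrite /r big_ord_recr /= opprD addrA. Qed.

(** For n = 0 this is the integral equation for U; then it propagates by
    linearity. *)
Lemma remainder_rec n z : (D `\ w) z ->
  area.-integrable setT (EFin \o (fun y => eps * p y * r n y * G z y)) /\
  r n.+1 z = intp (fun y => eps * p y * r n y * G z y).
Proof.
move=> Ez; have Dz : D z by case: Ez.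
elim: n => [|n [IH1 IH2]].
  have E : (fun y => eps * p y * r 0 y * G z y) = (fun y => U y * (eps * p y) * G z y).
    by apply/funext => y; rewrite /r big_ord0 subr0 (mulrC (eps * p y)).
  rewrite E; have [i e] := HU Ez; split => //.
  by rewrite /r big_ord_recr big_ord0 /= add0r mul1r e addrAC subrr add0r.
have [K K0 HK] := admissible_bound (neumann_admissible n).
have [i2 _] := HK z Dz.
have i3 := integrableZl measurableT (eps ^+ n.+1) i2.
have E : (fun y => eps * p y * r n.+1 y * G z y) =
  (fun y => eps * p y * r n y * G z y - eps ^+ n.+1 * (p y * neumann n y * G z y)).
  apply/funext => y; rewrite remainderS exprS; move: (eps ^+ n) => t; ring.
rewrite E; split; first exact: (integrableB measurableT IH1 i3).
rewrite remainderS IH2 /intp (RintegralB measurableT IH1 i3) -/(intp _) -/(intp _).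
congr (_ - _); rewrite /intp (RintegralZl (eps ^+ n.+1) measurableT i2) /=.
congr (_ * _); rewrite /perturb ifN; first by rewrite green_operatorE.
by apply/eqP; case: Ez.
Qed.

Let theta := `|eps| * P * M.
Let epsP y : `|eps * p y| <= `|eps| * P.
Proof. by rewrite normrM; apply: ler_wpM2l. Qed.

Let eP0 : 0 <= `|eps| * P. Proof. by rewrite mulr_ge0. Qed.
Let theta0 : 0 <= theta. Proof. by rewrite mulr_ge0. Qed.

Lemma remainder_step n (m : R) : 0 <= m -> (forall y, `|r n y| <= m) ->
  forall y, `|r n.+1 y| <= theta * m.
Proof.
move=> m0 H y; case: (pselect ((D `\ w) y)) => Ey; last first.
  by rewrite remainder_off // normr0 mulr_ge0.
have Dy : D y by case: Ey.
have [_ ->] := remainder_rec n Ey.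
have mf : measurable_fun [set: P2] (fun y => eps * p y * r n y).
  apply: measurable_funM; last exact: measurable_remainder.
  by apply: measurable_funM => //; exact: measurable_cst.
have b x : `|eps * p x * r n x| <= `|eps| * P * m by rewrite normrM; apply: ler_pM.
have m1 : 0 <= `|eps| * P * m by rewrite mulr_ge0.
have [_ h] := operator_bounded c0 mG GS SM Dy mf m1 b.
by apply: le_trans h _; rewrite /theta mulrAC.
Qed.

(** Split U as r 1 + G w in the integral equation. *)
Lemma remainder1_step (m : R) : 0 <= m -> (forall y, `|r 1 y| <= m) ->
  forall y, `|r 1 y| <= theta * m + 2 * theta.
Proof.
move=> m0 H y; case: (pselect ((D `\ w) y)) => Ey; last first.
  by rewrite remainder_off // normr0 addr_ge0 // mulr_ge0.
have Dy : D y by case: Ey.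
have mep : measurable_fun [set: P2] (fun y => eps * p y).
  by apply: measurable_funM => //; exact: measurable_cst.
have mf : measurable_fun [set: P2] (fun y => eps * p y * r 1 y).
  by apply: measurable_funM => //; exact: measurable_remainder.
have mg : measurable_fun [set: P2] (fun y => eps * p y * G w y).
  by apply: measurable_funM => //; exact: mG.
have b x : `|eps * p x * r 1 x| <= `|eps| * P * m by rewrite normrM; apply: ler_pM.
have bg x : `|eps * p x * G w x| <= `|eps| * P * `|G w x|.
  by rewrite normrM; apply: ler_wpM2r.
have m1 : 0 <= `|eps| * P * m by rewrite mulr_ge0.
have [i1 h1] := operator_bounded c0 mG GS SM Dy mf m1 b.
have [i2 h2] := operator_green c0 mG GS SM Dy Dw mg eP0 bg.
have [_ ->] := remainder_rec 0 Ey.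
have -> : (fun x => eps * p x * r 0 x * G y x) =
    (fun x => eps * p x * r 1 x * G y x + eps * p x * G w x * G y x).
  apply/funext => x; rewrite (remainderS 0) expr0 mul1r /=; ring.
rewrite /intp (RintegralD measurableT i1 i2) -/(intp _) -/(intp _).
apply: (le_trans (ler_normD _ _)); apply: le_trans (lerD h1 h2) _.
by rewrite le_eqVlt; apply/orP; left; apply/eqP; rewrite /theta; ring.
Qed.

(** The supremum s of |r 1| is finite by [apriori_bound] and satisfies s <=
    theta s + 2 theta. *)
Lemma remainder1_bound : theta <= 2^-1 -> forall y, `|r 1 y| <= 4 * theta.
Proof.
move=> th.
have e1 z : r 1 z = U z - G w z by rewrite /r big_ord_recr big_ord0 /= add0r mul1r.
have [m m0 Hm] : exists2 m, 0 <= m & forall z, `|r 1 z| <= m.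
  have Uw y : ~ (D `\ w) y -> U y = G w y.
    move=> nE; rewrite U0 //; case: (pselect (D y)) => Dy; last by rewrite G0.
    by have -> : y = w by [apply: contrapT => yw; apply: nE]; rewrite Gdiag.
  have U0' y : ~ D y -> U y = 0 by move=> nD; apply: U0 => -[].
  have [m m0 H] := apriori_bound DB c0 M0 G0 mG GS SM Dw mU Uw U0' iU epsP HU.
  by exists m => // z; rewrite e1.
pose E := [set `|r 1 y| | y in [set: R * R]].
have Ene : E !=set0 by exists `|r 1 w|; exists w.
have hs : has_sup E by split => //; exists m => _ [y _ <-]; exact: Hm.
have ub y : `|r 1 y| <= sup E by apply: (sup_upper_bound hs); exists y.
have s0 : 0 <= sup E by exact: le_trans (normr_ge0 _) (ub w).
have s1 : sup E <= theta * sup E + 2 * theta.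
  by apply: ge_sup => // _ [y _ <-]; exact: remainder1_step.
have s2 : theta * sup E <= 2^-1 * sup E by apply: ler_wpM2r.
by move=> y; apply: le_trans (ub y) _; lra.
Qed.

Lemma remainder_bound n : theta <= 2^-1 -> forall y, `|r n.+1 y| <= 4 * theta * theta ^+ n.
Proof.
move=> th; elim: n => [|n IH] y; first by rewrite mulr1; exact: remainder1_bound.
have m0 : 0 <= 4 * theta * theta ^+ n by rewrite !mulr_ge0 // exprn_ge0.
by apply: le_trans (remainder_step m0 IH y) _; rewrite exprS mulrCA.
Qed.

Lemma neumann_converges z : theta <= 2^-1 ->
  (fun N => \sum_(k < N) eps ^+ k * neumann k z) @ \oo --> U z.
Proof.
move=> th; apply/cvgrPdist_le => e e0.
have t1 : `|theta| < 1 by rewrite ger0_norm //; lra.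
have c1 := @cvg_geometric R (4 * theta) theta t1.
have c2 : \forall n \near \oo, `|geometric (4 * theta) theta n| <= e.
  exact: (cvgr0_norm_le _ c1 _ e0).
have [N _ HN] := c2; exists N.+1 => // -[//|n] /= Nn.
apply: le_trans (remainder_bound n th z) _.
by apply: le_trans (ler_norm _) (HN n Nn).
Qed.

End Perturbation.
End NeumannSeries.

(** * Iterates of the Green operator and the expansion *)

Section GreenOperatorIterates.
Set Implicit Arguments.
Unset Strict Implicit.
Context {R : realType}.
Local Notation P2 := (measurableTypeR R * measurableTypeR R)%type.
Implicit Types (a b z : R * R).

Lemma integral_off_two_points a b (F1 F2 : P2 -> \bar R) : measurable_fun [set: P2] F2 ->
  (forall z, z <> a -> z <> b -> F1 z = F2 z) ->
  (\int[area]_z F1 z = \int[area]_z F2 z)%E.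
Proof.
move=> mF2 E.
pose N : set P2 := [set a] `|` [set b].
have mN : measurable N by apply: measurableU; exact: measurable_point.
have mF1 : measurable_fun [set: P2] F1.
  rewrite -(setUv N); apply/measurable_funU => //; first exact: measurableC.
  split.
    apply/measurable_funU; [exact: measurable_point|exact: measurable_point|].
    by split; exact: measurable_fun_set1.
  apply: (@eq_measurable_fun _ _ _ _ _ F2); last exact: measurable_funTS.
  by move=> z; rewrite inE => nN; rewrite E // => h; apply: nN; [left|right].
apply: ae_eq_integral => //.
exists N; split => //.
  have [x y] : area ([set a] : set P2) = 0%E /\ area ([set b] : set P2) = 0%E.
    by split; exact: area_point.
  apply/eqP; rewrite eq_le measure_ge0 andbT.
  apply: le_trans (measureU2 _ _ _) _; [exact: measurable_point|exact: measurable_point|].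
  have xy := etrans (congr2 (fun s t => (s + t)%E) x y) (adde0 _).
  by apply: (le_trans (y := 0%E)) => //; rewrite le_eqVlt; apply/orP; left; apply/eqP.
move=> z /= nE; apply: contrapT => nN; apply: nE => _.
by apply: E => h; apply: nN; [left|right].
Qed.

Variables (D : set (R * R)) (g : R * R -> R * R -> \bar R).
Hypotheses (oD : open D) (bD : bounded_set D) (cD : connected D)
  (hg : green_function D g).
Variables (w : R * R) (p : R * R -> R).
Hypothesis Dw : D w.
Local Notation G := (gam D g).

Definition extend0 z : R := if `[< D z >] then p z else 0.
Local Notation pD := extend0.

(** By symmetry the Green function is continuous in its pole. *)
Lemma gam_pole_continuous y z : D z -> y <> z -> {for z, continuous (fun x => G x y)}.
Proof.
move=> Dz yz; case: (pselect (D y)) => Dy; last first.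
  apply: (@continuous_near _ (fun=> 0)); last exact: cst_continuous.
  by near=> x; rewrite gam_off // => -[].
have Ez : (D `\ y) z by split => // zy; apply: yz.
have [[cg _ _] _] := gam_C2 oD hg Dy.
apply: continuous_near (cg z Ez).
have := near_punctured oD Ez; apply: filterS => x Ex.
exact: (gam_sym oD bD cD hg Dy Ex).
Unshelve. all: by end_near. Qed.

(** The extended-real and the real integrands agree off the two poles w and z. *)
Lemma green_op_real (h : R * R -> \bar R) (f : R * R -> R) z : D z ->
  (forall y, (D `\ w) y -> h y = (f y)%:E) ->
  area.-integrable setT (EFin \o (fun y => pD y * f y * G z y)) ->
  green_op D g (mult_op p h) z = (intp (fun y => pD y * f y * G z y))%:E.
Proof.
move=> Dz hf i.
rewrite /green_op integral_mkcond.
rewrite (@integral_off_two_points w z _ (EFin \o (fun y => pD y * f y * G z y))).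
- by rewrite /intp /Rintegral fineK //; exact: (integrable_fin_num measurableT i).
- exact: measurable_int i.
- move=> y yw yz; rewrite patchE; case: (pselect (D y)) => Dy; last first.
    by rewrite memNset //= /pD; case: asboolP => // _; rewrite !mul0r.
  rewrite mem_set // /mult_op hf //=.
  have Ey : (D `\ z) y by [].
  have Ez : (D `\ y) z by split => // zy; apply: yz.
  rewrite (gam_fin hg Dy Ez) (gam_sym oD bD cD hg Dy Ez) -!EFinM.
  by rewrite /pD; case: asboolP.
Qed.

End GreenOperatorIterates.

Section Coefficient.
Set Implicit Arguments.
Unset Strict Implicit.
Context {R : realType}.

Lemma continuous_bounded_closure (D U : set (R * R)) (p : R * R -> R) :
  bounded_set D -> closure D `<=` U -> {in U, continuous p} ->
  exists2 P, 0 <= P & forall z, D z -> `|p z| <= P.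
Proof.
move=> bD DU cp; have [B B0 DB] := bounded_box bD.
have cK : compact (closure D).
  apply: (subclosed_compact _ (@box_compact R B)); first exact: closed_closure.
  have cB : closed (box B : set (R * R)) by apply: compact_closed; [exact: norm_hausdorff|exact: box_compact].
  rewrite [X in _ `<=` X](_ : _ = closure (box B : set (R * R))).
    exact: closure_subset.
  exact/closure_id.
have [P P0 HP] := continuous_compact_bounded cK (fun z cz => cp z (mem_set (DU z cz))).
by exists P => [|z Dz]; [exact: ltW|apply: HP; exact: subset_closure].
Qed.

End Coefficient.

Theorem theorem5 (R : realType) (D : set (R * R)) (w : R * R)
    (p : R * R -> R)
    (g : R * R -> R * R -> \bar R)
    (gs : R -> R * R -> R * R -> \bar R)
    (hD : bounded_domain D) (hbd : real_analytic_boundary D) (hw : D w)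
    (hp : exists U : set (R * R),
        [/\ open U, closure D `<=` U & smooth U p])
    (hg : green_function D g)
    (hgs : \forall eps \near (0 : R),
        schrodinger_green_function D (fun z => eps * p z) (gs eps)) :
  let gw := fun z => g z w in
  let TP := green_op D g \o mult_op p in
  (forall eta : R, 0 < eta -> \forall eps \near (0 : R),
     forall z, D z -> z <> w ->
       (`| gs eps z w - gw z - eps%:E * TP gw z | <= (eta * `|eps|)%:E)%E) /\
  (\forall eps \near (0 : R), forall z, D z ->
     (fun N => \sum_(0 <= n < N) ((eps ^+ n)%:E * iter n TP gw z))%E
       @ \oo --> gs eps z w).
Proof.
move=> gw TP.
have [_ oD cD bD] := hD.
have [V [_ DV sp]] := hp; have [cpV _] := sp 0%N.
have [P P0 pP] := continuous_bounded_closure bD DV cpV.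
have cp z : D z -> {for z, continuous p}.
  by move=> Dz; apply: cpV; rewrite inE; apply: DV; exact: subset_closure.
have [c [B [c0 B0 DB GS]]] := gam_kB oD bD hg.
have [M M0 SMB] := kB_integral c0 B0.
have SM a Da := SMB a (DB a Da).
set G := gam D g in GS.
have G0 a z : D a -> ~ D z -> G a z = 0 by move=> _ nD; apply: gam_off => -[].
have Gd a : G a a = 0 by apply: gam_off => -[_]; apply.
have mG a : D a -> measurable_fun setT (G a) := @measurable_gam R D g oD hg a.
have Gle0 a z : D a -> G a z <= 0.
  move=> Da; case: (pselect ((D `\ a) z)) => Ez; first exact: (gam_le0 oD bD hg Da Ez).
  by rewrite /G gam_off.
have cG := gam_pole_continuous oD bD cD hg.
pose pD := extend0 D p.
have pDE z : D z -> pD z = p z by rewrite /pD /extend0; case: asboolP.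
have pDP y : `|pD y| <= P.
  by rewrite /pD /extend0; case: asboolP => [/pP//|_]; rewrite normr0.
have mpD : measurable_fun setT pD.
  have -> : pD = p \_ D.
    apply/funext => z; rewrite patchE; case: (pselect (D z)) => Dz.
      by rewrite mem_set // pDE.
    by rewrite memNset // /pD /extend0; case: asboolP.
  apply/(measurable_restrictT _ (open_measurable_plane oD)).
  exact: continuous_measurable_plane.
pose v := neumann D G w pD.
have va n : admissible D G w (v n) := neumann_admissible oD DB c0 M0 G0 mG Gle0 cG GS SM hw mpD pDP n.
have val n := admissible_bound c0 M0 mG GS SM hw mpD pDP (va n).
have step n z : D z -> (forall y, (D `\ w) y -> iter n TP gw y = (v n y)%:E) ->
    iter n.+1 TP gw z = (intp (fun y => pD y * v n y * G z y))%:E.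
  move=> Dz H; have [K _ /(_ z Dz)[i _]] := val n.
  exact: (green_op_real oD bD cD hg Dz H i).
have iterE n : forall y, (D `\ w) y -> iter n TP gw y = (v n y)%:E.
  elim: n => [|n IH] y Ey; first exact: (gam_fin hg hw Ey).
  have Dy : D y by case: Ey.
  rewrite (step n y Dy IH) /v /= /perturb ifN; last by apply/eqP; case: Ey.
  by rewrite green_operatorE.
pose theta (eps : R) := `|eps| * P * M.
pose solves eps (U : R * R -> R) := [/\ forall z, (D `\ w) z -> gs eps z w = (U z)%:E,
    gs eps w w = -oo%E,
    theta eps <= 2^-1 -> forall n y,
      `|remainder D G w pD eps U n.+1 y| <= 4 * theta eps * theta eps ^+ n &
    theta eps <= 2^-1 -> forall z,
      (fun N => \sum_(k < N) eps ^+ k * v k z) @ \oo --> U z].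
have pert : \forall eps \near (0 : R), exists U, solves eps U.
  apply: filterS hgs => eps he; have [uw [fin cu] fu vu] := he w hw.
  pose q z := eps * p z.
  have cq z : D z -> {for z, continuous q}.
    by move=> Dz; apply: cvgM; [exact: cvg_cst|exact: cp].
  have Qq z : D z -> `|q z| <= `|eps| * P.
    by move=> Dz; rewrite normrM; apply: ler_wpM2l => //; exact: pP.
  pose U := finite_part D w (fun z => gs eps z w).
  have qE (z : R * R) : (fun y => U y * (eps * pD y) * G z y) =
     (fun y => U y * (if `[< D y >] then q y else 0) * G z y).
    apply/funext => y; congr (_ * _ * _); rewrite /pD /extend0; case: asboolP => // _.
    by rewrite mulr0.
  have mU := measurable_finite_part oD cu.
  have iU := finite_part_integrable oD bD uw cu fu vu.
  have U0 y : ~ (D `\ w) y -> U y = 0 by exact: finite_part_off.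
  have HU z : (D `\ w) z ->
     area.-integrable setT (EFin \o (fun y => U y * (eps * pD y) * G z y)) /\
     U z = G w z + intp (fun y => U y * (eps * pD y) * G z y).
    move=> Ez; rewrite qE; split.
      exact: (product_integrable oD bD hg hw uw cu fu vu cq Qq Ez).
    exact: (integral_equation oD bD cD hg hw uw cu fu vu cq Qq Ez).
  exists U; split => //.
  - by move=> z Ez; rewrite /U finite_partE // fineK //; case: Ez => ? ?; exact: fin.
  - move=> th n y.
    exact: (remainder_bound oD DB c0 M0 G0 Gd mG Gle0 cG GS SM hw mpD pDP mU iU U0 HU n th y).
  - move=> th z.
    exact: (neumann_converges oD DB c0 M0 G0 Gd mG Gle0 cG GS SM hw mpD pDP mU iU U0 HU th).
have small (e : R) : 0 < e -> \forall eps \near (0 : R), theta eps <= e.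
  move=> e0; have PM0 : 0 < P * M + 1 by rewrite ltr_wpDl // mulr_ge0.
  have H : \forall eps \near (0 : R), `|0 - eps| < e / (P * M + 1).
    by apply: (cvgr_dist_lt _ _ (cvg_id : id @ (0 : R) --> (0 : R))); rewrite divr_gt0.
  apply: filterS H => eps; rewrite sub0r normrN /theta -mulrA => /ltW h.
  apply: (@le_trans _ _ (e / (P * M + 1) * (P * M))).
    by rewrite ler_wpM2r // mulr_ge0.
  rewrite mulrAC ler_pdivrMr // ler_wpM2l ?(ltW e0) //; lra.
split.
  move=> eta eta0; near=> eps.
  have [U [Ufin Uw rb _]] : exists U, solves eps U by near: eps.
  have t2 : theta eps <= 2^-1 by near: eps; apply: small.
  (* this makes 4 theta^2 at most eta |eps| *)
  have t3 : theta eps <= eta / (4 * (P * M + 1)).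
    by near: eps; apply: small; rewrite divr_gt0 // mulr_gt0 // ltr_wpDl // mulr_ge0.
  move=> z Dz zw; have Ez : (D `\ w) z by [].
  have -> : TP gw z = (v 1%N z)%:E := iterE 1%N z Ez.
  have -> : gw z = (v 0%N z)%:E := iterE 0%N z Ez.
  rewrite (Ufin z Ez) -EFinM -!EFinB abse_EFin lee_fin.
  have -> : U z - v 0%N z - eps * v 1%N z = remainder D G w pD eps U 2 z.
    by rewrite /remainder !big_ord_recr big_ord0 /= -/v add0r expr0 mul1r expr1 opprD addrA.
  apply: le_trans (rb t2 1%N z) _; rewrite expr1.
  set t := theta eps in t2 t3 *.
  have PM0 : 0 < 4 * (P * M + 1) by rewrite mulr_gt0 // ltr_wpDl // mulr_ge0.
  have t0 : 0 <= t by rewrite /t /theta !mulr_ge0.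
  apply: (@le_trans _ _ (4 * t * (eta / (4 * (P * M + 1))))).
    by apply: ler_wpM2l => //; rewrite mulr_ge0.
  rewrite mulrA ler_pdivrMr //.
  have -> : 4 * t * eta = eta * `|eps| * (4 * (P * M)) by rewrite /t /theta; ring.
  by apply: ler_wpM2l; [rewrite mulr_ge0 // ltW|lra].
near=> eps.
have [U [Ufin Uw _ cvU]] : exists U, solves eps U by near: eps.
have t2 : theta eps <= 2^-1 by near: eps; apply: small.
move=> z Dz; have [->|/eqP zw] := eqVneq z w.
  (* at the pole the term of index 0 is -oo and absorbs all others *)
  rewrite Uw; apply: cvg_near_cst; exists 1%N => // -[//|N] _ /=.
  have [gww _ _ _ _] := hg w hw.
  by rewrite big_ltn //= expr0 mul1e /gw gww addNye.
have Ez : (D `\ w) z by [].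
rewrite (Ufin z Ez).
have -> : (fun N => \sum_(0 <= n < N) ((eps ^+ n)%:E * iter n TP gw z))%E =
   EFin \o (fun N => \sum_(k < N) eps ^+ k * v k z).
  apply/funext => N; rewrite big_mkord /= -sumEFin; apply: eq_bigr => k _.
  by rewrite (iterE k z Ez) EFinM.
by apply: cvg_EFin; [exact: nearW|exact: cvU].
Unshelve. all: by end_near. Qed.
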